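(* For every $\varepsilon>0$ there is $K_\varepsilon<\infty$ such that \[ D_m\le K_\varepsilon\, m^{\beta_\star+\varepsilon}\qquad\text{for all integers } m\ge1 . \] In particular, $D_m=o(m^{5/2})$ as $m\to\infty$.
   Context: For integers $m,n\ge1$ let $\mathcal P_m(\mathbb C^n)$ be the space of $m$-homogeneous complex polynomials $P(z)=\sum_{|\alpha|=m}a_\alpha z^\alpha$ on $\mathbb C^n$. Write $\|P\|_\infty=\sup_{z\in\mathbb D^n}|P(z)|$, $q_m=\frac{2m}{m+1}$, and $\|a(P)\|_p=(\sum_\alpha|a_\alpha|^p)^{1/p}$. Define $D_{m,n}=\sup_{0\ne P\in\mathcal P_m(\mathbb C^n)}\|a(P)\|_{q_m}/\|P\|_\infty$ and $D_m=\sup_{n\ge1}D_{m,n}$ (known to be finite). The constant $\beta_\star$ is defined as follows. Let $h(a)=-a\log a-(1-a)\log(1-a)$ for $0<a<1$, let $a_{\max}=\frac12\bigl(1-\frac1{\sqrt2}\bigr)$, and for $0<a<a_{\max}$ put \[ \mu(a)=\frac{1+\sqrt{2(1-2a)^2-1}}2,\qquad B_{\rm diff}(a)=\frac{\log(2\sqrt{e})}{h(a)}-\frac12,\qquad B_{\rm cap}(a)=\frac{3}{2\mu(a)} . \] Then \[ \beta_\star=\inf_{0<a<a_{\max}}\max\{B_{\rm diff}(a),B_{\rm cap}(a)\} \] (numerically $\beta_\star=2.468449871619\ldots$). *)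

(* Defs.v *)
From HB Require Import structures.
From mathcomp Require Import all_boot all_order all_algebra.
From mathcomp Require Import all_classical all_reals all_analysis.
From mathcomp Require Import complex.
(* The notations of mpoly clash with those of mathcomp-analysis. *)
From mathcomp Require Import -(notations) mpoly.

Set Implicit Arguments.
Unset Strict Implicit.
Unset Printing Implicit Defensive.

Import Order.TTheory GRing.Theory Num.Theory.
Import numFieldNormedType.Exports.

Local Open Scope classical_set_scope.
Local Open Scope ring_scope.

(* The modulus of a complex number, as an element of [R]; [`|z|] lives in
   [R[i]]. *)
Definition modC (R : realType) (z : R[i]) : R :=
  ComplexField.Normc.normc z.

Definition homog_poly (R : realType) (m n : nat) : set (mpoly n R[i]) :=
  [set P | P \is ishomog1 m (@mdeg n)].
Arguments homog_poly : clear implicits.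

Definition polydisc (R : realType) (n : nat) : set ('I_n -> R[i]) :=
  [set z | forall i, modC (z i) < 1].
Arguments polydisc : clear implicits.

(* The set is nonempty and bounded, so the real-valued [sup] is the genuine
   supremum. *)
Definition poly_supnorm (R : realType) (n : nat) (P : mpoly n R[i]) : R :=
  sup [set modC (meval z P) | z in polydisc R n].

(* [msupp P] is the finite, duplicate-free list of the multi-indices whose
   coefficient in [P] is nonzero. *)
Definition coef_norm (R : realType) (n : nat) (p : R)
    (P : mpoly n R[i]) : R :=
  (\sum_(alpha <- msupp P) modC (mcoeff alpha P) `^ p) `^ p^-1.

Definition BH_exponent (R : realType) (m : nat) : R := (2 * m)%:R / (m.+1)%:R.

Definition BH_const_dim (R : realType) (m n : nat) : \bar R :=
  ereal_sup [set (coef_norm (BH_exponent R m) P / poly_supnorm P)%:E |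
             P in [set P | homog_poly R m n P /\ P != 0]].

Definition BH_const (R : realType) (m : nat) : \bar R :=
  ereal_sup [set BH_const_dim R m n | n in [set n : nat | (1 <= n)%N]].

Definition entropy (R : realType) (a : R) : R :=
  - a * ln a - (1 - a) * ln (1 - a).

Definition a_max (R : realType) : R := 2^-1 * (1 - (Num.sqrt 2)^-1).

Definition mu (R : realType) (a : R) : R :=
  (1 + Num.sqrt (2 * (1 - 2 * a) ^+ 2 - 1)) / 2.

Definition B_diff (R : realType) (a : R) : R :=
  ln (2 * Num.sqrt (expR 1)) / entropy a - 2^-1.

Definition B_cap (R : realType) (a : R) : R := 3 / (2 * mu a).

(* The range of [a] is nonempty and the values are bounded below by 0, so the
   real-valued [inf] is the genuine infimum. *)
Definition beta_star (R : realType) : R :=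
  inf [set Num.max (B_diff a) (B_cap a) | a in [set a : R | 0 < a < a_max R]].

(* Main.v *)
(* Write [q_m = 2m/(m+1)].  A polynomial bounded by [1] on the torus (here a
   discrete torus of [N]-th roots of unity, [N] large) is shown to satisfy
   [sum_m W_m |a_m|_(q_m)^2 <= 1], where [a_m] is its family of coefficients of
   degree [m] and [W_m = eta m^(-24/5) 225^(1/m)]; the bound [D_m <= K m^(12/5)]
   follows.  The proof is by induction on the largest degree in the sum.  Colour
   the variables with two colours.  Freezing the variables of one colour, the
   induction hypothesis controls the coefficients in the other ones;
   hypercontractivity in the frozen variables turns this into a bound on mixed
   [l^q(l^2)] norms of the coefficients, and the mixed norms of the two colours
   interpolate to the [l^(q_m)] norm.
   - If no exponent of a monomial exceeds [m/2], a uniformly random colouring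
     splits the degree in a balanced way with a definite probability, and the
     binomial factor of the split compensates the ratio of the weights: these
     monomials use up [99/100] of the budget.
   - If one exponent [l] satisfies [m/2 < l < m], a biased random colouring
     isolates that variable at a cost of about [m^(11/10)].  The block of pure
     powers is bounded by an absolute constant thanks to Riesz products, so that
     these monomials contribute [O(sqrt eta)].
   - The pure powers contribute [O(eta)], by Riesz products again.
   Finally [12/5 <= beta_star]: for [a <= 1/7] one has [12/5 <= B_diff a], and for
   [a >= 1/7] one has [21/8 <= B_cap a]. *)
Require Import Defs.
From mathcomp Require Import all_boot all_order all_algebra.
From mathcomp Require Import cyclic separable cyclotomic.
From mathcomp Require Import all_classical all_reals all_analysis.
From mathcomp Require Import complex.
From mathcomp Require Import -(notations) mpoly.
From mathcomp Require Import zify ring lra.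

Set Implicit Arguments.
Unset Strict Implicit.
Unset Printing Implicit Defensive.

Import Order.TTheory GRing.Theory Num.Theory.
Import numFieldNormedType.Exports.

Local Open Scope classical_set_scope.
Local Open Scope ring_scope.

(** Summing over all splits of all degrees thus costs nothing, and as a split into two positive
    degrees only involves smaller ones, the hypothesis for M handles M + 1. Everything is quadratic
    in the coefficients: on squared moduli the exponents become r = s/(s+1) <= 1, so that 1/r = 1 +
    1/s and Minkowski's inequality is reversed. Jensen's inequality then charges a number of classes
    or a total mass only to the power 1/m, and such factors are what 225^(1/m) absorbs; a plain
    factor 3 could not be absorbed in the balanced part. The parameter eta closes the argument: the
    balanced estimate is homogeneous in eta, whereas in the two other ones part of the norm has an
    absolute bound, which leaves a positive power of eta. *)

(** * Hoelder, Jensen and reverse Minkowski inequalities for finite sums *)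

Section MeanInequalities.
Variable R : realType.
Implicit Types (x y t r p : R).

(** The tangent of [ln] at the weighted mean [M] bounds [ln x] and [ln y]; in the weighted average
    the linear terms cancel. *)
Lemma weighted_amgm x y t : 0 <= x -> 0 <= y -> 0 <= t <= 1 ->
  x `^ t * y `^ (1 - t) <= t * x + (1 - t) * y.
Proof.
move=> x0 y0 /andP[t0 t1].
have [->|tn0] := eqVneq t 0; first by rewrite powRr0 subr0 powRr1 // !mul1r mul0r add0r.
have [->|tn1] := eqVneq t 1; first by rewrite subrr powRr0 powRr1 // mul1r mulr1 mul0r addr0.
have s0 : 0 < 1 - t by rewrite subr_gt0 lt_neqAle tn1.
have t0' : 0 < t by rewrite lt_neqAle eq_sym tn0.
have [->|xn0] := eqVneq x 0.
  by rewrite powR0 // mul0r mulr0 add0r mulr_ge0 // ltW.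
have [->|yn0] := eqVneq y 0.
  by rewrite powR0 ?gt_eqF // mulr0 mulr0 addr0 mulr_ge0.
have xp : 0 < x by rewrite lt_neqAle eq_sym xn0.
have yp : 0 < y by rewrite lt_neqAle eq_sym yn0.
set M := t * x + _.
have Mp : 0 < M by rewrite /M addr_gt0 // mulr_gt0.
rewrite /powR (negbTE xn0) (negbTE yn0) -expRD -[leRHS](lnK Mp) ler_expR.
have key z : 0 < z -> ln z <= ln M + (z / M - 1).
  move=> zp; rewrite -[X in ln X <= _](@divfK _ M) ?gt_eqF // lnM ?posrE ?divr_gt0 //.
  rewrite addrC lerD2l -[X in ln X](subrKC 1) addrC.
  have -> : z / M - 1 + 1 = 1 + (z / M - 1) by rewrite addrC.
  by apply: le_ln1Dx; rewrite ltrBDr addrC subrr divr_gt0.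
have := ler_wpM2l t0 (key x xp); have := ler_wpM2l (ltW s0) (key y yp).
have : t * (x / M) + (1 - t) * (y / M) = 1.
  by rewrite !mulrA -mulrDl divff // gt_eqF.
lra.
Qed.

Lemma powRV x r : 0 <= x -> x^-1 `^ r = (x `^ r)^-1.
Proof. by move=> x0; rewrite -powR_inv1 // -powRrM mulN1r powRN. Qed.

Lemma hoelder_sum (I : finType) (P : pred I) (f g : I -> R) t :
  (forall i, P i -> 0 <= f i) -> (forall i, P i -> 0 <= g i) -> 0 <= t <= 1 ->
  \sum_(i | P i) f i `^ t * g i `^ (1 - t) <=
  (\sum_(i | P i) f i) `^ t * (\sum_(i | P i) g i) `^ (1 - t).
Proof.
move=> f0 g0 /andP[t0 t1].
set X := \sum_(i | P i) f i; set Y := \sum_(i | P i) g i.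
have [->|tn0] := eqVneq t 0.
  rewrite subr0 powRr0 mul1r powRr1 ?sumr_ge0 //.
  by apply: ler_sum => i Pi; rewrite powRr0 mul1r powRr1 // g0.
have [->|tn1] := eqVneq t 1.
  rewrite subrr powRr0 mulr1 powRr1 ?sumr_ge0 //.
  by apply: ler_sum => i Pi; rewrite powRr0 mulr1 powRr1 // f0.
have s0 : 1 - t != 0 by rewrite subr_eq0 eq_sym.
have [X0|Xn0] := eqVneq X 0.
  rewrite X0 powR0 // mul0r big1 // => i Pi.
  by rewrite (psumr_eq0P f0 X0) // powR0 // mul0r.
have [Y0|Yn0] := eqVneq Y 0.
  rewrite Y0 powR0 // mulr0 big1 // => i Pi.
  by rewrite (psumr_eq0P g0 Y0) // powR0 // mulr0.
have Xp : 0 < X by rewrite lt_neqAle eq_sym Xn0 sumr_ge0.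
have Yp : 0 < Y by rewrite lt_neqAle eq_sym Yn0 sumr_ge0.
have C0 : 0 < X `^ t * Y `^ (1 - t) by rewrite mulr_gt0 ?powR_gt0.
rewrite -[leRHS]mulr1 -ler_pdivrMl // mulr_sumr.
apply: (@le_trans _ _ (\sum_(i | P i) (t * (f i / X) + (1 - t) * (g i / Y)))).
  apply: ler_sum => i Pi.
  apply: le_trans (weighted_amgm _ _ _); rewrite ?divr_ge0 ?f0 ?g0 ?t0 ?t1 ?(ltW Xp) ?(ltW Yp) //.
  rewrite !powRM ?f0 ?g0 ?invr_ge0 ?(ltW Xp) ?(ltW Yp) //.
  by rewrite !powRV ?(ltW Xp) ?(ltW Yp) // invfM [leRHS]mulrACA [leRHS]mulrC.
rewrite big_split /= -!mulr_sumr -!mulr_suml divff // divff // !mulr1; lra.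
Qed.

(** The l^r quasi-norm. On squared moduli, with [r <= 1], it is the square of the l^(2r) norm of the
    coefficients. *)
Definition lr (I : finType) (r : R) (P : pred I) (f : I -> R) : R :=
  (\sum_(i | P i) f i `^ r) `^ r^-1.

Lemma lr_ge0 (I : finType) r (P : pred I) (f : I -> R) : 0 <= lr r P f.
Proof. exact: powR_ge0. Qed.

Lemma powRVK r x : r != 0 -> 0 <= x -> (x `^ r) `^ r^-1 = x.
Proof. by move=> r0 x0; rewrite -powRrM divff // powRr1. Qed.

Lemma powRKV r x : r != 0 -> 0 <= x -> (x `^ r^-1) `^ r = x.
Proof. by move=> r0 x0; rewrite -powRrM mulVf // powRr1. Qed.

Lemma lrK (I : finType) r (P : pred I) (f : I -> R) : r != 0 ->
  lr r P f `^ r = \sum_(i | P i) f i `^ r.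
Proof. by move=> r0; rewrite powRKV // sumr_ge0 // => i _; exact: powR_ge0. Qed.

Lemma ler_powR2 r x y : 0 <= r -> 0 <= x -> x <= y -> x `^ r <= y `^ r.
Proof. by move=> r0 x0 xy; rewrite ge0_ler_powR // nnegrE // (le_trans x0). Qed.

Lemma ler_lr (I : finType) r (P : pred I) (f g : I -> R) : 0 < r ->
  (forall i, P i -> 0 <= f i <= g i) -> lr r P f <= lr r P g.
Proof.
move=> r0 fg; apply: ler_powR2; first by rewrite invr_ge0 ltW.
  by apply: sumr_ge0 => i _; exact: powR_ge0.
apply: ler_sum => i /fg /andP[f0 fg']; apply: ler_powR2 => //; exact: ltW.
Qed.

(* Jensen's inequality for the convex power [1/r] and a measure [w] of
   arbitrary total mass. *)
Lemma power_mean_sum (I : finType) (P : pred I) (w f : I -> R) r :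
  (forall i, P i -> 0 <= w i) -> (forall i, P i -> 0 <= f i) -> 0 < r <= 1 ->
  (\sum_(i | P i) w i * f i) `^ r^-1 <=
  (\sum_(i | P i) w i) `^ (r^-1 - 1) * \sum_(i | P i) w i * f i `^ r^-1.
Proof.
move=> w0 f0 /andP[r0 r1].
have rn0 : r != 0 by rewrite gt_eqF.
have s0 : 0 <= \sum_(i | P i) w i * f i `^ r^-1.
  by apply: sumr_ge0 => i Pi; rewrite mulr_ge0 ?powR_ge0 ?w0.
have := @hoelder_sum I P (fun i => w i * f i `^ r^-1) w r.
rewrite (ltW r0) r1 => /(_ _ w0 isT) H.
have {}H : \sum_(i | P i) w i * f i <= (\sum_(i | P i) w i * f i `^ r^-1) `^ r
       * (\sum_(i | P i) w i) `^ (1 - r).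
  apply: le_trans (H _); last by move=> i Pi; rewrite mulr_ge0 ?powR_ge0 ?w0.
  apply: ler_sum => i Pi; rewrite powRM ?powR_ge0 ?w0 // powRKV ?f0 //.
  rewrite mulrAC; have [w00|wn0] := eqVneq (w i) 0.
    by rewrite w00 mul0r !mulr_ge0 ?powR_ge0 ?f0.
  by rewrite -powRD ?(wn0, implybT) // subrKC powRr1 ?w0.
apply: le_trans (ler_powR2 _ _ H) _; first by rewrite invr_ge0 ltW.
  by apply: sumr_ge0 => i Pi; rewrite mulr_ge0 ?w0 ?f0.
rewrite powRM ?powR_ge0 // powRVK // -powRrM mulrC.
by rewrite mulrBl mul1r divff.
Qed.

(** Reverse Minkowski inequality. With the total [S], write X^r = (X S^(r-1))^r (S^r)^(1-r) and
    apply Hoelder's inequality: the bound for each [j] is linear in [X], and summing over [j]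
    reassembles the right side. *)
Lemma lr_superadditive (I J : finType) (P : pred I) (Q : pred J) (X : I -> J -> R) r :
  0 < r <= 1 -> (forall i j, 0 <= X i j) ->
  \sum_(j | Q j) lr r P (X ^~ j) <= lr r P (fun i => \sum_(j | Q j) X i j).
Proof.
move=> /andP[r0 r1] X0.
have rn0 : r != 0 by rewrite gt_eqF.
set S := fun i => \sum_(j | Q j) X i j.
have S0 i : 0 <= S i by apply: sumr_ge0.
set T := \sum_(i | P i) S i `^ r.
have T0 : 0 <= T by apply: sumr_ge0 => i _; exact: powR_ge0.
have key j : Q j -> lr r P (X ^~ j) <= (\sum_(i | P i) X i j * S i `^ (r - 1)) * T `^ (r^-1 - 1).
  move=> Qj; have Y0 : 0 <= \sum_(i | P i) X i j * S i `^ (r - 1).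
    by apply: sumr_ge0 => i _; rewrite mulr_ge0 ?powR_ge0.
  have -> : (\sum_(i | P i) X i j * S i `^ (r - 1)) * T `^ (r^-1 - 1) =
    ((\sum_(i | P i) X i j * S i `^ (r - 1)) `^ r * T `^ (1 - r)) `^ r^-1.
    by rewrite powRM ?powR_ge0 // powRVK // -powRrM mulrBl mul1r divff.
  apply: ler_powR2; first by rewrite invr_ge0 ltW.
    by apply: sumr_ge0 => i _; exact: powR_ge0.
  apply: le_trans (hoelder_sum _ _ _); rewrite ?(ltW r0) ?r1 //; last 2 first.
  - by move=> i _; rewrite mulr_ge0 ?powR_ge0.
  - by move=> i _; exact: powR_ge0.
  apply: ler_sum => i _; rewrite powRM ?powR_ge0 // -!powRrM.
  have [Si0|Sn0] := eqVneq (S i) 0.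
    have /psumr_eq0P : S i = 0 by [].
    move=> /(_ (fun j _ => X0 i j)) ->//.
    by rewrite powR0 // mul0r.
  rewrite -mulrA -powRD ?Sn0 ?implybT //.
  have -> : (r - 1) * r + r * (1 - r) = 0 by ring.
  by rewrite powRr0 mulr1.
apply: le_trans (ler_sum _ key) _.
rewrite -mulr_suml exchange_big /=.
have -> : \sum_(i | P i) \sum_(j | Q j) X i j * S i `^ (r - 1) = T.
  apply: eq_bigr => i _; rewrite -mulr_suml -/(S i).
  have [Si0|Sn0] := eqVneq (S i) 0; first by rewrite Si0 mul0r powR0.
  by rewrite mulr_powRB1.
rewrite /lr -/T; have [->|Tn0] := eqVneq T 0; first by rewrite mul0r powR_ge0.
by rewrite mulr_powRB1 // invr_gt0.
Qed.

Lemma lrZ (I : finType) r (P : pred I) (f : I -> R) (k : R) : r != 0 -> 0 <= k ->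
  (forall i, P i -> 0 <= f i) ->
  lr r P (fun i => k * f i) = k * lr r P f.
Proof.
move=> r0 k0 f0; rewrite /lr; have -> : \sum_(i | P i) (k * f i) `^ r = k `^ r * \sum_(i | P i) f i `^ r.
  by rewrite mulr_sumr; apply: eq_bigr => i Pi; rewrite powRM ?f0.
by rewrite powRM ?powR_ge0 ?sumr_ge0 ?powRVK // => i _; exact: powR_ge0.
Qed.

Lemma hoelder_powers (I : finType) (P : pred I) (f : I -> R) r0 r1 t :
  (forall i, P i -> 0 <= f i) -> 0 < r0 -> 0 < r1 -> 0 <= t <= 1 ->
  \sum_(i | P i) f i `^ (r0 * t + r1 * (1 - t)) <=
  (\sum_(i | P i) f i `^ r0) `^ t * (\sum_(i | P i) f i `^ r1) `^ (1 - t).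
Proof.
move=> f0 p0 p1 tt; have /andP[t0 t1] := tt.
apply: le_trans (hoelder_sum _ _ tt); [|by move=> i _; exact: powR_ge0..].
apply: ler_sum => i Pi; rewrite -!powRrM; have [->|fn0] := eqVneq (f i) 0.
  rewrite powR0 ?mulr_ge0 ?powR_ge0 // gt_eqF //.
  have [->|tn] := eqVneq t 0; first by lra.
  by rewrite ltr_wpDr ?mulr_ge0 ?mulr_gt0 ?(ltW p1) ?subr_ge0 // lt_neqAle eq_sym tn.
by rewrite -powRD // fn0 implybT.
Qed.

End MeanInequalities.

(** * The modulus of complex numbers, as a real number *)

Section Modulus.
Variable R : realType.
Implicit Types z x y : R[i].

Lemma modC_norm z : (modC z)%:C%C = `|z|.
Proof. by []. Qed.

Lemma modC_ge0 z : 0 <= modC z.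
Proof. by rewrite -lecR rmorph0 modC_norm normr_ge0. Qed.

Lemma modC0 : modC (0 : R[i]) = 0.
Proof. by apply: (@complexI R); rewrite modC_norm normr0 rmorph0. Qed.

Lemma modC1 : modC (1 : R[i]) = 1.
Proof. by apply: (@complexI R); rewrite modC_norm normr1 rmorph1. Qed.

Lemma modCM x y : modC (x * y) = modC x * modC y.
Proof. by apply: (@complexI R); rewrite rmorphM /= !modC_norm normrM. Qed.

Lemma modC_eq0 z : (modC z == 0) = (z == 0).
Proof. by rewrite -(inj_eq (@complexI R)) rmorph0 modC_norm normr_eq0. Qed.

Lemma ler_modC_sum (I : Type) (s : seq I) (P : pred I) (f : I -> R[i]) :
  modC (\sum_(i <- s | P i) f i) <= \sum_(i <- s | P i) modC (f i).
Proof.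
by rewrite -lecR rmorph_sum /= modC_norm ler_norm_sum.
Qed.

Lemma modCX z n : modC (z ^+ n) = modC z ^+ n.
Proof. by elim: n => [|n IH]; rewrite ?expr0 ?modC1 // !exprS modCM IH. Qed.

Lemma modC_real (x : R) : 0 <= x -> modC (x%:C)%C = x.
Proof. by move=> x0; rewrite /modC /= expr0n /= addr0 sqrtr_sqr ger0_norm. Qed.

Lemma modC_conj z : modC z^* = modC z.
Proof. by apply: (@complexI R); rewrite !modC_norm norm_conjC. Qed.

Lemma modCV z : modC z^-1 = (modC z)^-1.
Proof. by apply: (@complexI R); rewrite fmorphV !modC_norm normfV. Qed.

Lemma modC_sqr z : (modC z ^+ 2)%:C%C = z * z^*.
Proof. by rewrite rmorphXn /= modC_norm normCK. Qed.

Lemma modC_nat n : modC (n%:R : R[i]) = n%:R.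
Proof. by apply: (@complexI R); rewrite modC_norm normr_nat rmorph_nat. Qed.

(** X^N - 1 splits over the algebraically closed field [R[i]] and is separable, so that it has [N]
    distinct roots. *)
Lemma prim_root_exists N : (0 < N)%N -> exists w : R[i], N.-primitive_root w.
Proof.
move=> N0; pose p : {poly R[i]} := 'X^N - 1.
have [r Dp] := closed_field_poly_normal p.
rewrite (monicP _) ?monicXnsubC // scale1r in Dp.
have rn1 : all N.-unity_root r by apply/allP=> z; rewrite -root_prod_XsubC -Dp.
have sz_r : (N < (size r).+1)%N.
  by rewrite -(size_prod_XsubC r id) -Dp size_XnsubC.
have [|z] := hasP (has_prim_root N0 rn1 _ sz_r); last by exists z.
by rewrite -separable_prod_XsubC -Dp separable_Xn_sub_1 // pnatr_eq0 -lt0n.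
Qed.

End Modulus.

(** * Fourier analysis on the N-th roots of unity *)

Section RootsOfUnity.
Variables (R : realType) (N : nat) (w : R[i]).
Hypothesis prim_w : N.-primitive_root w.

Lemma root_order_gt0 : (0 < N)%N.
Proof. exact: prim_order_gt0 prim_w. Qed.

Lemma modC_root : modC w = 1.
Proof.
apply/eqP; rewrite -(@pexpr_eq1 _ _ N) ?modC_ge0 ?root_order_gt0 // -modCX.
by rewrite (prim_expr_order prim_w) modC1.
Qed.

Lemma modC_rootX k : modC (w ^+ k) = 1.
Proof. by rewrite modCX modC_root expr1n. Qed.

Lemma conj_rootX k : (w ^+ k)^* * w ^+ k = 1.
Proof. by rewrite mulrC -modC_sqr modC_rootX expr1n rmorph1. Qed.

Lemma sum_rootX k :
  \sum_(y < N) w ^+ (k * y) = if (N %| k)%N then N%:R else 0.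
Proof.
have : (w ^+ k - 1) * \sum_(y < N) (w ^+ k) ^+ y = 0.
  by rewrite -subrX1 -exprM mulnC exprM (prim_expr_order prim_w) expr1n subrr.
rewrite (_ : \sum_(y < N) (w ^+ k) ^+ y = \sum_(y < N) w ^+ (k * y)); last first.
  by apply: eq_bigr => y _; rewrite exprM.
case: ifP => [/dvdnP[q ->] _|ndiv /eqP].
  rewrite (eq_bigr (fun=> 1)) ?sumr_const ?card_ord // => y _.
  by rewrite mulnAC mulnC exprM (prim_expr_order prim_w) expr1n.
rewrite mulf_eq0 subr_eq0 -[1](expr0 w) (eq_prim_root_expr prim_w) mod0n -/(dvdn N k).
by rewrite ndiv => /eqP.
Qed.

Lemma root_orthogonal j k : (j < N)%N -> (k < N)%N ->
  \sum_(y < N) w ^+ (j * y) * (w ^+ (k * y))^* = if j == k then N%:R else 0.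
Proof.
move=> jN kN.
rewrite (eq_bigr (fun y : 'I_N => w ^+ ((j + (N - k)) * y))); last first.
  move=> y _; rewrite mulnDl exprD; congr (_ * _).
  have : w ^+ ((N - k) * y) * w ^+ (k * y) = 1.
    by rewrite -exprD -mulnDl subnK ?(ltnW kN) // exprM (prim_expr_order prim_w) expr1n.
  rewrite -[RHS](conj_rootX (k * y)) => /mulIf -> //.
  by rewrite -modC_eq0 modC_rootX oner_neq0.
rewrite sum_rootX; congr (if _ then _ else _).
case: (ltngtP j k) => jk.
- by rewrite /dvdn modn_small ?gtn_eqF //; move: jk kN; clear; lia.
- have e : (j + (N - k) = N + (j - k))%N by move: jk kN; clear; lia.
  by rewrite e /dvdn modnDl modn_small ?gtn_eqF //; move: jk jN; clear; lia.
- by rewrite jk subnKC ?dvdnn // ltnW.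
Qed.

Lemma root_parseval d (a b : 'I_d -> R[i]) : (d <= N)%N ->
  \sum_(y < N) (\sum_k a k * w ^+ (k * y)) * (\sum_k b k * w ^+ (k * y))^*
  = N%:R * \sum_k a k * (b k)^*.
Proof.
move=> dN.
under eq_bigr => y _ do rewrite rmorph_sum /= big_distrlr /=.
rewrite exchange_big mulr_sumr; apply: eq_bigr => /= k _.
rewrite exchange_big (bigD1 k) //= [X in _ + X]big1 ?addr0 => [|l lk].
  transitivity (a k * (b k)^* * \sum_(y < N) w ^+ (k * y) * (w ^+ (k * y))^*).
    by rewrite mulr_sumr; apply: eq_bigr => y _; rewrite rmorphM mulrACA.
  by rewrite root_orthogonal ?eqxx ?(leq_trans (ltn_ord k)) // mulrC.
transitivity (a k * (b l)^* * \sum_(y < N) w ^+ (k * y) * (w ^+ (l * y))^*).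
  by rewrite mulr_sumr; apply: eq_bigr => y _; rewrite rmorphM mulrACA.
by rewrite root_orthogonal ?(leq_trans (ltn_ord _)) // ifN ?mulr0 // eq_sym.
Qed.

Lemma root_plancherel d (a : 'I_d -> R[i]) : (d <= N)%N ->
  \sum_(y < N) modC (\sum_k a k * w ^+ (k * y)) ^+ 2
  = N%:R * \sum_k modC (a k) ^+ 2.
Proof.
move=> dN; apply: (@complexI R); rewrite rmorphM /= !rmorph_sum /= rmorph_nat.
rewrite (eq_bigr _ (fun y _ => modC_sqr _)).
by rewrite (root_parseval _ _ dN); congr (_ * _); apply: eq_bigr => k _; rewrite modC_sqr.
Qed.

End RootsOfUnity.

(** * The fourth moment of a polynomial in one variable *)

Section OneVariableHypercontractivity.
Variable R : realType.

Lemma sqr_sum_le (I : finType) (P : pred I) (x : I -> R) :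
  (\sum_(i | P i) x i) ^+ 2 <= #|P|%:R * \sum_(i | P i) x i ^+ 2.
Proof.
rewrite expr2 big_distrlr /=.
apply: (@le_trans _ _ (\sum_(i | P i) \sum_(j | P j) (x i ^+ 2 + x j ^+ 2) / 2)).
  apply: ler_sum => i _; apply: ler_sum => j _.
  have := sqr_ge0 (x i - x j); rewrite sqrrB; lra.
rewrite (eq_bigr (fun i => #|P|%:R * (x i ^+ 2 / 2) +  (\sum_(j | P j) x j ^+ 2) / 2)).
  rewrite big_split /= sumr_const -mulr_sumr -mulr_suml -mulr_natl.
  rewrite le_eqVlt; apply/orP; left; apply/eqP; by field.
move=> i _; rewrite -mulr_suml big_split /= sumr_const mulrDl; congr (_ + _).
by rewrite mulr_natl mulrnAl.
Qed.

Lemma card_add_eq d K : (#|[pred p : 'I_d * 'I_d | p.1 + p.2 == K]| <= K.+1)%N.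
Proof.
set A := [pred p : 'I_d * 'I_d | _].
have inj : {in A &, injective (fun p : 'I_d * 'I_d => inord p.1 : 'I_K.+1)}.
  move=> [i j] [k l] /= /eqP /= ij /eqP /= kl /(congr1 val) /=.
  rewrite !inordK; [|by rewrite ltnS -kl leq_addr|by rewrite ltnS -ij leq_addr].
  move=> ik; congr (_, _); apply: val_inj => //=.
  by move: ij; rewrite ik -kl => /addnI.
by rewrite -(card_in_imset inj) -[X in (_ <= X)%N](card_ord K.+1) max_card.
Qed.

Lemma bernoulli_ineq (x : R) n : -1 <= x -> 1 + n%:R * x <= (1 + x) ^+ n.
Proof.
move=> x1; elim: n => [|n IH]; first by rewrite mul0r addr0 expr0.
rewrite exprS; apply: le_trans (ler_wpM2l _ IH); last by lra.
have := mulr_ge0 (ler0n R n) (sqr_ge0 x).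
rewrite -natr1 expr2; nra.
Qed.

Variables (N : nat) (w : R[i]).
Hypothesis prim_w : N.-primitive_root w.

(** By Plancherel for the square, whose degrees stay below [N] as [2 * d <= N]. Its coefficient of
    degree K is a sum of at most K + 1 products, which is the factor that Cauchy-Schwarz costs. *)
Lemma fourth_moment d (g : 'I_d -> R[i]) : (2 * d <= N)%N ->
  \sum_(y < N) modC (\sum_k g k * w ^+ (k * y)) ^+ 2 ^+ 2 <=
  N%:R * \sum_(p : 'I_d * 'I_d) (p.1 + p.2).+1%N%:R * (modC (g p.1) ^+ 2 * modC (g p.2) ^+ 2).
Proof.
move=> dN.
pose h (K : 'I_(2 * d)) := \sum_(p : 'I_d * 'I_d | (p.1 + p.2 == K)%N) g p.1 * g p.2.
have sqG y : (\sum_k g k * w ^+ (k * y)) ^+ 2 = \sum_K h K * w ^+ (K * y).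
  rewrite expr2 big_distrlr /= pair_bigA /=.
  rewrite (partition_big (fun p : 'I_d * 'I_d => inord (p.1 + p.2)%N : 'I_(2 * d).-1.+1) xpredT) //=.
  have lt2 (p : 'I_d * 'I_d) : (p.1 + p.2 < 2 * d)%N.
    by have := ltn_ord p.1; have := ltn_ord p.2; move: (nat_of_ord _) (nat_of_ord _); clear; lia.
  have [d0|d0] := posnP (2 * d).
    rewrite !big1 // => [K|K]; first by have := leq_ltn_trans (leq0n K) (ltn_ord K); rewrite {1}d0.
    by move=> _; rewrite big1 // => p _; have := lt2 p; rewrite d0.
  rewrite [RHS](reindex_onto (cast_ord (prednK d0)) (cast_ord (esym (prednK d0)))) /=; last first.
    by move=> K _; apply: val_inj.
  apply: eq_big => [K|K _]; first by apply/esym/eqP/val_inj.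
  rewrite /h mulr_suml; apply: eq_big => [p|p /eqP <-] /=.
    by rewrite -val_eqE /= inordK // prednK.
  by rewrite inordK ?prednK // mulnDl exprD mulrACA.
under eq_bigr => y _ do rewrite -modCX sqG.
rewrite (root_plancherel prim_w) // ler_pM2l ?ltr0n ?(root_order_gt0 prim_w) //.
rewrite [leRHS](partition_big (fun p : 'I_d * 'I_d => insub (p.1 + p.2)%N : option 'I_(2 * d)) xpredT) //=.
rewrite (bigD1 None) //= ler_wpDl //; first by apply: sumr_ge0 => p _; rewrite mulr_ge0 ?ler0n // mulr_ge0 ?sqr_ge0.
rewrite [leRHS](reindex_omap Some id) /=; last by case.
under [leRHS]eq_bigl => K do rewrite eqxx.
apply: ler_sum => K _.
have eqP_ (p : 'I_d * 'I_d) : ((insub (p.1 + p.2)%N : option 'I_(2 * d)) == Some K) = (p.1 + p.2 == K)%N.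
  case: insubP => [k _ /= <-|] //.
  by move=> /negP h1; apply/esym/negP => /eqP h2; apply: h1; rewrite h2.
under [leRHS]eq_bigl => p do rewrite eqP_.
apply: (@le_trans _ _ ((\sum_(p : 'I_d * 'I_d | (p.1 + p.2 == K)%N) modC (g p.1) * modC (g p.2)) ^+ 2)).
  rewrite ler_pXn2r ?nnegrE ?modC_ge0 ?sumr_ge0 //; last by move=> p _; rewrite mulr_ge0 ?modC_ge0.
  by apply: le_trans (ler_modC_sum _ _ _) _; apply: ler_sum => p _; rewrite modCM.
apply: le_trans (sqr_sum_le _ _) _.
apply: (@le_trans _ _ (K.+1%:R * \sum_(p : 'I_d * 'I_d | (p.1 + p.2 == K)%N) (modC (g p.1) * modC (g p.2)) ^+ 2)).
  apply: ler_wpM2r; first by rewrite sumr_ge0 // => p _; exact: sqr_ge0.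
  by rewrite ler_nat card_add_eq.
rewrite mulr_sumr le_eqVlt; apply/orP; left; apply/eqP.
by apply: eq_bigr => p /eqP ->; rewrite exprMn.
Qed.

End OneVariableHypercontractivity.

(** * Hypercontractivity in one variable *)

Section Hypercontractivity.
Variable R : realType.

(* The paper's exponent [2m/(m+1)], halved: it is applied to squared moduli. *)
Definition rexp (s : nat) : R := s%:R / s.+1%:R.

Lemma rexp_gt0 s : (0 < s)%N -> 0 < rexp s.
Proof. by move=> s0; rewrite divr_gt0 ?ltr0n. Qed.

Lemma rexp_le1 s : rexp s <= 1.
Proof. by rewrite ler_pdivrMr ?ltr0n // mul1r ler_nat. Qed.

Lemma rexpV s : (0 < s)%N -> (rexp s)^-1 = 1 + s%:R^-1.
Proof.
move=> s0; have sn0 : s%:R != 0 :> R by rewrite pnatr_eq0 -lt0n.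
by rewrite /rexp invf_div -natr1 mulrDl divff // mul1r.
Qed.

Variables (N : nat) (w : R[i]).
Hypothesis prim_w : N.-primitive_root w.

(** Duality. [A] is the scalar product of the polynomial with [G], of coefficients u^k c_k.
    Hoelder's inequality leaves a norm of [G] of exponent 2s/(s-1), which lies between 2 and 4
    because s >= 2; it is interpolated between the mean square [a1] and the fourth moment [a2]. *)
Lemma hypercontractive1 s d (c : 'I_d -> R[i]) : (1 < s)%N -> (2 * d <= N)%N ->
  (\sum_(k < d) (s%:R / s.+2%:R) ^+ k * modC (c k) ^+ 2) `^ rexp s <=
  N%:R^-1 * \sum_(y < N) (modC (\sum_k c k * w ^+ (k * y)) ^+ 2) `^ rexp s.
Proof.
move=> s1 dN; set u : R := s%:R / _.
have N0 : 0 < N%:R :> R by rewrite ltr0n (root_order_gt0 prim_w).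
have s0 : 0 < s%:R :> R by rewrite ltr0n ltnW.
have s2 : 2 <= s%:R :> R by rewrite ler_nat.
have sn0 : s%:R != 0 :> R by rewrite gt_eqF.
have s1n0 : s%:R - 1 != 0 :> R by rewrite gt_eqF //; lra.
have rE : rexp s = s%:R / (s%:R + 1) by rewrite /rexp natr1.
have uE : u = s%:R / (s%:R + 2) by rewrite /u -addn2 natrD.
have u0 : 0 < u by rewrite uE divr_gt0 //; lra.
have r0 : 0 < rexp s by rewrite rexp_gt0 // ltnW.
set A := \sum_(k < d) u ^+ k * modC (c k) ^+ 2.
have A0 : 0 <= A.
  by apply: sumr_ge0 => k _; rewrite mulr_ge0 ?sqr_ge0 ?exprn_ge0 // ltW.
have rn0 : rexp s != 0 by rewrite gt_eqF.
have [->|An0] := eqVneq A 0.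
  rewrite powR0 // mulr_ge0 ?invr_ge0 ?(ltW N0) // sumr_ge0 // => y _; exact: powR_ge0.
have Ap : 0 < A by rewrite lt_neqAle eq_sym An0.
pose f y := \sum_k c k * w ^+ (k * y).
pose g (k : 'I_d) := (u ^+ k)%:C%C * c k.
pose G y := \sum_k g k * w ^+ (k * y).
have modg k : modC (g k) ^+ 2 = u ^+ k * (u ^+ k * modC (c k) ^+ 2).
  by rewrite /g modCM modC_real ?exprn_ge0 ?(ltW u0) // exprMn expr2 mulrA.
pose E := \sum_(y < N) (modC (f y) ^+ 2) `^ rexp s.
pose X := \sum_(y < N) modC (G y) ^+ 2.
pose Y := \sum_(y < N) (modC (G y) ^+ 2) ^+ 2.
have E0 : 0 <= E by apply: sumr_ge0 => y _; exact: powR_ge0.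
have X0 : 0 <= X by apply: sumr_ge0 => y _; exact: sqr_ge0.
have Y0 : 0 <= Y by apply: sumr_ge0 => y _; exact: sqr_ge0.
have NA : N%:R * A <= \sum_(y < N) modC (f y) * modC (G y).
  have le_dN : (d <= N)%N by apply: leq_trans dN; rewrite leq_pmull.
  have := root_parseval prim_w c g le_dN.
  have -> : \sum_(k < d) c k * (g k)^* = A%:C%C.
    rewrite /A rmorph_sum /=; apply: eq_bigr => k _.
    by rewrite /g rmorphM rmorphM /= modC_sqr conj_Creal ?complex_real //; ring.
  move=> /(congr1 (@modC R)); rewrite modCM modC_nat modC_real // => <-.
  apply: le_trans (ler_modC_sum _ _ _) _; apply: ler_sum => y _.
  by rewrite modCM modC_conj.
pose t : R := (s%:R + 1) / (2 * s%:R).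
pose t1 : R := (s%:R - 2) / (s%:R - 1).
have t01 : 0 <= t <= 1.
  by rewrite /t divr_ge0 ?ler_pdivrMr ?mulr_ge0 ?mulr_gt0 ?(ltW s0) //; lra.
have t11 : 0 <= t1 <= 1.
  by rewrite /t1 divr_ge0 ?ler_pdivrMr //; lra.
have tE : 1 - t = (s%:R - 1) / (2 * s%:R) by rewrite /t; field.
have s1' : 0 < (s%:R - 1) / s%:R :> R by rewrite divr_gt0 //; lra.
have H1 : \sum_(y < N) modC (f y) * modC (G y) <=
    E `^ t * (\sum_(y < N) (modC (G y) ^+ 2) `^ (s%:R / (s%:R - 1))) `^ (1 - t).
  apply: le_trans (hoelder_sum _ _ t01); [|by move=> y _; exact: powR_ge0..].
  apply: ler_sum => y _; rewrite -!powRrM.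
  have -> : rexp s * t = 2^-1 by rewrite rE /t; field; rewrite sn0 /= gt_eqF //; lra.
  have -> : s%:R / (s%:R - 1) * (1 - t) = 2^-1 by rewrite tE; field; rewrite sn0 s1n0.
  by rewrite !powR12_sqrt ?sqr_ge0 // !sqrtr_sqr !ger0_norm ?modC_ge0.
have H2 : \sum_(y < N) (modC (G y) ^+ 2) `^ (s%:R / (s%:R - 1)) <= X `^ t1 * Y `^ (1 - t1).
  have -> : s%:R / (s%:R - 1) = 1 * t1 + 2 * (1 - t1) by rewrite /t1; field.
  apply: le_trans (@hoelder_powers _ _ xpredT (fun y : 'I_N => modC (G y) ^+ 2) 1 2 t1 _ _ _ t11) _ => //.
    by move=> y _; exact: sqr_ge0.
  rewrite /X /Y le_eqVlt; apply/orP; left; apply/eqP; congr (_ `^ _ * _ `^ _).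
    by apply: eq_bigr => y _; rewrite powRr1 ?sqr_ge0.
  by apply: eq_bigr => y _; rewrite powR_mulrn ?sqr_ge0.
pose a1 := X / N%:R; pose a2 := Y / N%:R.
have a10 : 0 <= a1 by rewrite divr_ge0 // ltW.
have a20 : 0 <= a2 by rewrite divr_ge0 // ltW.
have Emean : A <= (N%:R^-1 * E) `^ t * (a1 `^ t1 * a2 `^ (1 - t1)) `^ (1 - t).
  rewrite -(ler_pM2l N0); apply: le_trans NA _; apply: le_trans H1 _.
  apply: (@le_trans _ _ (E `^ t * (X `^ t1 * Y `^ (1 - t1)) `^ (1 - t))).
    apply: ler_wpM2l; rewrite ?powR_ge0 //; apply: ler_powR2 => //.
      by rewrite subr_ge0; case/andP: t01.
    by apply: sumr_ge0 => y _; exact: powR_ge0.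
  rewrite [X in _ <= _ * (X `^ _ * _)]mulrC /a1 /a2.
  have NV : 0 <= N%:R^-1 :> R by rewrite invr_ge0 ltW.
  rewrite (powRM t E0 NV) (powRM t1 X0 NV) (powRM (1 - t1) Y0 NV).
  rewrite [X in _ <= _ * (_ * X `^ _)](_ : _ = X `^ t1 * Y `^ (1 - t1) * N%:R^-1); last first.
    rewrite mulrACA -powRD; last by rewrite invr_eq0 (gt_eqF N0) implybT.
    by rewrite subrKC powRr1.
  rewrite (@powRM _ (X `^ t1 * _)) ?mulr_ge0 ?powR_ge0 // mulrACA -powRD; last first.
    by rewrite invr_eq0 (gt_eqF N0) implybT.
  by rewrite subrKC powRr1 // mulrCA divff ?mulr1 ?gt_eqF.
pose y_ (k : 'I_d) := u ^+ k * modC (c k) ^+ 2.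
have y0 k : 0 <= y_ k by rewrite mulr_ge0 ?sqr_ge0 ?exprn_ge0 // ltW.
have a1E : a1 = \sum_(k < d) u ^+ k * y_ k.
  have le_dN : (d <= N)%N by apply: leq_trans dN; rewrite leq_pmull.
  rewrite /a1 /X (root_plancherel prim_w) // mulrAC divff ?gt_eqF // mul1r.
  by apply: eq_bigr => k _; rewrite modg.
have a2E : a2 <= \sum_(p : 'I_d * 'I_d) (p.1 + p.2).+1%N%:R * (u ^+ (p.1 + p.2) * (y_ p.1 * y_ p.2)).
  rewrite /a2 ler_pdivrMr // mulrC; apply: le_trans (fourth_moment prim_w g dN) _.
  rewrite ler_pM2l //; apply: ler_sum => p _; apply: ler_wpM2l; first exact: ler0n.
  by rewrite !modg exprD mulrACA.
(* This dictates [u]: the coefficient of [y_ p.1 * y_ p.2] is u^K (1 + 2K/s), at most (u (1 +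
   2/s))^K = 1 by Bernoulli's inequality. *)
have main : (1 - 2 / s%:R) * a1 ^+ 2 + 2 / s%:R * a2 <= A ^+ 2.
  have c0 : 0 <= 2 / s%:R :> R by rewrite divr_ge0 ?(ltW s0).
  apply: le_trans (lerD (lexx _) (ler_wpM2l c0 a2E)) _.
  rewrite a1E !expr2 !big_distrlr /= !pair_bigA /= !mulr_sumr -big_split /=.
  apply: ler_sum => p _; set K := (p.1 + p.2)%N.
  have -> : (1 - 2 / s%:R) * (u ^+ p.1 * y_ p.1 * (u ^+ p.2 * y_ p.2)) +
     2 / s%:R * (K.+1%:R * (u ^+ K * (y_ p.1 * y_ p.2))) =
     (u ^+ K * (1 + K%:R * (2 / s%:R))) * (y_ p.1 * y_ p.2).
    by rewrite mulrACA -exprD -/K -natr1; ring.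
  rewrite -[leRHS]mul1r; apply: ler_wpM2r; first by rewrite mulr_ge0.
  apply: le_trans (ler_wpM2l _ (bernoulli_ineq K _)) _; rewrite ?exprn_ge0 ?(ltW u0) //.
    exact: le_trans (lerN10 R) c0.
  rewrite -exprMn (_ : u * _ = 1) ?expr1n // uE; field; rewrite sn0 /= gt_eqF //; lra.
have fin : (a1 `^ t1 * a2 `^ (1 - t1)) `^ (1 - t) <= A `^ 2^-1.
  have th : 0 <= (1 - 2 / s%:R : R) <= 1.
    apply/andP; split; first by rewrite subr_ge0 ler_pdivrMr // mul1r.
    by rewrite gerBl divr_ge0 ?(ltW s0).
  have amgm := le_trans (weighted_amgm (sqr_ge0 a1) a20 th) _.
  have {amgm} : (a1 ^+ 2) `^ (1 - 2 / s%:R) * a2 `^ (1 - (1 - 2 / s%:R)) <= A ^+ 2.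
    by apply: amgm; rewrite subKr.
  have q4 : 0 <= 4^-1 :> R by rewrite invr_ge0 ler0n.
  move=> /(ler_powR2 q4); rewrite mulr_ge0 ?powR_ge0 // => /(_ isT).
  rewrite powRM ?powR_ge0 // -!powR_mulrn // -!powRrM.
  have -> : 2 * ((1 - 2 / s%:R) / 4) = t1 * (1 - t) by rewrite tE /t1; field; rewrite sn0 s1n0.
  have -> : (1 - (1 - 2 / s%:R)) / 4 = (1 - t1) * (1 - t) by rewrite tE /t1; field; rewrite sn0 s1n0.
  have q2 : 2 / 4 = 2^-1 :> R by field.
  by rewrite q2 (@powRM _ (a1 `^ t1)) ?powR_ge0 // -!powRrM.
have half : 2^-1 + 2^-1 = 1 :> R by field.
have {fin Emean} : A <= (N%:R^-1 * E) `^ t * A `^ 2^-1.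
  by apply: le_trans Emean _; rewrite ler_wpM2l ?powR_ge0.
have sqA : A `^ 2^-1 * A `^ 2^-1 = A by rewrite -powRD ?An0 ?implybT // half powRr1.
rewrite -{1}sqA ler_pM2r ?powR_gt0 // => fin.
have r2 : 0 <= 2 * rexp s by rewrite mulr_ge0 // ltW.
have := ler_powR2 r2 (powR_ge0 _ _) fin.
rewrite -!powRrM mulrA mulVf // mul1r.
rewrite (_ : t * (2 * rexp s) = 1) ?powRr1 //.
  by rewrite mulr_ge0 // invr_ge0 ltW.
by rewrite rE /t; field; rewrite sn0 /= gt_eqF // addr_gt0.
Qed.

End Hypercontractivity.

(** * Tensor powers of a hypercontractive inequality *)

Section Tensorization.
Variable R : realType.

(** An inequality from L^(2r) of the uniform measure on [Y] to a weighted l^2, raised to the power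
    2r; [u] holds the squared multipliers. *)
Definition hypercontractive (X Y : finType) (K : X -> Y -> R[i]) (u : X -> R) (r : R) :=
  forall a : X -> R[i],
  (\sum_x u x * modC (a x) ^+ 2) `^ r <=
  #|Y|%:R^-1 * \sum_y (modC (\sum_x a x * K x y) ^+ 2) `^ r.

(** The first inequality is applied in [y.1] for each [y.2]; reverse Minkowski, where r <= 1 enters,
    exchanges the sum over [x.1] with the quasi-norm in [y.2]; the second inequality is applied for
    each [x.1]. *)
Lemma hypercontractive_prod (X1 X2 Y1 Y2 : finType) (K1 : X1 -> Y1 -> R[i])
    (K2 : X2 -> Y2 -> R[i]) u1 u2 r :
  0 < r <= 1 -> (0 < #|Y2|)%N -> (forall x, 0 <= u1 x) -> (forall x, 0 <= u2 x) ->
  hypercontractive K1 u1 r -> hypercontractive K2 u2 r ->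
  hypercontractive (fun (x : X1 * X2) (y : Y1 * Y2) => K1 x.1 y.1 * K2 x.2 y.2)
    (fun x => u1 x.1 * u2 x.2) r.
Proof.
move=> r01 Y20 u10 u20 H1 H2 a; have /andP[r0 r1] := r01.
have rn0 : r != 0 by rewrite gt_eqF.
pose g x1 y2 := \sum_x2 a (x1, x2) * K2 x2 y2.
have card_ge0 (Y : finType) : 0 <= (#|Y|%:R)^-1 :> R by rewrite invr_ge0 ler0n.
have sums y1 y2 : \sum_x a x * (K1 x.1 y1 * K2 x.2 y2) = \sum_x1 g x1 y2 * K1 x1 y1.
  under [RHS]eq_bigr => x1 _ do rewrite mulr_suml.
  rewrite pair_bigA /=; apply: eq_bigr => -[x1 x2] _ /=.
  by rewrite -mulrA [K2 _ _ * _]mulrC.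
(* The averaging factor is put inside as its 1/r-th power, so that the r-th powers of [Z] add up to
   a mean over [y2]. *)
pose Z x1 y2 : R := #|Y2|%:R^-1 `^ r^-1 * (u1 x1 * modC (g x1 y2) ^+ 2).
have Z0 x1 y2 : 0 <= Z x1 y2.
  by rewrite /Z mulr_ge0 ?powR_ge0 // mulr_ge0 ?u10 ?sqr_ge0.
apply: (@le_trans _ _ (\sum_y2 (\sum_x1 Z x1 y2) `^ r)); last first.
  have -> : #|{: Y1 * Y2}|%:R^-1 * \sum_y (modC (\sum_x a x * (K1 x.1 y.1 * K2 x.2 y.2)) ^+ 2) `^ r
    = \sum_y2 #|Y2|%:R^-1 * (#|Y1|%:R^-1 * \sum_y1 (modC (\sum_x1 g x1 y2 * K1 x1 y1) ^+ 2) `^ r).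
    rewrite card_prod natrM invfM [_^-1 * _]mulrC -mulrA -!mulr_sumr; congr (_ * (_ * _)).
    rewrite exchange_big pair_bigA /=; apply: eq_bigr => -[y1 y2] _.
    by rewrite sums.
  apply: ler_sum => y2 _.
  rewrite -mulr_sumr powRM ?powR_ge0 ?sumr_ge0 //; last first.
    by move=> x1 _; rewrite mulr_ge0 ?u10 ?sqr_ge0.
  by rewrite powRKV // ler_wpM2l // H1.
have sup := @lr_superadditive R _ _ xpredT xpredT (fun y2 x1 => Z x1 y2) r r01
  (fun y2 x1 => Z0 x1 y2).
rewrite -lrK //; apply: ler_powR2; rewrite ?(ltW r0) //.
  by apply: sumr_ge0 => x _; rewrite mulr_ge0 ?sqr_ge0 // mulr_ge0.
apply: le_trans sup.
rewrite (_ : \sum_x _ = \sum_x1 u1 x1 * \sum_x2 u2 x2 * modC (a (x1, x2)) ^+ 2); last first.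
  under [RHS]eq_bigr => x1 _ do rewrite mulr_sumr.
  by rewrite pair_bigA /=; apply: eq_bigr => -[x1 x2] _ /=; rewrite mulrA.
apply: ler_sum => x1 _.
have Z1 y2 : Z x1 y2 = u1 x1 * (#|Y2|%:R^-1 `^ r^-1 * modC (g x1 y2) ^+ 2).
  by rewrite /Z mulrCA.
rewrite [leRHS](_ : _ = lr r xpredT (fun y2 =>
    u1 x1 * (#|Y2|%:R^-1 `^ r^-1 * modC (g x1 y2) ^+ 2))); last first.
  by congr (lr r); apply/funext => y2; exact: Z1.
rewrite lrZ // => [|y2 _]; last by rewrite mulr_ge0 ?sqr_ge0 ?powR_ge0.
apply: ler_wpM2l => //; rewrite lrZ ?powR_ge0 // => [|y2 _]; last exact: sqr_ge0.
rewrite /lr -powRM ?sumr_ge0 // => [|y2 _]; last exact: powR_ge0.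
rewrite -[leLHS](@powRVK _ r) // ?sumr_ge0 // => [|x2 _]; last by rewrite mulr_ge0 ?sqr_ge0.
apply: ler_powR2; rewrite ?powR_ge0 ?invr_ge0 ?(ltW r0) //; exact: H2.
Qed.

Lemma big_ffun_cons (T : nmodType) (X : finType) n (G : {ffun 'I_n.+1 -> X} -> T) :
  \sum_f G f = \sum_(p : X * {ffun 'I_n -> X})
    G [ffun i => if unlift ord0 i is Some j then p.2 j else p.1].
Proof.
rewrite (reindex (fun p : X * {ffun 'I_n -> X} =>
  [ffun i => if unlift ord0 i is Some j then p.2 j else p.1])) //=.
exists (fun f : {ffun 'I_n.+1 -> X} => (f ord0, [ffun j => f (lift ord0 j)])).
  move=> [x f] _ /=; congr (_, _); first by rewrite ffunE unlift_none.
  by apply/ffunP => j; rewrite !ffunE liftK.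
move=> f _; apply/ffunP => i; rewrite ffunE /=.
by case: unliftP => [j|] -> //; rewrite ffunE.
Qed.

Definition tensor (X Y : finType) (K : X -> Y -> R[i]) n
    (x : {ffun 'I_n -> X}) (y : {ffun 'I_n -> Y}) : R[i] := \prod_i K (x i) (y i).

Lemma hypercontractive_tensor (X Y : finType) (K : X -> Y -> R[i]) u r n :
  0 < r <= 1 -> (0 < #|Y|)%N -> (forall x, 0 <= u x) ->
  hypercontractive K u r ->
  hypercontractive (@tensor X Y K n) (fun x => \prod_i u (x i)) r.
Proof.
move=> r01 Y0 u0 H; have /andP[r0 _] := r01; elim: n => [|n IH] a.
  have c1 (Z : finType) : #|{: {ffun 'I_0 -> Z}}| = 1%N by rewrite card_ffun card_ord expn0.
  rewrite c1 invr1 mul1r.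
  have uniq0 (Z : finType) : exists x0 : {ffun 'I_0 -> Z}, forall x, x = x0.
    by have /mem_card1[x0 xE] := c1 Z; exists x0 => x; have := xE x; rewrite !inE => /esym/eqP.
  have [[x0 xE] [y0 yE]] := (uniq0 X, uniq0 Y).
  rewrite (eq_bigl (pred1 x0)) => [|x]; last by rewrite /= [x]xE eqxx.
  rewrite big_pred1_eq big_ord0 mul1r (eq_bigl (pred1 y0)) => [|y]; last by rewrite /= [y]yE eqxx.
  rewrite big_pred1_eq (eq_bigl (pred1 x0)) => [|x]; last by rewrite /= [x]xE eqxx.
  by rewrite big_pred1_eq /tensor big_ord0 mulr1.
have := hypercontractive_prod r01 _ u0 _ H IH.
have -> : (0 < #|{: {ffun 'I_n -> Y}}|)%N by rewrite card_ffun expn_gt0 Y0.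
have pu (x : {ffun 'I_n -> X}) : 0 <= \prod_i u (x i) by apply: prodr_ge0.
move=> /(_ isT pu (fun p => a [ffun i => if unlift ord0 i is Some j then p.2 j else p.1])).
rewrite !big_ffun_cons card_prod !card_ffun !card_ord expnS.
have prod_cons (T : comPzSemiRingType) (Z : finType) (h : 'I_n.+1 -> Z -> T) (x : Z * {ffun 'I_n -> Z}) :
   \prod_i h i ([ffun i => if unlift ord0 i is Some j then x.2 j else x.1] i) =
   h ord0 x.1 * \prod_i h (lift ord0 i) (x.2 i).
  rewrite big_ord_recl ffunE unlift_none; congr (_ * _).
  by apply: eq_bigr => i _; rewrite ffunE liftK.
set L1 := (X in X `^ r <= _ -> _); set L2 := (X in _ -> X `^ r <= _).
have -> : L1 = L2.
  by apply: eq_bigr => x _; rewrite (prod_cons _ _ (fun=> u)).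
set R1 := (X in _ <= _ * X -> _); set R2 := (X in _ -> _ <= _ * X).
suff -> : R1 = R2 by [].
apply: eq_bigr => y _; congr ((modC _ ^+ 2) `^ r).
rewrite big_ffun_cons; apply: eq_bigr => x _; congr (_ * _).
rewrite /tensor big_ord_recl !ffunE !unlift_none; congr (_ * _).
by apply: eq_bigr => i _; rewrite !ffunE !liftK.
Qed.

End Tensorization.

(** * Polynomials on the discrete torus *)

Section Torus.
Variables (R : realType) (N : nat) (w : R[i]).
Hypothesis prim_w : N.-primitive_root w.
Variables n d : nat.
Hypothesis small_d : (2 * d <= N)%N.
Hypothesis small_nd : (n * d < N)%N.

Notation mono := {ffun 'I_n -> 'I_d}.
Notation point := {ffun 'I_n -> 'I_N}.

Definition deg (m : nat) (x : {ffun 'I_n -> 'I_m}) : nat := (\sum_i x i)%N.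

Definition monomial : mono -> point -> R[i] :=
  @tensor R _ _ (fun (k : 'I_d) (y : 'I_N) => w ^+ (k * y)) n.

Definition ev (a : mono -> R[i]) (z : point) : R[i] := \sum_x a x * monomial x z.

Definition tavg (f : point -> R) : R := #|{: point}|%:R^-1 * \sum_z f z.

(** Distinct total degrees remain distinct modulo [N], so that rotations can separate the
    homogeneous parts. *)
Lemma deg_lt (x : mono) : (deg x < N)%N.
Proof.
apply: leq_ltn_trans small_nd; rewrite mulnC -[n in (_ <= _ * n)%N]card_ord mulnC -sum_nat_const.
by apply: leq_sum => i _; exact: ltnW.
Qed.

Lemma card_point_gt0 : 0 < #|{: point}|%:R :> R.
Proof. by rewrite ltr0n card_ffun card_ord expn_gt0 (root_order_gt0 prim_w). Qed.

Lemma tavg_ge0 f : (forall z, 0 <= f z) -> 0 <= tavg f.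
Proof. by move=> f0; rewrite mulr_ge0 ?invr_ge0 ?sumr_ge0. Qed.

Lemma ler_tavg f g : (forall z, f z <= g z) -> tavg f <= tavg g.
Proof. by move=> fg; rewrite ler_wpM2l ?invr_ge0 // ler_sum. Qed.

Lemma tavg_cst (c : R) : tavg (fun=> c) = c.
Proof. by rewrite /tavg sumr_const -(mulr_natl c) mulKf // gt_eqF ?card_point_gt0. Qed.

Lemma tavg_sum (I : finType) (P : pred I) (f : I -> point -> R) :
  tavg (fun z => \sum_(i | P i) f i z) = \sum_(i | P i) tavg (f i).
Proof. by rewrite /tavg exchange_big mulr_sumr. Qed.

Lemma tavgZ (c : R) f : tavg (fun z => c * f z) = c * tavg f.
Proof. by rewrite /tavg -mulr_sumr mulrCA. Qed.

Lemma tavg_sqr (a : mono -> R[i]) :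
  tavg (fun z => modC (ev a z) ^+ 2) = \sum_x modC (a x) ^+ 2.
Proof.
rewrite /tavg; apply: (canLR (mulKf _)); first by rewrite gt_eqF // card_point_gt0.
apply: (@complexI R); rewrite rmorphM /= !rmorph_sum /= rmorph_nat.
under eq_bigr => z _ do rewrite modC_sqr /ev rmorph_sum /= big_distrlr /=.
have orth x y : \sum_z monomial x z * (monomial y z)^* =
    if x == y then #|{: point}|%:R else 0.
  transitivity (\sum_(z : point) \prod_i (w ^+ (x i * z i) * (w ^+ (y i * z i))^*)).
    by apply: eq_bigr => z _; rewrite /monomial /tensor rmorph_prod -big_split.
  rewrite -(bigA_distr_bigA (fun i (u : 'I_N) => w ^+ (x i * u) * (w ^+ (y i * u))^*)) /=.
  have lt_dN (k : 'I_d) : (k < N)%N.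
    by apply: leq_trans (ltn_ord k) _; apply: leq_trans small_d; rewrite leq_pmull.
  case: eqVneq => [->|].
    rewrite (eq_bigr (fun=> N%:R)) => [|i _]; last by rewrite (root_orthogonal prim_w) ?eqxx.
    by rewrite prodr_const card_ffun !card_ord natrX.
  move=> /eqP/ffunP xy; have [i /eqP xyi] : exists i, x i <> y i.
    by apply/not_existsP => xy'; apply: xy => i; have := xy' i; apply: contra_notP.
  by rewrite (bigD1 i) //= (root_orthogonal prim_w) // ifN ?mul0r.
transitivity (\sum_x \sum_y a x * (a y)^* * \sum_z monomial x z * (monomial y z)^*).
  rewrite exchange_big /=; apply: eq_bigr => x _; rewrite exchange_big /=.
  apply: eq_bigr => y _; rewrite mulr_sumr; apply: eq_bigr => z _.
  by rewrite rmorphM /= mulrACA.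
rewrite mulr_sumr; apply: eq_bigr => x _.
rewrite (bigD1 x) //= orth eqxx big1 ?addr0 => [|y yx].
  by rewrite modC_sqr mulrC.
by rewrite orth eq_sym (negbTE yx) mulr0.
Qed.

Definition rot (j : nat) (y : 'I_N) : 'I_N := Ordinal (ltn_pmod (y + j) (root_order_gt0 prim_w)).

Definition rotate (j : nat) (z : point) : point := [ffun i => rot j (z i)].

Lemma rotate_inj j : injective (rotate j).
Proof.
move=> y z /ffunP yz; apply/ffunP => i; have := yz i; rewrite !ffunE => /(congr1 val) /= /eqP.
by rewrite eqn_modDr !modn_small // => /eqP /val_inj.
Qed.

Lemma tavg_rotate j f : tavg (fun z => f (rotate j z)) = tavg f.
Proof. by rewrite /tavg [in RHS](reindex_inj (@rotate_inj j)). Qed.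

Lemma monomial_rotate x j z : monomial x (rotate j z) = w ^+ (deg x * j) * monomial x z.
Proof.
rewrite /monomial /tensor /deg big_distrl /= -prodrXr -big_split /=.
apply: eq_bigr => i _; rewrite ffunE /= -exprD -mulnDr ![(x i * _)%N]mulnC !exprM.
by rewrite (prim_expr_mod prim_w) addnC.
Qed.

Definition hpart (t : nat) (a : mono -> R[i]) : mono -> R[i] :=
  fun x => if deg x == t then a x else 0.

(** Discrete Cauchy formula: rotating all the variables by w^j multiplies a monomial by w^(j deg),
    and orthogonality of the characters selects the degree [t]. *)
Lemma ev_hpart t a z : (t < N)%N ->
  N%:R * ev (hpart t a) z = \sum_(j < N) (w ^+ (t * j))^* * ev a (rotate j z).
Proof.
move=> tN; rewrite /ev mulr_sumr.
under [RHS]eq_bigr => j _ do rewrite mulr_sumr.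
rewrite exchange_big /=; apply: eq_bigr => x _.
under [RHS]eq_bigr => j _ do rewrite monomial_rotate.
transitivity (a x * monomial x z * \sum_(j < N) w ^+ (deg x * j) * (w ^+ (t * j))^*).
  rewrite (root_orthogonal prim_w) ?deg_lt // /hpart; case: eqP => _.
    by rewrite mulrC.
  by rewrite mul0r !mulr0.
by rewrite mulr_sumr; apply: eq_bigr => j _; ring.
Qed.

Lemma ler_modC_ev_hpart t a z : (t < N)%N ->
  modC (ev (hpart t a) z) <= N%:R^-1 * \sum_(j < N) modC (ev a (rotate j z)).
Proof.
move=> tN; have N0 : 0 < N%:R :> R by rewrite ltr0n (root_order_gt0 prim_w).
rewrite -ler_pdivrMl ?invr_gt0 // invrK -(modC_nat R N) -modCM ev_hpart //.
apply: le_trans (ler_modC_sum _ _ _) _; apply: ler_sum => j _.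
by rewrite modCM modC_conj (modC_rootX prim_w) mul1r.
Qed.

Lemma hpart_le1 t a : (t < N)%N -> (forall z, modC (ev a z) <= 1) ->
  forall z, modC (ev (hpart t a) z) <= 1.
Proof.
move=> tN a1 z; apply: le_trans (ler_modC_ev_hpart _ _ tN) _.
rewrite ler_pdivrMl ?ltr0n ?(root_order_gt0 prim_w) // mulr1.
apply: (@le_trans _ _ (\sum_(j < N) 1)); first by apply: ler_sum.
by rewrite sumr_const card_ord.
Qed.

Lemma tavg_hpart t a : (t < N)%N ->
  tavg (fun z => modC (ev (hpart t a) z)) <= tavg (fun z => modC (ev a z)).
Proof.
move=> tN; apply: le_trans (ler_tavg (fun z => ler_modC_ev_hpart a z tN)) _.
rewrite tavgZ tavg_sum.
under eq_bigr => j _ do rewrite (tavg_rotate j (fun z => modC (ev a z))).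
by rewrite sumr_const card_ord -(mulr_natl (tavg _)) mulKf ?pnatr_eq0 -?lt0n ?(root_order_gt0 prim_w).
Qed.

Lemma hypercontractive_ev s a : (1 < s)%N ->
  (\sum_x (s%:R / s.+2%:R) ^+ deg x * modC (a x) ^+ 2) `^ rexp R s <=
  tavg (fun z => (modC (ev a z) ^+ 2) `^ rexp R s).
Proof.
move=> s1.
have H : hypercontractive (fun (k : 'I_d) (y : 'I_N) => w ^+ (k * y))
    (fun k => (s%:R / s.+2%:R) ^+ k) (rexp R s).
  by move=> c; have := hypercontractive1 prim_w c s1 small_d; rewrite card_ord.
have := @hypercontractive_tensor R _ _ _ _ (rexp R s) n _ _ _ H a.
rewrite rexp_gt0 ?rexp_le1 ?(ltnW s1) // card_ord (root_order_gt0 prim_w).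
move=> /(_ isT isT) H'.
have {}H' := H' (fun x => exprn_ge0 _ (divr_ge0 (ler0n R s) (ler0n R s.+2))).
apply: le_trans _ H'; rewrite le_eqVlt; apply/orP; left; apply/eqP.
by congr (_ `^ _); apply: eq_bigr => x _; rewrite prodrXr.
Qed.

Definition mass (t : nat) (a : mono -> R[i]) : R := \sum_(x | deg x == t) modC (a x) ^+ 2.

Lemma mass_ge0 t a : 0 <= mass t a.
Proof. by apply: sumr_ge0 => x _; exact: sqr_ge0. Qed.

Lemma mass_hpart t a : \sum_x modC (hpart t a x) ^+ 2 = mass t a.
Proof.
rewrite /mass [RHS]big_mkcond /=; apply: eq_bigr => x _.
by rewrite /hpart; case: ifP => // _; rewrite modC0 expr0n.
Qed.

(** L^1 is out of reach of [hypercontractive_ev]. The case s = 2 there, an inequality from L^(4/3)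
    to L^2, is combined with the interpolation of L^(4/3) between L^1 and L^2; the L^2 norm on the
    right is then absorbed. *)
Lemma mass_le_l1 t a : (t < N)%N ->
  mass t a <= 4 ^+ t * tavg (fun z => modC (ev a z)) ^+ 2.
Proof.
move=> tN.
set S := mass t a; have S0 : 0 <= S := mass_ge0 t a.
set M := tavg (fun z => modC (ev (hpart t a) z)).
have M0 : 0 <= M by apply: tavg_ge0 => z; exact: modC_ge0.
suff H : S <= 4 ^+ t * M ^+ 2.
  apply: le_trans H _; rewrite ler_pM2l ?exprn_gt0 // ler_pXn2r ?nnegrE ?tavg_hpart //.
  by apply: tavg_ge0 => z; exact: modC_ge0.
have [->|Sn0] := eqVneq S 0; first by rewrite mulr_ge0 ?exprn_ge0 ?sqr_ge0.
have Sp : 0 < S by rewrite lt_neqAle eq_sym Sn0.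
have rE : rexp R 2 = 2 / 3 by [].
have half : (2 / 4) ^+ t = (2 ^- t : R).
  by rewrite -exprVn; congr (_ ^+ _); field.
have hc := hypercontractive_ev (hpart t a) (isT : (1 < 2)%N).
have {hc} : (2 ^- t * S) `^ (2 / 3) <=
    tavg (fun z => (modC (ev (hpart t a) z) ^+ 2) `^ (2 / 3)).
  apply: le_trans hc; rewrite rE le_eqVlt; apply/orP; left; apply/eqP; congr (_ `^ _).
  rewrite /S -mass_hpart mulr_sumr; apply: eq_bigr => x _.
  rewrite /hpart; case: eqP => [->|_]; first by rewrite half.
  by rewrite modC0 expr0n !mulr0.
have t01 : 0 <= (2 / 3 : R) <= 1.
  by rewrite divr_ge0 ?ler0n //= ler_pdivrMr ?ltr0n // mul1r ler_nat.
have ho : tavg (fun z => (modC (ev (hpart t a) z) ^+ 2) `^ (2 / 3)) <= M `^ (2 / 3) * S `^ (1 - 2 / 3).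
  rewrite /M /S -mass_hpart -tavg_sqr /tavg.
  have c0 : 0 <= #|{: point}|%:R^-1 :> R by rewrite invr_ge0.
  rewrite !powRM ?sumr_ge0 // => [|z _|z _]; last 2 first.
  - exact: sqr_ge0.
  - exact: modC_ge0.
  rewrite mulrACA -powRD; last by rewrite invr_eq0 (gt_eqF card_point_gt0) implybT.
  rewrite subrKC powRr1 // ler_wpM2l //.
  have e1 z : modC (ev (hpart t a) z) = modC (ev (hpart t a) z) `^ 1 by rewrite powRr1 ?modC_ge0.
  have e2 z : modC (ev (hpart t a) z) ^+ 2 = modC (ev (hpart t a) z) `^ 2 by rewrite powR_mulrn ?modC_ge0.
  rewrite [X in _ <= X `^ _ * _](eq_bigr _ (fun z _ => e1 z)).
  rewrite [X in _ <= _ * X `^ _](eq_bigr _ (fun z _ => e2 z)).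
  apply: le_trans (hoelder_powers _ _ _ t01) => //; last by move=> z _; exact: modC_ge0.
  apply: ler_sum => z _; rewrite e2 -powRrM.
  by have -> : 2 * (2 / 3) = 1 * (2 / 3) + 2 * (1 - 2 / 3) :> R by field.
move=> /le_trans/(_ ho); set p : R := 2 / 3.
have p0 : p != 0 by rewrite /p gt_eqF ?divr_gt0.
have pV : 0 <= p^-1 by rewrite invr_ge0 divr_ge0.
move=> /(ler_powR2 pV (powR_ge0 _ _)).
rewrite powRVK ?mulr_ge0 ?invr_ge0 ?exprn_ge0 // powRM ?powR_ge0 // powRVK // -powRrM.
have -> : (1 - p) / p = 2^-1 by rewrite /p; field.
have sqS : S = S `^ 2^-1 * S `^ 2^-1.
  by rewrite -powRD ?Sn0 ?implybT // (_ : 2^-1 + 2^-1 = 1) ?powRr1 //; field.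
rewrite {1}sqS mulrA ler_pM2r ?powR_gt0 // ler_pdivrMl ?exprn_gt0 // => fin.
have : (S `^ 2^-1) ^+ 2 <= (2 ^+ t * M) ^+ 2.
  by rewrite ler_pXn2r ?nnegrE ?powR_ge0 ?(mulr_ge0 (exprn_ge0 _ _) M0).
rewrite expr2 -sqS exprMn -exprM mulnC exprM.
by have -> : 2 ^+ 2 = 4 :> R by ring.
Qed.

(** The squared hypercontractive multiplier per degree. For [s = 1] the value 1/8 offsets the factor
    4^t of [mass_le_l1] and leaves 2^(-t), whose sum over t >= 1 is 1. *)
Definition vfac (s : nat) : R := if s == 1%N then 8^-1 else s%:R / s.+2%:R.

Lemma vfac_gt0 s : (0 < s)%N -> 0 < vfac s.
Proof.
by rewrite /vfac; case: eqP => _ s0; rewrite ?invr_gt0 ?divr_gt0 ?ltr0n.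
Qed.

(** All degrees are controlled at once. Degree 0 is left out: for [s = 1] the geometric series over
    t >= 1 already uses up the constant. *)
Lemma degree_hypercontractive s a T : (0 < s)%N -> (T <= N)%N ->
  (\sum_(t < T | (0 < t)%N) vfac s ^+ t * mass t a) `^ rexp R s <=
  tavg (fun z => (modC (ev a z) ^+ 2) `^ rexp R s).
Proof.
move=> s0 TN; have r0 := rexp_gt0 R s0.
have v0 := vfac_gt0 s0.
have S0 : 0 <= \sum_(t < T | (0 < t)%N) vfac s ^+ t * mass t a.
  by apply: sumr_ge0 => t _; rewrite mulr_ge0 ?mass_ge0 ?exprn_ge0 // ltW.
have [s1|s1] := eqVneq s 1%N; last first.
  have s2 : (1 < s)%N by rewrite ltn_neqAle eq_sym s1.
  apply: le_trans (hypercontractive_ev a s2); apply: ler_powR2 => //; first exact: ltW.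
  rewrite /vfac (negbTE s1).
  have u0 : 0 <= s%:R / s.+2%:R :> R by rewrite divr_ge0.
  under eq_bigr => t _ do rewrite /mass mulr_sumr.
  rewrite (exchange_big_dep xpredT) //=; apply: ler_sum => x _.
  set F := (X in _ <= X).
  have F0 : 0 <= F by rewrite /F mulr_ge0 ?sqr_ge0 ?exprn_ge0.
  apply: (@le_trans _ _ (\sum_(t < T | deg x == t) F)).
    rewrite [leRHS](bigID (fun t : 'I_T => (0 < t)%N)) /= ler_wpDr ?sumr_ge0 //.
    rewrite le_eqVlt; apply/orP; left; apply/eqP.
    apply: eq_big => [t|t /andP[_ /eqP <-] //]; exact: andbC.
  have [xT|Tx] := ltnP (deg x) T.
    rewrite (big_pred1 (Ordinal xT)) // => t; by rewrite eq_sym -val_eqE.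
  rewrite big_pred0 // => t; apply/negbTE/eqP => e.
  by have := ltn_ord t; rewrite -e ltnNge Tx.
rewrite s1 /vfac eqxx.
set M := tavg (fun z => modC (ev a z)).
have rE : rexp R 1 = 2^-1 by rewrite /rexp div1r.
have M0 : 0 <= M by apply: tavg_ge0 => z; exact: modC_ge0.
have -> : tavg (fun z => (modC (ev a z) ^+ 2) `^ rexp R 1) = M.
  rewrite /M /tavg; congr (_ * _); apply: eq_bigr => z _.
  by rewrite rE powR12_sqrt ?sqr_ge0 // sqrtr_sqr ger0_norm ?modC_ge0.
rewrite rE powR12_sqrt; last by apply: sumr_ge0 => t _; rewrite mulr_ge0 ?mass_ge0 ?exprn_ge0.
rewrite -[leRHS]ger0_norm // -sqrtr_sqr ler_wsqrtr //.
apply: (@le_trans _ _ (\sum_(t < T | (0 < t)%N) 2^-1 ^+ t * M ^+ 2)).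
  apply: ler_sum => t _.
  have tN : (t < N)%N by apply: leq_trans (ltn_ord t) TN.
  have c0 : 0 <= 8^-1 ^+ t :> R by rewrite exprn_ge0.
  apply: le_trans (ler_wpM2l c0 (mass_le_l1 a tN)) _.
  rewrite mulrA -exprMn; have -> : 8^-1 * 4 = 2^-1 :> R by field.
  by [].
rewrite -mulr_suml -[leRHS]mul1r ler_wpM2r ?sqr_ge0 //.
have geom k : \sum_(t < k.+1 | (0 < t)%N) 2^-1 ^+ t + 2^-1 ^+ k = 1 :> R.
  elim: k => [|k IHk]; first by rewrite big_mkcond big_ord1 /= add0r expr0.
  rewrite big_mkcond big_ord_recr -big_mkcond /= -[RHS]IHk -addrA; congr (_ + _).
  by rewrite !exprS; field.
case: T {S0 TN} => [|T]; first by rewrite big_ord0.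
by rewrite -[leRHS](geom T) lerDl exprn_ge0.
Qed.

End Torus.

(** * Two-coloured variables and the budget inequality *)

Section Colorings.
Variables (R : realType) (N : nat) (w : R[i]).
Hypothesis prim_w : N.-primitive_root w.
Variables n d : nat.
Hypothesis small_d : (2 * d.+1 <= N)%N.
Hypothesis small_nd : (n * d.+1 < N)%N.

Notation mono := {ffun 'I_n -> 'I_d.+1}.
Notation point := {ffun 'I_n -> 'I_N}.
Notation coloring := {ffun 'I_n -> bool}.
Notation ev := (@ev R N w n d.+1).
Notation monomial := (@monomial R N w n d.+1).
Notation tavg := (@tavg R N n).
Notation mass := (@mass R n d.+1).

Definition mix (T : Type) (c : coloring) (f g : {ffun 'I_n -> T}) : {ffun 'I_n -> T} :=
  [ffun i => if c i then f i else g i].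

Definition neg (c : coloring) : coloring := [ffun i => ~~ c i].

Definition res (c : coloring) (x : mono) : mono := mix c x [ffun=> ord0].

Lemma negK : involutive neg.
Proof. by move=> c; apply/ffunP => i; rewrite !ffunE negbK. Qed.

Lemma mix_neg (T : Type) c (f g : {ffun 'I_n -> T}) : mix (neg c) f g = mix c g f.
Proof. by apply/ffunP => i; rewrite !ffunE; case: (c i). Qed.

Lemma mix_res c x : mix c (res c x) (res (neg c) x) = x.
Proof. by apply/ffunP => i; rewrite !ffunE; case: (c i). Qed.

Lemma res_id c x : res c (res c x) = res c x.
Proof. by apply/ffunP => i; rewrite !ffunE; case: (c i). Qed.

Lemma deg_mix_res c x : (deg (res c x) + deg (res (neg c) x) = deg x)%N.
Proof.
rewrite /deg -big_split /=; apply: eq_bigr => i _; rewrite !ffunE.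
by case: (c i); rewrite /= ?addn0.
Qed.

Definition splits (c : coloring) (x y : mono) := (res c x == x) && (res (neg c) y == y).

Lemma splits_neg c x y : splits (neg c) y x = splits c x y.
Proof. by rewrite /splits negK andbC. Qed.

Lemma res_mix c x y : splits c x y -> res c (mix c x y) = x /\ res (neg c) (mix c x y) = y.
Proof.
move=> /andP[/eqP ex /eqP ey]; split.
  by rewrite -[RHS]ex; apply/ffunP => i; rewrite !ffunE; case: (c i).
by rewrite -[RHS]ey; apply/ffunP => i; rewrite !ffunE; case: (c i).
Qed.

Lemma sum_splits (V : nmodType) (c : coloring) (P : pred mono) (F : mono -> V) :
  \sum_(x | P x) F x = \sum_x \sum_(y | splits c x y && P (mix c x y)) F (mix c x y).
Proof.
rewrite pair_big_dep /= (reindex_onto (fun p : mono * mono => mix c p.1 p.2)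
  (fun x => (res c x, res (neg c) x))) /=; last by move=> x _; exact: mix_res.
apply: eq_bigl => -[x y] /=; rewrite andbC; congr (_ && _).
apply/eqP/idP => [[<- <-]|/res_mix[-> ->] //].
by rewrite /splits !res_id !eqxx.
Qed.

(** The coefficients as a matrix: rows [x] use the variables coloured [true], columns [y] the other
    ones. Indices that use a variable of the wrong colour get 0, so that all monomials can serve as
    indices. *)
Definition split_coef (a : mono -> R[i]) c x y := if splits c x y then a (mix c x y) else 0.

Lemma split_coef_neg a c x y : split_coef a (neg c) y x = split_coef a c x y.
Proof. by rewrite /split_coef splits_neg mix_neg. Qed.

Lemma monomial_mix c x y (z1 z2 : point) : splits c x y ->
  monomial (mix c x y) (mix c z1 z2) = monomial x z1 * monomial y z2.
Proof.
move=> /andP[/eqP ex /eqP ey]; rewrite /monomial /tensor -big_split /=.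
apply: eq_bigr => i _; rewrite -ex -ey !ffunE.
by case: (c i); rewrite /= mul0n expr0 ?mulr1 ?mul1r.
Qed.

(** For fixed [z2] this is a polynomial in [z1] with coefficients polynomial in [z2]; as the mixed
    point is on the torus, it inherits the bound by 1. *)
Lemma ev_mix a c (z1 z2 : point) :
  ev a (mix c z1 z2) = ev (fun x => ev (split_coef a c x) z2) z1.
Proof.
rewrite -[LHS]/(\sum_x a x * monomial x (mix c z1 z2)) (sum_splits c); apply: eq_bigr => x _.
rewrite mulr_suml big_mkcond; apply: eq_bigr => y _.
rewrite andbT /split_coef; case: ifP => s; last by rewrite !mul0r.
by rewrite monomial_mix // mulrA mulrAC.
Qed.

(** The square of the l^(2m/(m+1)) norm in degree [m], as [rexp R m] is half of that exponent. *)
Definition coef_lr (m : nat) (a : mono -> R[i]) : R :=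
  lr (rexp R m) (fun x => deg x == m) (fun x => modC (a x) ^+ 2).

Definition weighted_BH (W : nat -> R) (M : nat) := forall a : mono -> R[i],
  (forall z, modC (ev a z) <= 1) -> \sum_(1 <= m < M.+1) W m * coef_lr m a <= 1.

(** The square of a mixed norm: l^2 over the monomials of degree [t] in one colour, then
    l^(2s/(s+1)) over those of degree [s] in the other. *)
Definition block (s t : nat) (a : mono -> R[i]) (c : coloring) : R :=
  lr (rexp R s) (fun x => deg x == s) (fun x => mass t (split_coef a c x)).

(** Reverse Minkowski moves the sum over [t] inside the quasi-norm in [x]; [degree_hypercontractive]
    is applied for each [x], and Jensen's inequality for the power 1/r >= 1 exchanges it with the
    average. *)
Lemma block_le_tavg a c s T : (0 < s)%N -> (T <= N)%N ->
  \sum_(t < T | (0 < t)%N) vfac R s ^+ t * block s t a c <=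
  tavg (fun z => coef_lr s (fun x => ev (split_coef a c x) z)).
Proof.
move=> s0 TN; have r0 := rexp_gt0 R s0; have r1 := rexp_le1 R s.
have rn0 : rexp R s != 0 by rewrite gt_eqF.
have v0 := vfac_gt0 R s0.
have r01 : 0 < rexp R s <= 1 by rewrite r0.
have X0 x (t : 'I_T) : 0 <= vfac R s ^+ t * mass t (split_coef a c x).
  by rewrite mulr_ge0 ?mass_ge0 ?exprn_ge0 // ltW.
apply: (@le_trans _ _ (lr (rexp R s) (fun x => deg x == s)
    (fun x => \sum_(t < T | (0 < t)%N) vfac R s ^+ t * mass t (split_coef a c x)))).
  apply: le_trans (lr_superadditive _ _ r01 X0).
  apply: ler_sum => t _; rewrite lrZ // ?exprn_ge0 ?(ltW v0) // => x _; exact: mass_ge0.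
apply: (@le_trans _ _ ((tavg (fun z => \sum_(x | deg x == s)
    (modC (ev (split_coef a c x) z) ^+ 2) `^ rexp R s)) `^ (rexp R s)^-1)).
  apply: ler_powR2; rewrite ?invr_ge0 ?(ltW r0) //.
    by apply: sumr_ge0 => x _; exact: powR_ge0.
  rewrite tavg_sum; apply: ler_sum => x _.
  exact (degree_hypercontractive prim_w small_d small_nd (split_coef a c x) s0 TN).
have c0 : 0 <= #|{: point}|%:R^-1 :> R by rewrite invr_ge0.
have := @power_mean_sum R _ xpredT (fun=> #|{: point}|%:R^-1)
  (fun z : point => \sum_(x | deg x == s) (modC (ev (split_coef a c x) z) ^+ 2) `^ rexp R s)
  _ (fun _ _ => c0) _ r01.
have -> : \sum_(z : point) #|{: point}|%:R^-1 = 1 :> R.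
  rewrite sumr_const -(mulr_natl (_^-1)) divff // gt_eqF //.
  exact: (card_point_gt0 prim_w).
rewrite powR1 mul1r /tavg !mulr_sumr; apply.
by move=> z _; apply: sumr_ge0 => x _; exact: powR_ge0.
Qed.

Lemma block_sum_le1 W M a c T : (T <= N)%N -> (forall m, 0 <= W m) ->
  weighted_BH W M -> (forall z, modC (ev a z) <= 1) ->
  \sum_(1 <= s < M.+1) W s * \sum_(t < T | (0 < t)%N) vfac R s ^+ t * block s t a c <= 1.
Proof.
move=> TN W0 H a1.
apply: (@le_trans _ _ (tavg (fun y => \sum_(1 <= s < M.+1)
   W s * coef_lr s (fun x => ev (split_coef a c x) y)))); last first.
  rewrite -[leRHS](tavg_cst prim_w n); apply: ler_tavg => y; apply: H => z.
  by rewrite -ev_mix.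
have -> : tavg (fun y => \sum_(1 <= s < M.+1) W s * coef_lr s (fun x => ev (split_coef a c x) y)) =
    \sum_(1 <= s < M.+1) W s * tavg (fun y => coef_lr s (fun x => ev (split_coef a c x) y)).
  by rewrite /tavg exchange_big mulr_sumr; apply: eq_bigr => s _; rewrite -mulr_sumr mulrCA.
rewrite !big_nat; apply: ler_sum => s /andP[s0 _].
by apply: ler_wpM2l; rewrite ?W0 // block_le_tavg.
Qed.

End Colorings.

(** * Interpolation of the two mixed norms *)

Section MixedNorms.
Variable R : realType.

Lemma powR_prod (x y p q r : R) : (x `^ p * y `^ q) `^ r = x `^ (p * r) * y `^ (q * r).
Proof. by rewrite powRM ?powR_ge0 // -!powRrM. Qed.

(** Hoelder in [y], then in [x], and reverse Minkowski for the second factor. In reciprocals of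
    exponents, the pairs (1 + 1/s, 1) and (1, 1 + 1/t), weighted by s/m and t/m with m = s + t,
    average to (1 + 1/m, 1 + 1/m). *)
Lemma mixed_norm_interpolation (X Y : finType) (P : pred X) (Q : pred Y)
    (A : X -> Y -> R) (s t : nat) : (0 < s)%N -> (0 < t)%N ->
  (forall x y, 0 <= A x y) ->
  \sum_(x | P x) \sum_(y | Q y) A x y `^ rexp R (s + t) <=
  (lr (rexp R s) P (fun x => \sum_(y | Q y) A x y) `^ (s%:R / (s + t)%:R) *
   lr (rexp R t) Q (fun y => \sum_(x | P x) A x y) `^ (t%:R / (s + t)%:R)) `^ rexp R (s + t).
Proof.
move=> s0 t0 A0.
have s0' : 0 < s%:R :> R by rewrite ltr0n.
have t0' : 0 < t%:R :> R by rewrite ltr0n.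
have rs0 := rexp_gt0 R s0; have rt0 := rexp_gt0 R t0.
have rm0 : 0 < rexp R (s + t) by rewrite rexp_gt0 // addn_gt0 s0.
set U := lr _ P _; set V := lr _ Q _.
pose a x := \sum_(y | Q y) A x y.
pose b x := lr (rexp R t) Q (A x).
have a0 x : 0 <= a x by apply: sumr_ge0.
have b0 x : 0 <= b x by exact: lr_ge0.
have rn : rexp R t != 0 by rewrite gt_eqF.
set th : R := s%:R / _; set th' : R := t%:R / _.
have th0 : 0 <= th by rewrite divr_ge0.
have th'0 : 0 <= th' by rewrite divr_ge0.
have mE : (s + t)%:R = s%:R + t%:R :> R by rewrite natrD.
have mn0 : s%:R + t%:R != 0 :> R by rewrite gt_eqF ?addr_gt0.
have m1n0 : s%:R + t%:R + 1 != 0 :> R by rewrite gt_eqF ?addr_gt0.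
have rmE : rexp R (s + t) = (s%:R + t%:R) / (s%:R + t%:R + 1) by rewrite /rexp -natr1 mE.
have rsE : rexp R s = s%:R / (s%:R + 1) by rewrite /rexp natr1.
have rtE : rexp R t = t%:R / (t%:R + 1) by rewrite /rexp natr1.
have sn0 : s%:R != 0 :> R by rewrite gt_eqF.
have tn0 : t%:R != 0 :> R by rewrite gt_eqF.
have s1n0 : s%:R + 1 != 0 :> R by rewrite gt_eqF ?addr_gt0.
have t1n0 : t%:R + 1 != 0 :> R by rewrite gt_eqF ?addr_gt0.
have inner x : \sum_(y | Q y) A x y `^ rexp R (s + t) <=
    a x `^ (th * rexp R (s + t)) * b x `^ (th' * rexp R (s + t)).
  pose l : R := th * rexp R (s + t).
  have lE : l = s%:R / (s%:R + t%:R + 1).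
    by rewrite /l /th rmE mE; field; rewrite mn0 m1n0.
  have l01 : 0 <= l <= 1.
    rewrite lE divr_ge0 ?addr_ge0 ?(ltW s0') ?(ltW t0') //= ler_pdivrMr ?addr_gt0 //.
    by rewrite mul1r -addrA lerDl addr_ge0 // ltW.
  have := @hoelder_powers R _ Q (A x) 1 (rexp R t) l (fun y _ => A0 x y) ltr01 rt0 l01.
  have -> : 1 * l + rexp R t * (1 - l) = rexp R (s + t).
    by rewrite lE rtE rmE; field; rewrite t1n0 m1n0.
  move=> /le_trans; apply.
  have -> : \sum_(y | Q y) A x y `^ 1 = a x by apply: eq_bigr => y _; rewrite powRr1.
  rewrite -(lrK _ _ rn) -/(b x) -powRrM.
  have -> : rexp R t * (1 - l) = th' * rexp R (s + t).
    by rewrite lE rtE rmE /th' mE; field; rewrite mn0 t1n0 m1n0.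
  exact: lexx.
apply: (@le_trans _ _ (\sum_(x | P x)
   a x `^ (th * rexp R (s + t)) * b x `^ (th' * rexp R (s + t)))).
  by apply: ler_sum => x _; exact: inner.
pose l : R := th' * rexp R (s + t).
have lE : l = t%:R / (s%:R + t%:R + 1).
  by rewrite /l /th' rmE mE; field; rewrite mn0 m1n0.
have l01 : 0 <= 1 - l <= 1.
  rewrite lE subr_ge0 gerBl divr_ge0 ?addr_ge0 ?(ltW s0') ?(ltW t0') // andbT.
  by rewrite ler_pdivrMr ?addr_gt0 // mul1r addrAC lerDr addr_ge0 // ltW.
apply: (@le_trans _ _ ((\sum_(x | P x) a x `^ rexp R s) `^ (1 - l) * (\sum_(x | P x) b x) `^ l)).
  have -> : l = 1 - (1 - l) by ring.
  rewrite [1 - (1 - (1 - l))](_ : _ = 1 - l); last by ring.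
  apply: le_trans (hoelder_sum (fun x _ => powR_ge0 _ _) (fun x _ => b0 x) l01).
  apply: ler_sum => x _; rewrite -powRrM.
  have -> : rexp R s * (1 - l) = th * rexp R (s + t).
    by rewrite lE rsE rmE /th mE; field; rewrite mn0 s1n0 m1n0.
  by rewrite /l [1 - (1 - _)]subKr.
rewrite powR_prod.
have -> : (\sum_(x | P x) a x `^ rexp R s) `^ (1 - l) = U `^ (th * rexp R (s + t)).
  rewrite /U /lr -powRrM; congr (_ `^ _).
  by rewrite lE rsE rmE /th mE; field; rewrite mn0 s1n0 m1n0 sn0.
apply: ler_wpM2l; rewrite ?powR_ge0 //; apply: ler_powR2; rewrite ?mulr_ge0 ?(ltW rm0) //.
  by apply: sumr_ge0 => x _; exact: b0.
rewrite /V; apply: le_trans (@lr_superadditive R _ _ Q P (fun y x => A x y) _ _ _) => //.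
by rewrite rt0 rexp_le1.
Qed.

End MixedNorms.

(** * Uniform random colourings of diffuse monomials *)

Section RandomSplit.
Variables (R : realType) (n : nat).
Implicit Types (x : 'I_n -> nat) (c : {ffun 'I_n -> bool}).

(** A tent supported by the proportions between 1/8 and 7/8. For a diffuse monomial the mean of |2t
    - 1| is at most 1/2, so that the mean of [psi] is at least 3 - 4/2 = 1. *)
Definition psi (t : R) : R := Num.max 0 (3 - 4 * `|2 * t - 1|).

(** A weighted median: the shortest initial segment carrying more than half of the mass ends at
    [j]. *)
Lemma balanced_cut x m : (0 < m)%N -> (\sum_i x i = m)%N ->
  exists j : 'I_n, (2 * \sum_(i : 'I_n | (i < j)%N) x i <= m)%N /\
                   (2 * \sum_(i : 'I_n | (j < i)%N) x i <= m)%N.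
Proof.
move=> m0 xm.
have exP : exists k, (m < 2 * \sum_(i : 'I_n | (i < k)%N) x i)%N.
  exists n; rewrite (eq_bigl xpredT) => [|i]; last exact: ltn_ord.
  by rewrite xm; move: m0; clear; lia.
case: (ex_minnP exP) => -[|k] Pk kmin.
  by move: Pk; rewrite big_pred0_eq muln0.
have kn : (k < n)%N.
  rewrite ltnNge; apply/negP => nk.
  have : (k.+1 <= k)%N; last by rewrite ltnn.
  apply: kmin; rewrite (eq_bigl xpredT) => [|i]; last by rewrite (leq_trans (ltn_ord i)).
  by rewrite xm; move: m0; clear; lia.
exists (Ordinal kn) => /=; split.
  by rewrite leqNgt; apply/negP => /kmin; rewrite ltnn.
have := xm; rewrite (bigID (fun i : 'I_n => (i < k.+1)%N)) /=.
rewrite [X in (_ + X)%N](eq_bigl (fun i : 'I_n => (k < i)%N)); last by move=> i; rewrite -leqNgt.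
move: Pk; move: (\sum_(i : 'I_n | (i < k.+1)%N) x i)%N (\sum_(i : 'I_n | (k < i)%N) x i)%N => A B.
by clear; lia.
Qed.

Definition sgn c i : R := if c i then 1 else -1.

Definition flip (D : pred 'I_n) c : {ffun 'I_n -> bool} := [ffun i => c i (+) D i].

Lemma flip_inj D : injective (flip D).
Proof.
by move=> c c' /ffunP e; apply/ffunP => i; have := e i; rewrite !ffunE => /addIb.
Qed.

Definition part x (D : pred 'I_n) c : R := \sum_(i | D i) sgn c i * (x i)%:R.

Lemma part_flip x (D E : pred 'I_n) c : (forall i, E i -> D i) ->
  part x E (flip D c) = - part x E c.
Proof.
move=> ED; rewrite /part -sumrN; apply: eq_bigr => i /ED Di.
by rewrite /sgn ffunE Di addbT; case: (c i); rewrite /= ?mulN1r ?mul1r ?opprK.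
Qed.

Lemma part_flip_disjoint x (D E : pred 'I_n) c : (forall i, E i -> ~~ D i) ->
  part x E (flip D c) = part x E c.
Proof.
move=> ED; apply: eq_bigr => i /ED /negbTE Di.
by rewrite /sgn ffunE Di addbF.
Qed.

Lemma norm_part x D c : `|part x D c| <= (\sum_(i | D i) x i)%:R.
Proof.
apply: le_trans (ler_norm_sum _ _ _) _; rewrite natr_sum; apply: ler_sum => i _.
by rewrite /sgn normrM normr_nat; case: (c i); rewrite ?normrN normr1 mul1r.
Qed.

(** The sum of the four moduli is the larger of 2 (|a| + |b| + |c|) and 4 times the largest of |a|,
    |b|, |c|. *)
Lemma four_signs (a b c m : R) : 2 * `|a| <= m -> 2 * `|b| <= m -> 2 * `|c| <= m ->
  `|a| + `|b| + `|c| <= m ->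
  `|a + b + c| + `|- a + b + c| + `|a - b + c| + `|a + b - c| <= 2 * m.
Proof.
move: (ler_norm a) (ler_norm (- a)) (ler_norm b) (ler_norm (- b)) (ler_norm c) (ler_norm (- c)).
rewrite !normrN; set A := `|a|; set B := `|b|; set C := `|c|; move: A B C => A B C.
move=> *; case: (ger0P (a + b + c)) => _; case: (ger0P (- a + b + c)) => _;
  case: (ger0P (a - b + c)) => _; case: (ger0P (a + b - c)) => _; lra.
Qed.

(* Conditioning on three blocks, each carrying at most half of the mass, leaves
   only the signs of the blocks, for which the bound is explicit. *)
Lemma mean_abs_sign_sum x m : (0 < m)%N -> (\sum_i x i = m)%N -> (forall i, (2 * x i <= m)%N) ->
  \sum_c `|part x xpredT c| <= 2 ^+ n * (m%:R / 2).
Proof.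
move=> m0 xm xle; have [j [jl jr]] := balanced_cut m0 xm.
pose D0 := [pred i : 'I_n | (i < j)%N]; pose D1 := [pred i : 'I_n | i == j].
pose D2 := [pred i : 'I_n | (j < i)%N].
pose y0 := part x D0; pose y1 := part x D1; pose y2 := part x D2.
have yE c : part x xpredT c = y0 c + y1 c + y2 c.
  rewrite /part (bigID D0) /= -addrA; congr (_ + _).
  rewrite (bigID D1) /=; congr (_ + _); apply: eq_bigl => i.
    by rewrite -leqNgt /= -val_eqE /=; case: ltngtP.
  by rewrite -leqNgt -val_eqE /=; case: ltngtP.
have s0 : \sum_c `|part x xpredT c| = \sum_c `|- y0 c + y1 c + y2 c|.
  rewrite (reindex_inj (@flip_inj D0)) /=; apply: eq_bigr => c _.
  rewrite yE /y0 /y1 /y2 (@part_flip x D0 D0) // !part_flip_disjoint // => i /=.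
    by rewrite -leqNgt => /ltnW.
  by move/eqP ->; rewrite ltnn.
have s1 : \sum_c `|part x xpredT c| = \sum_c `|y0 c - y1 c + y2 c|.
  rewrite (reindex_inj (@flip_inj D1)) /=; apply: eq_bigr => c _.
  rewrite yE /y0 /y1 /y2 (@part_flip x D1 D1) // !part_flip_disjoint // => i /=.
    by rewrite -val_eqE /=; case: ltngtP.
  by rewrite -val_eqE /=; case: ltngtP.
have s2 : \sum_c `|part x xpredT c| = \sum_c `|y0 c + y1 c - y2 c|.
  rewrite (reindex_inj (@flip_inj D2)) /=; apply: eq_bigr => c _.
  rewrite yE /y0 /y1 /y2 (@part_flip x D2 D2) // !part_flip_disjoint // => i /=.
    by move/eqP ->; rewrite ltnn.
  by rewrite -leqNgt => /ltnW.
have s3 : \sum_c `|part x xpredT c| = \sum_c `|y0 c + y1 c + y2 c|.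
  by apply: eq_bigr => c _; rewrite yE.
suff : \sum_c (`|y0 c + y1 c + y2 c| + `|- y0 c + y1 c + y2 c| + `|y0 c - y1 c + y2 c|
     + `|y0 c + y1 c - y2 c|) <= 2 ^+ n * (2 * m%:R).
  rewrite !big_split /= -s0 -s1 -s2 -s3; lra.
have -> : 2 ^+ n * (2 * m%:R) = \sum_(c : {ffun 'I_n -> bool}) 2 * m%:R :> R.
  by rewrite sumr_const card_ffun card_bool card_ord -(mulr_natl (2 * m%:R)) natrX.
apply: ler_sum => c _.
have m0E : (\sum_(i | D0 i) x i)%:R + (x j)%:R + (\sum_(i | D2 i) x i)%:R = m%:R :> R.
  rewrite -!natrD -xm; congr (_%:R); rewrite [RHS](bigID D0) /= -addnA; congr (_ + _)%N.
  rewrite [RHS](bigID D1) /=; congr (_ + _)%N.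
    rewrite (big_pred1 j) // => i; by rewrite /= -leqNgt -val_eqE /=; case: ltngtP.
  by apply: eq_bigl => i; rewrite -leqNgt -val_eqE /=; case: ltngtP.
have n0 := norm_part x D0 c; have n2 := norm_part x D2 c.
have n1 := norm_part x D1 c; rewrite big_pred1_eq in n1.
have l0 : 2 * (\sum_(i | D0 i) x i)%:R <= m%:R :> R by rewrite -natrM ler_nat.
have l1 : 2 * (x j)%:R <= m%:R :> R by rewrite -natrM ler_nat.
have l2 : 2 * (\sum_(i | D2 i) x i)%:R <= m%:R :> R by rewrite -natrM ler_nat.
move: n0 n1 n2; rewrite -/(y0 c) -/(y1 c) -/(y2 c) => n0 n1 n2.
by apply: four_signs; move: n0 n1 n2 l0 l1 l2 m0E; clear; lra.
Qed.

Lemma psi_ge0 t : 0 <= psi t.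
Proof. by rewrite /psi le_max lexx. Qed.

Lemma psi_le3 t : psi t <= 3.
Proof.
rewrite /psi ge_max; apply/andP; split; first by lra.
have := normr_ge0 (2 * t - 1); lra.
Qed.

Lemma psi_end : psi 0 = 0 /\ psi 1 = 0.
Proof.
rewrite /psi mulr0 sub0r normrN1 mulr1 (_ : 2 * 1 - 1 = 1 :> R); last by ring.
rewrite normr1 mulr1; split; apply/max_idPl; lra.
Qed.

Lemma mean_psi_ge1 x m : (0 < m)%N -> (\sum_i x i = m)%N -> (forall i, (2 * x i <= m)%N) ->
  1 <= 2 ^- n * \sum_(c : {ffun 'I_n -> bool}) psi ((\sum_(i | c i) x i)%:R / m%:R).
Proof.
move=> m0 xm xle.
have m0' : 0 < m%:R :> R by rewrite ltr0n.
rewrite ler_pdivlMl ?exprn_gt0 // mulr1.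
apply: (@le_trans _ _ (\sum_c (3 - 4 * (m%:R^-1 * `|part x xpredT c|)))).
  rewrite big_split /= sumr_const card_ffun card_bool card_ord sumrN -!mulr_sumr.
  have : m%:R^-1 * \sum_c `|part x xpredT c| <= 2 ^+ n / 2.
    apply: le_trans (ler_wpM2l _ (mean_abs_sign_sum m0 xm xle)) _; first by rewrite invr_ge0 ltW.
    by rewrite le_eqVlt; apply/orP; left; apply/eqP; field; rewrite gt_eqF.
  rewrite -(mulr_natl 3) natrX; lra.
apply: ler_sum => c _; rewrite /psi le_max; apply/orP; right; rewrite lerD2l lerN2.
rewrite ler_pM2l // le_eqVlt; apply/orP; left; apply/eqP.
have e : part x xpredT c = 2 * (\sum_(i | c i) x i)%:R - m%:R.
  rewrite -xm !natr_sum (bigID (fun i => c i) xpredT) /= /part (bigID (fun i => c i) xpredT) /=.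
  rewrite opprD addrA; congr (_ + _).
    rewrite (eq_bigr (fun i => (x i)%:R)) => [|i ci]; last by rewrite /sgn ci mul1r.
    by rewrite mulr_natl mulr2n addrK.
  by rewrite -sumrN; apply: eq_bigr => i /negbTE ci; rewrite /sgn ci mulN1r.
rewrite e -[m%:R^-1 in RHS]ger0_norm ?invr_ge0 ?(ltW m0') // -normrM; congr (`|_|).
by field; rewrite gt_eqF.
Qed.

End RandomSplit.

(** * Pure powers and Riesz products *)

Section PurePowers.
Variables (R : realType) (N : nat) (w : R[i]).
Hypothesis prim_w : N.-primitive_root w.
Variables n d : nat.
Hypothesis small_d : (2 * d.+1 <= N)%N.
Hypothesis small_nd : (n * d.+1 < N)%N.

Notation mono := {ffun 'I_n -> 'I_d.+1}.
Notation point := {ffun 'I_n -> 'I_N}.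
Notation ev := (@ev R N w n d.+1).
Notation monomial := (@monomial R N w n d.+1).

Definition atom (l : nat) (i : 'I_n) : mono := [ffun j => if j == i then inord l else ord0].

Definition pure (l : nat) : {set mono} := [set atom l i | i : 'I_n].

Lemma atomE l i j : (l <= d)%N -> atom l i j = (if j == i then l else 0%N) :> nat.
Proof. by move=> ld; rewrite ffunE; case: eqP => // _; rewrite inordK. Qed.

Lemma atom_inj l : (0 < l <= d)%N -> injective (atom l).
Proof.
move=> /andP[l0 ld] i j /ffunP /(_ i) /(congr1 val) /=.
rewrite !atomE // eqxx; case: eqP => [//|_ e]; by rewrite e in l0.
Qed.

Lemma deg_atom l i : (l <= d)%N -> deg (atom l i) = l.
Proof.
move=> ld; rewrite /deg (bigD1 i) //= atomE // eqxx big1 ?addn0 // => j /negbTE ji.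
by rewrite atomE // ji.
Qed.

Lemma sum_pure (V : nmodType) l (F : mono -> V) : (0 < l <= d)%N ->
  \sum_(x in pure l) F x = \sum_i F (atom l i).
Proof. by move=> ld; rewrite big_imset //= => i j _ _; exact: atom_inj. Qed.

Lemma pure_deg l x : (l <= d)%N -> x \in pure l -> deg x = l.
Proof. by move=> ld /imsetP[i _ ->]; exact: deg_atom. Qed.

(* Riesz products: the kernel [|1 + e^* z^l|^2 / 2] has mean one, and its
   Fourier coefficients at [0] and [l] are [1] and [e / 2]. *)
Lemma riesz_factor (e : R[i]) l k : modC e = 1 -> (0 < l <= d)%N -> (k <= d)%N ->
  \sum_(y < N) (1 + e^* * w ^+ (l * y)) * (1 + e^* * w ^+ (l * y))^* / 2 * w ^+ (k * y) =
  N%:R * ((k == 0%N)%:R + e / 2 * (k == l)%:R).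
Proof.
move=> e1 /andP[l0 ld] kd.
have lN : (l < N)%N by move: ld small_d; clear; lia.
have kN : (k < N)%N by move: kd small_d; clear; lia.
have ee : e^* * e = 1 by rewrite mulrC -modC_sqr e1 expr1n.
have term (y : 'I_N) : (1 + e^* * w ^+ (l * y)) * (1 + e^* * w ^+ (l * y))^* / 2 * w ^+ (k * y) =
   w ^+ (k * y) + e^* / 2 * w ^+ ((k + l) * y) + e / 2 * (w ^+ (k * y) * (w ^+ (l * y))^*).
  have ww := conj_rootX prim_w (l * y).
  rewrite rmorphD rmorphM /= rmorph1 conjCK mulnDl exprD.
  move: (w ^+ (l * y)) (w ^+ (l * y))^* ww (w ^+ (k * y)) => u u' uu v.
  transitivity ((1 + (e^* * e) * (u' * u)) / 2 * v + e^* / 2 * (v * u) + e / 2 * (v * u')).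
    by ring.
  by rewrite ee uu mulr1; field.
rewrite (eq_bigr _ (fun y _ => term y)) !big_split /= -!mulr_sumr.
rewrite (sum_rootX prim_w) (sum_rootX prim_w) (root_orthogonal prim_w) //.
rewrite [(N %| k + l)%N](_ : _ = false); last first.
  by rewrite /dvdn modn_small ?gtn_eqF ?addn_gt0 ?l0 ?orbT //; move: kd ld small_d; clear; lia.
rewrite mulr0 addr0 mulrDr; congr (_ + _).
  rewrite [(N %| k)%N](_ : _ = (k == 0%N)); last by rewrite /dvdn modn_small.
  by case: eqP; rewrite ?mulr1 ?mulr0.
by case: eqP; rewrite ?mulr1 ?mulr0 // mulrC.
Qed.

(** Duality with a Riesz product. The phases [e i] turn the coefficients of the pure powers into
    their moduli; the product kernel is nonnegative of mean 1 and meets the part of degree [l] only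
    in the pure powers, each with the factor 1/2. *)
Lemma sum_pure_le2 (a : mono -> R[i]) l : (0 < l <= d)%N ->
  (forall z, modC (ev a z) <= 1) -> \sum_(x in pure l) modC (a x) <= 2.
Proof.
move=> ld a1; have /andP[l0 ld'] := ld; rewrite sum_pure //.
have lN : (l < N)%N by move: ld' small_d; clear; lia.
have N0 : 0 < N%:R :> R by rewrite ltr0n (root_order_gt0 prim_w).
pose e i : R[i] := if a (atom l i) == 0 then 1 else (modC (a (atom l i)))%:C%C / a (atom l i).
have e1 i : modC (e i) = 1.
  rewrite /e; case: eqP => [_|/eqP an0]; first exact: modC1.
  by rewrite modCM modCV modC_real ?modC_ge0 // divff // modC_eq0.
have ea i : e i * a (atom l i) = (modC (a (atom l i)))%:C%C.
  rewrite /e; case: eqP => [->|/eqP an0]; first by rewrite mulr0 modC0.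
  by rewrite divfK.
pose g i (y : 'I_N) := 1 + (e i)^* * w ^+ (l * y).
pose rho i y := g i y * (g i y)^* / 2.
(* The kernel also sees the constant term and the products of l-th powers of several variables;
   their degrees differ from [l], so passing to the part of degree [l] removes them. *)
have h1 := hpart_le1 prim_w small_nd lN a1.
have fourier x : \sum_(z : point) (\prod_i rho i (z i)) * monomial x z =
    N%:R ^+ n * \prod_i ((x i == 0 :> nat)%:R + e i / 2 * (x i == l :> nat)%:R).
  transitivity (\sum_(z : point) \prod_i (rho i (z i) * w ^+ (x i * z i))).
    by apply: eq_bigr => z _; rewrite /monomial /tensor -big_split.
  rewrite -(bigA_distr_bigA (fun i y => rho i y * w ^+ (x i * y))) /=.
  rewrite (eq_bigr (fun i => N%:R * ((x i == 0 :> nat)%:R + e i / 2 * (x i == l :> nat)%:R))).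
    by rewrite big_split /= prodr_const card_ord.
  by move=> i _; rewrite riesz_factor // -ltnS.
have total : \sum_(z : point) (\prod_i rho i (z i)) * ev (hpart l a) z =
    N%:R ^+ n * ((\sum_i modC (a (atom l i))) / 2)%:C%C.
  transitivity (\sum_x hpart l a x * (\sum_(z : point) (\prod_i rho i (z i)) * monomial x z)).
    under eq_bigr => z _ do rewrite /ev mulr_sumr.
    rewrite exchange_big; apply: eq_bigr => x _; rewrite mulr_sumr; apply: eq_bigr => z _.
    by rewrite mulrCA.
  under eq_bigr => x _ do rewrite fourier mulrCA.
  rewrite -mulr_sumr; congr (_ * _).
  rewrite (bigID (mem (pure l))) /= [X in _ + X]big1 ?addr0 => [|x xnp].
    rewrite sum_pure // rmorphM /= rmorph_sum mulr_suml; apply: eq_bigr => i _.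
    rewrite /hpart deg_atom // eqxx (bigD1 i) //= atomE // eqxx eqn0Ngt l0 add0r eqxx mulr1.
    rewrite big1 ?mulr1 => [|j /negbTE ji]; last first.
      by rewrite atomE // ji eqxx eq_sym eqn0Ngt l0 mulr0 addr0.
    by rewrite mulrA [a _ * _]mulrC ea fmorphV rmorph_nat.
  rewrite /hpart; case: eqP => [dx|_]; last by rewrite mul0r.
  apply/eqP; rewrite mulf_eq0; apply/orP; right; apply/prodf_eq0.
  apply/exists_inP; apply: contraNT xnp; rewrite negb_exists_in => /forall_inP H.
  have val0l i : x i = 0 :> nat \/ x i = l :> nat.
    have := H i isT; case: (eqVneq (x i : nat) 0%N) => [|_]; first by left.
    by case: (eqVneq (x i : nat) l) => [|_]; [right | rewrite mulr0 addr0 eqxx].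
  have [i xi] : exists i, x i = l :> nat.
    apply/not_existsP => nex; move: dx l0; rewrite /deg big1 => [<- //|i _].
    by case: (val0l i) => // /nex.
  apply/imsetP; exists i => //; apply/ffunP => j; apply: val_inj; rewrite /= atomE //.
  case: eqP => [-> //|/eqP ji]; move: dx; rewrite /deg (bigD1 i) //= (bigD1 j) //= xi.
  by clear; lia.
have : modC (\sum_(z : point) (\prod_i rho i (z i)) * ev (hpart l a) z) <= N%:R ^+ n.
  apply: le_trans (ler_modC_sum _ _ _) _.
  apply: (@le_trans _ _ (\sum_(z : point) \prod_i (modC (g i (z i)) ^+ 2 / 2))).
    apply: ler_sum => z _; rewrite modCM -[leRHS]mulr1.
    apply: ler_pM; rewrite ?modC_ge0 ?h1 //.
    rewrite (big_morph (@modC R) (@modCM R) (modC1 R)).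
    apply: ler_prod => i _; rewrite modC_ge0 /rho !modCM modC_conj modCV modC_nat.
    by rewrite /= expr2 lexx.
  rewrite -(bigA_distr_bigA (fun i y => modC (g i y) ^+ 2 / 2)) /=.
  rewrite (eq_bigr (fun=> N%:R)) ?prodr_const ?card_ord // => i _.
  rewrite -mulr_suml.
  have ldN : (l.+1 <= N)%N by [].
  (* [g i] as a polynomial with two coefficients of modulus 1, so that Plancherel gives the kernel
     the mean (1 + 1) / 2. *)
  pose p (k : 'I_l.+1) : R[i] := if k == ord0 then 1 else if k == ord_max then (e i)^* else 0.
  have max0 : (@ord_max l == ord0) = false by rewrite -val_eqE /= eqn0Ngt l0.
  have p0 k : k != ord0 -> k != ord_max -> p k = 0.
    by rewrite /p => /negbTE -> /negbTE ->.
  have pv0 : modC (p ord0) = 1 by rewrite /p eqxx modC1.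
  have pv1 : modC (p ord_max) = 1 by rewrite /p max0 eqxx modC_conj e1.
  have := root_plancherel prim_w p ldN.
  rewrite (eq_bigr (fun y : 'I_N => modC (g i y) ^+ 2)) => [->|y _].
    rewrite (bigD1 ord0) // (bigD1 ord_max) ?max0 // big1 => [|k /= /andP[k0 kl]].
      by rewrite pv0 pv1 /=; field.
    by rewrite p0 // modC0 expr0n.
  congr (modC _ ^+ 2); rewrite (bigD1 ord0) //= (bigD1 ord_max) ?max0 //= big1 => [|k /andP[k0 kl]].
    by rewrite /p max0 !eqxx mul0n expr0 mulr1 addr0.
  by rewrite p0 // mul0r.
rewrite total modCM modCX modC_nat modC_real; last by rewrite divr_ge0 // sumr_ge0 // => i _; exact: modC_ge0.
by rewrite -[leRHS]mulr1 ler_pM2l ?exprn_gt0 // ler_pdivrMr // mul1r.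
Qed.

End PurePowers.

(** * Biased random colourings that isolate one variable *)

Section BiasedColorings.
Variables (R : realType) (n : nat).
Notation coloring := {ffun 'I_n -> bool}.

Definition bias (p : R) (c : coloring) : R := \prod_i (if c i then p else 1 - p).

Lemma bias_ge0 p c : 0 <= p <= 1 -> 0 <= bias p c.
Proof.
move=> /andP[p0 p1]; apply: prodr_ge0 => i _; case: ifP => // _.
by rewrite subr_ge0.
Qed.

Lemma sum_bias p (g : 'I_n -> bool -> R) :
  \sum_c bias p c * \prod_i g i (c i) = \prod_i (p * g i true + (1 - p) * g i false).
Proof.
transitivity (\sum_(c : coloring) \prod_i ((if c i then p else 1 - p) * g i (c i))).
  by apply: eq_bigr => c _; rewrite -big_split.
rewrite -(bigA_distr_bigA (fun i (b : bool) => (if b then p else 1 - p) * g i b)) /=.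
by apply: eq_bigr => i _; rewrite big_bool.
Qed.

Lemma sum_bias1 p : \sum_c bias p c = 1.
Proof.
have := sum_bias p (fun _ _ => 1); rewrite [RHS]big1 => [<-|i _]; last by ring.
by apply: eq_bigr => c _; rewrite big1 // mulr1.
Qed.

Lemma powR_expn (x e : R) j : 0 <= x -> (x ^+ j) `^ e = (x `^ e) ^+ j.
Proof. by move=> x0; rewrite -(powR_mulrn j x0) -(powR_mulrn j (powR_ge0 x e)) powRAC. Qed.

(* A mixture of product measures of parameters [2^-j]: one measure that
   isolates a given variable of a monomial of any degree [m] with probability
   nearly [1 / m]. *)
Definition nu (J : nat) (c : coloring) : R :=
  \sum_(j < J) (2 ^- j) `^ 10^-1 * bias (2 ^- j) c.

Lemma pow2V_itv j : 0 <= (2 ^- j : R) <= 1.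
Proof.
by rewrite invr_ge0 exprn_ge0 //= invf_le1 ?exprn_gt0 // exprn_ege1 // ler1n.
Qed.

Lemma nu_ge0 J c : 0 <= nu J c.
Proof. by apply: sumr_ge0 => j _; rewrite mulr_ge0 ?powR_ge0 ?bias_ge0 ?pow2V_itv. Qed.

Lemma sum_nu J : \sum_c nu J c <= (1 - 2^-1 `^ 10^-1)^-1.
Proof.
rewrite /nu exchange_big /=.
under eq_bigr => j _ do rewrite -mulr_sumr sum_bias1 mulr1.
set q : R := 2^-1 `^ 10^-1.
have q0 : 0 <= q by exact: powR_ge0.
have q1 : q < 1.
  have e1 : 1 `^ 10^-1 = 1 :> R by rewrite powR1.
  rewrite -[ltRHS]e1 /q gt0_ltr_powR ?nnegrE ?invr_gt0 ?invr_ge0 //; lra.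
have -> : \sum_(j < J) (2 ^- j) `^ 10^-1 = \sum_(j < J) q ^+ j.
  have i2 : 0 <= 2^-1 :> R by rewrite invr_ge0.
  by apply: eq_bigr => j _; rewrite -exprVn powR_expn.
have s0 : 0 < 1 - q by rewrite subr_gt0.
rewrite -[leRHS]mul1r ler_pdivlMr // mulrC.
have -> : (1 - q) * \sum_(j < J) q ^+ j = 1 - q ^+ J.
  by rewrite -[1 - q]opprB -[1 - q ^+ J]opprB subrX1 mulNr.
by rewrite gerBl exprn_ge0.
Qed.

Definition isolates (x : 'I_n -> nat) (i : 'I_n) (c : coloring) :=
  c i && [forall j, (j != i) && (0 < x j)%N ==> ~~ c j].

(** At most [m] variables occur besides [i]; each must receive [false], and the absent variables are
    free. *)
Lemma bias_isolates p (x : 'I_n -> nat) m i : 0 <= p <= 1 -> (\sum_i x i = m)%N ->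
  p * (1 - p) ^+ m <= \sum_(c | isolates x i c) bias p c.
Proof.
move=> p01 xm; have /andP[p0 p1] := p01.
pose g j (b : bool) : R := if j == i then b%:R else if (0 < x j)%N then (~~ b)%:R else 1.
have gE (c : coloring) : \prod_j g j (c j) = (isolates x i c)%:R.
  rewrite /isolates (bigD1 i) //= {1}/g eqxx; case: (c i) => /=; last by rewrite mul0r.
  rewrite mul1r; case: forallP => [H|/forallP].
    rewrite big1 // => j ji; rewrite /g (negbTE ji); case: ifP => // xj.
    by have := H j; rewrite ji xj /= => ->.
  rewrite negb_forall => /existsP[j]; rewrite negb_imply negbK => /andP[/andP[ji xj] cj].
  by rewrite (bigD1 j) //= {1}/g (negbTE ji) xj cj mul0r.
rewrite big_mkcond /=.
have -> : \sum_c (if isolates x i c then bias p c else 0) = \sum_c bias p c * \prod_j g j (c j).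
  by apply: eq_bigr => c _; rewrite gE; case: ifP; rewrite ?mulr1 ?mulr0.
rewrite sum_bias (bigD1 i) //= {1 2}/g eqxx mulr1 mulr0 addr0 ler_wpM2l //.
apply: (@le_trans _ _ (\prod_(j | j != i) (1 - p) ^+ x j)).
  rewrite prodrXr -xm (bigD1 i) //= addnC exprD ler_piMr ?exprn_ge0 ?subr_ge0 //.
  by rewrite exprn_ile1 ?subr_ge0 // gerBl.
apply: ler_prod => j ji; rewrite exprn_ge0 ?subr_ge0 //= /g (negbTE ji).
case: posnP => [->|xj]; first by rewrite expr0 !mulr1 subrKC.
rewrite mulr0 add0r mulr1; case: (x j) xj => // k _.
by rewrite exprS ler_piMr ?subr_ge0 // exprn_ile1 ?subr_ge0 // gerBl.
Qed.

(** Only a scale p = 2^(-j) with 1/(4m) <= p <= 1/(2m) is kept; there (1 - p)^m >= 1 - mp >= 1/2.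
    The density p^(1/10), which bounds the mass of [nu] independently of [J], raises the exponent
    from 1 to 11/10. *)
Lemma nu_isolates J (x : 'I_n -> nat) m i : (0 < m)%N -> (4 * m < 2 ^ J)%N ->
  (\sum_i x i = m)%N ->
  (4 * m%:R) `^ (- (11 / 10)) / 2 <= \sum_(c | isolates x i c) nu J c.
Proof.
move=> m0 mJ xm.
have m4 : (0 < 4 * m)%N by rewrite muln_gt0.
pose j := trunc_log 2 (4 * m).
have /andP[jl ju] /= := trunc_log_bounds (isT : (1 < 2)%N) m4.
have jJ : (j < J)%N by rewrite -(ltn_exp2l _ _ (isT : (1 < 2)%N)) (leq_ltn_trans jl).
have m0' : 0 < m%:R :> R by rewrite ltr0n.
have pj0 : 0 < 2 ^+ j :> R by rewrite exprn_gt0.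
have j1 : 2 ^+ j <= 4 * m%:R :> R by rewrite -natrX -natrM ler_nat.
have j2 : 2 * m%:R <= 2 ^+ j :> R.
  rewrite -natrX -natrM ler_nat; move: ju; rewrite expnS; move: (2 ^ j)%N => k; clear; lia.
set p : R := 2 ^- j.
have p01 : 0 <= p <= 1 := pow2V_itv j.
have /andP[p0 p1] := p01.
have pl : (4 * m%:R)^-1 <= p by rewrite lef_pV2 ?posrE ?mulr_gt0.
have pu : m%:R * p <= 2^-1.
  by rewrite ler_pdivrMr // ler_pdivlMl.
apply: (@le_trans _ _ (\sum_(c | isolates x i c) p `^ 10^-1 * bias p c)); last first.
  apply: ler_sum => c _; rewrite /nu (bigD1 (Ordinal jJ)) //= -/p lerDl.
  by apply: sumr_ge0 => k _; rewrite mulr_ge0 ?powR_ge0 ?bias_ge0 ?pow2V_itv.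
rewrite -mulr_sumr.
apply: (@le_trans _ _ (p `^ 10^-1 * (p * 2^-1))); last first.
  apply: ler_wpM2l; rewrite ?powR_ge0 //; apply: le_trans (bias_isolates i p01 xm).
  apply: ler_wpM2l => //; apply: (@le_trans _ _ (1 + m%:R * (- p))); first by lra.
  by apply: bernoulli_ineq; rewrite lerN2.
rewrite mulrA ler_wpM2r ?invr_ge0 //.
set y : R := 4 * m%:R; have y0 : 0 < y by rewrite mulr_gt0.
have -> : y `^ (- (11 / 10)) = y^-1 `^ 10^-1 * y^-1.
  rewrite (powRV _ (ltW y0)) -powRN -(powR_inv1 (ltW y0)) -powRD.
    by congr (_ `^ _); field.
  by rewrite (gt_eqF y0) implybT.
have i0 : 0 <= y^-1 by rewrite invr_ge0 ltW.
apply: (ler_pM (powR_ge0 _ _) i0 _ pl); apply: (ler_powR2 _ i0 pl).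
by rewrite invr_ge0.
Qed.

End BiasedColorings.

(** * The numerical inequality behind the exponent 24/5 *)

Section DiffuseConstant.
Variable R : realType.

(** The difference of the two sides vanishes at 0 and has the derivative y^3 / (1 + y), which has
    the sign of y. *)
Lemma ln1D_le_cubic (x : R) : -1 < x -> ln (1 + x) <= x - x ^+ 2 / 2 + x ^+ 3 / 3.
Proof.
move=> x1; pose f (y : R) := y - y ^+ 2 / 2 + y ^+ 3 / 3 - ln (1 + y).
have df (y : R) : -1 < y -> is_derive y 1 f (y ^+ 3 / (1 + y)).
  move=> y1; have y1p : 0 < 1 + y by lra.
  have dln : is_derive y 1 (fun y : R => ln (1 + y)) ((1 + y)^-1).
    have d1 : is_derive y 1 (fun y : R => 1 + y) 1.
      by have := is_deriveD (is_derive_cst (1 : R) y (1 : R)) (is_derive_id y (1 : R)); rewrite add0r.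
    have d2 : is_derive (1 + y) 1 (@ln R) (1 + y)^-1 := is_derive1_ln y1p.
    by have := is_derive1_comp d2 d1; rewrite mulr1.
  rewrite /f; apply: is_derive_eq; rewrite /GRing.scale /= ; field.
  by rewrite gt_eqF.
have f0 : f 0 = 0 by rewrite /f addr0 ln1 !expr0n /=; lra.
suff : 0 <= f x by rewrite /f subr_ge0.
have cont (a b : R) : -1 < a -> {within `[a, b], continuous f}.
  move=> a1; apply: derivable_within_continuous => y; rewrite in_itv /= => /andP[ay _].
  have dfy := df y (lt_le_trans a1 ay); exact: (@ex_derive _ _ _ _ _ _ _ dfy).
have [x0|x0] := leP 0 x.
  have [y|c + e] := @MVT_segment _ f (fun y => y ^+ 3 / (1 + y)) 0 x x0 _ (cont _ _ (ltrN10 R)).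
    by rewrite in_itv /= => /andP[y0 _]; apply: df; lra.
  rewrite in_itv /= => /andP[c0 _]; move: e; rewrite f0 !subr0 => ->.
  by rewrite mulr_ge0 // divr_ge0 ?exprn_ge0 // addr_ge0.
have [y|c + e] := @MVT_segment _ f (fun y => y ^+ 3 / (1 + y)) x 0 (ltW x0) _ (cont _ _ x1).
  by rewrite in_itv /= => /andP[y0 _]; apply: df; lra.
rewrite in_itv /= => /andP[xc c0]; move: e; rewrite f0 sub0r => e.
have : c ^+ 3 / (1 + c) * (0 - x) <= 0.
  rewrite mulr_le0_ge0 //; last by lra.
  rewrite mulr_le0_ge0 ?invr_ge0 //; last by lra.
  by rewrite exprS mulr_le0_ge0 // sqr_ge0.
by rewrite -e oppr_le0.
Qed.

(** The left side is minus the entropy of (1 + S) / 2. The cubic bound is used at S and at - S, and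
    the odd powers cancel. *)
Lemma entropy_upper (S : R) : 0 <= S < 1 ->
  (1 + S) / 2 * ln ((1 + S) / 2) + (1 - S) / 2 * ln ((1 - S) / 2)
    <= - ln 2 + S ^+ 2 / 2 + S ^+ 4 / 3.
Proof.
move=> /andP[S0 S1].
have p1 : 0 < 1 + S by lra.
have p2 : 0 < 1 - S by lra.
rewrite !ln_div ?posrE //.
have := @ln1D_le_cubic S; have := @ln1D_le_cubic (- S).
move=> /(_ _)/(ler_wpM2l (ltW p2)); rewrite ltrN2 => /(_ S1) h2.
move=> /(_ _)/(ler_wpM2l (ltW p1)) h1; have {}h1 := h1 (lt_le_trans (ltrN10 R) S0).
move: h1 h2; set a := ln (1 + S); set b := ln (1 - S); set c := ln 2.
have -> : (1 + S) * (S - S ^+ 2 / 2 + S ^+ 3 / 3) = S + S ^+ 2 / 2 - S ^+ 3 / 6 + S ^+ 4 / 3.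
  by field.
have -> : (1 - S) * (- S - (- S) ^+ 2 / 2 + (- S) ^+ 3 / 3) = - S + S ^+ 2 / 2 + S ^+ 3 / 6 + S ^+ 4 / 3.
  by field.
move=> h1 h2; have -> : (1 + S) / 2 * (a - c) + (1 - S) / 2 * (b - c)
   = ((1 + S) * a + (1 - S) * b) / 2 - c by field.
lra.
Qed.

Lemma expR_ge_pow (y : R) k : (0 < k)%N -> 0 <= 1 + y / k%:R -> (1 + y / k%:R) ^+ k <= expR y.
Proof.
move=> k0 y0; have kn0 : k%:R != 0 :> R by rewrite pnatr_eq0 -lt0n.
have {2}-> : y = k%:R * (y / k%:R) by field.
by rewrite expRM_natl ler_pXn2r ?nnegrE ?expR_ge0 // expR_ge1Dx.
Qed.

Lemma expR_tangent (x x0 c : R) : 0 <= c -> c <= expR (- x0) -> x <= 1 + x0 ->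
  c * (1 + x0 - x) <= expR (- x).
Proof.
move=> c0 cx xx; apply: (@le_trans _ _ (expR (- x0) * (1 + (x0 - x)))).
  by rewrite -addrA ler_wpM2r // addrA subr_ge0.
have -> : expR (- x) = expR (- x0) * expR (x0 - x) by rewrite -expRD; congr expR; ring.
by rewrite ler_wpM2l ?expR_ge0 // expR_ge1Dx.
Qed.

(** Reduction to linear arithmetic: the exponential is replaced by its tangent at - [x0], with [c]
    below exp (- [x0]), and the convex S^2 and S^4 by their chords over the interval. In [S], [t]
    and [tt] everything is linear. *)
Lemma diffuse_piece (S t x0 c a b : R) k :
  0 <= c -> (0 < k)%N -> 0 <= 1 + - x0 / k%:R -> c <= (1 + - x0 / k%:R) ^+ k ->
  t = S ^+ 2 -> 0 <= a -> a <= S -> S <= b ->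
  (forall tt : R, t <= (a + b) * S - a * b -> a * a <= t ->
     tt <= (a * a + b * b) * t - (a * a) * (b * b) ->
     12 / 5 * t + 8 / 5 * tt <= 1 + x0 /\
     1497 / 10000 * (3 - S - 4 * t) <= 99 / 200 * (c * (1 + x0 - (12 / 5 * t + 8 / 5 * tt)))) ->
  1497 / 10000 * (3 - S - 4 * t) <= 99 / 200 * expR (- (12 / 5 * t + 8 / 5 * (t * t))).
Proof.
move=> c0 k0 k1 ck tE a0 aS Sb.
have chord (u v y : R) : u <= y -> y <= v -> y * y <= (u + v) * y - u * v.
  move=> uy yv; have := mulr_ge0 (_ : 0 <= y - u) (_ : 0 <= v - y).
  rewrite !subr_ge0 => /(_ uy yv) h; rewrite -subr_ge0; apply: le_trans h _.
  by rewrite le_eqVlt; apply/orP; left; apply/eqP; ring.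
have at_ : a * a <= t by rewrite tE expr2 ler_pM.
have tb : t <= b * b by rewrite tE expr2 ler_pM // (le_trans a0).
have tc : t <= (a + b) * S - a * b by rewrite tE expr2 chord.
move=> /(_ _ tc at_ (chord _ _ _ at_ tb)) [xx] /le_trans; apply.
apply: (ler_wpM2l (divr_ge0 (ler0n _ 99) (ler0n _ 200))).
apply: expR_tangent xx => //; apply: le_trans ck _; exact: expR_ge_pow.
Qed.

(** 12/5 and 8/5 are 24/5 times the coefficients 1/2 and 1/3 of [entropy_upper]; 1497/10000 exceeds
    (208/25) / 2 * (10/278), with 278/10 from [two_powR]; at 3/4 the tent reaches 0. In each piece
    [x0] lies in the range of the exponent and [c] rounds (1 - x0/k)^k down. *)
Lemma diffuse_polynomial (S : R) : 0 <= S <= 3 / 4 ->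
  1497 / 10000 * ((1 + S) * (3 - 4 * S)) <=
  99 / 200 * expR (- (12 / 5 * S ^+ 2 + 8 / 5 * S ^+ 4)).
Proof.
move=> /andP[S0 S1].
have -> : S ^+ 4 = S ^+ 2 * S ^+ 2 by rewrite -exprD.
have -> : (1 + S) * (3 - 4 * S) = 3 - S - 4 * S ^+ 2 by ring.
have [t tE] : exists t, t = S ^+ 2 by exists (S ^+ 2).
rewrite -tE.
have [Sa|Sa] := leP S (9 / 20).
  apply: (@diffuse_piece S t (3 / 10) (737 / 1000) 0 (9 / 20) 10 _ isT _ _ tE (lexx _) S0 Sa);
    [by clear; lra..|].
  by move: t Sa S0 {tE S1} => t *; split; lra.
have [Sb|Sb] := leP S (3 / 5).
  apply: (@diffuse_piece S t (4 / 5) (434 / 1000) (9 / 20) (3 / 5) 10 _ isT _ _ tE _ (ltW Sa) Sb);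
    [by clear; lra..|].
  by move: t Sa Sb {S0 tE S1} => t *; split; lra.
apply: (@diffuse_piece S t (7 / 5) (234 / 1000) (3 / 5) (3 / 4) 20 _ isT _ _ tE _ (ltW Sb) S1);
  [by clear; lra..|].
by move: t S1 Sb {S0 tE Sa} => t *; split; lra.
Qed.

Lemma two_powR : (278 / 10 : R) <= 2 `^ (24 / 5).
Proof.
have e5 : 2 `^ (24 / 5) = (2 ^+ 24) `^ 5^-1 :> R by rewrite -powR_mulrn // -powRrM.
have c0 : 0 <= (278 / 10 : R) := divr_ge0 (ler0n _ _) (ler0n _ _).
rewrite e5 -[leLHS](@powRVK _ 5) // ?powR_mulrn //; apply: ler_powR2; rewrite ?invr_ge0 ?exprn_ge0 //.
by clear; lra.
Qed.

(** For [t] = s/m, the ratio of m^(-24/5) to the weighted geometric mean of s^(-24/5) and (m -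
    s)^(-24/5); it is exp (- 24/5 h) with h the entropy of [t]. *)
Definition split_factor (t : R) : R := (t `^ t * (1 - t) `^ (1 - t)) `^ (24 / 5).

Lemma diffuse_constant_half (t : R) : 1 / 2 <= t < 1 ->
  208 / 25 * psi t * split_factor t * t <= 99 / 200.
Proof.
move=> /andP[th t1]; set S := 2 * t - 1.
have S0 : 0 <= S by rewrite /S; lra.
have tE : t = (1 + S) / 2 by rewrite /S; lra.
have tE' : 1 - t = (1 - S) / 2 by rewrite /S; lra.
have t0 : 0 < t by lra.
have t10 : 0 < 1 - t by lra.
rewrite /psi -/S ger0_norm //.
have [S34|S34] := leP S (3 / 4); last first.
  rewrite (_ : Num.max _ _ = 0); last by apply/max_idPl; lra.
  by rewrite mulr0 !mul0r divr_ge0.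
rewrite (_ : Num.max _ _ = 3 - 4 * S); last by apply/max_idPr; lra.
have F0 : split_factor t = expR (24 / 5 * (t * ln t + (1 - t) * ln (1 - t))).
  rewrite /split_factor /powR (gt_eqF t0) (gt_eqF t10) -expRD gt_eqF ?expR_gt0 //.
  by rewrite expRK.
pose x := 12 / 5 * S ^+ 2 + 8 / 5 * S ^+ 4.
have F : split_factor t <= (2 `^ (24 / 5))^-1 * (expR (- x))^-1.
  rewrite -expRN opprK /powR (gt_eqF (ltr0n _ 2)) -expRN -expRD F0 ler_expR.
  have Sl : 0 <= S < 1 by rewrite S0 /=; lra.
  have := entropy_upper Sl; rewrite -tE -tE' => h.
  apply: le_trans (ler_wpM2l _ h) _; first by rewrite divr_ge0.
  by rewrite /x; lra.
have q : (2 `^ (24 / 5))^-1 <= 10 / 278 :> R.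
  rewrite -[leRHS]invf_div lef_pV2 ?posrE ?powR_gt0 ?divr_gt0 //; exact: two_powR.
have := diffuse_polynomial; move=> /(_ S); rewrite S0 S34 => /(_ isT); rewrite -/x => D.
have E0 : 0 < expR (- x) := expR_gt0 _.
have D' : 1497 / 10000 * ((1 + S) * (3 - 4 * S)) * (expR (- x))^-1 <= 99 / 200.
  by rewrite ler_pdivrMr.
apply: le_trans D'.
have -> : 208 / 25 * (3 - 4 * S) * split_factor t * t =
  (208 / 25 / 2 * ((1 + S) * (3 - 4 * S))) * split_factor t by rewrite {2}tE; ring.
have P0 : 0 <= (1 + S) * (3 - 4 * S) by rewrite mulr_ge0 //; lra.
have k0 : 0 <= 208 / 25 / 2 :> R by rewrite !divr_ge0.
apply: le_trans (ler_wpM2l (mulr_ge0 k0 P0) F) _.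
rewrite mulrA ler_wpM2r ?invr_ge0 ?expR_ge0 //.
apply: le_trans (ler_wpM2l (mulr_ge0 k0 P0) q) _.
rewrite mulrAC ler_wpM2r //; clear; lra.
Qed.

Lemma psi_sym (t : R) : psi (1 - t) = psi t.
Proof.
rewrite /psi; have -> : 2 * (1 - t) - 1 = - (2 * t - 1) by ring.
by rewrite normrN.
Qed.

Lemma split_factor_sym (t : R) : split_factor (1 - t) = split_factor t.
Proof. by rewrite /split_factor subKr mulrC. Qed.

(** 208/25 = 8 * (26/25) collects the losses of [vfac_split] and [root_le_104]; 99/200 is half of
    the share 99/100. At [t = 1/2] the left side is 12.48 / 2^(24/5), about 0.45; with 23/5 for 24/5
    it would exceed 99/200. *)
Lemma diffuse_constant (t : R) : 0 < t < 1 ->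
  208 / 25 * psi t * split_factor t * t <= 99 / 200.
Proof.
move=> /andP[t0 t1]; have [th|th] := leP (1 / 2) t.
  by apply: diffuse_constant_half; rewrite th.
have : 1 / 2 <= 1 - t < 1 by apply/andP; split; lra.
move=> /diffuse_constant_half; rewrite psi_sym split_factor_sym; apply: le_trans.
apply: ler_wpM2l; last by lra.
by rewrite !mulr_ge0 ?psi_ge0 ?powR_ge0 // divr_ge0.
Qed.

End DiffuseConstant.

(** * The weights and the cost of a single split *)

Section Weights.
Variable R : realType.

(** 225 = 9 * 25. One factor 3 pays for the three classes of monomials, the other for [psi_le3],
    both to the power 1/m; with 25, Bernoulli's inequality gives (m/25)^(1/m) <= 26/25. *)
Definition gain : R := 225.

Lemma gain_gt0 : 0 < gain.
Proof. by rewrite ltr0n. Qed.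

Definition weight (eta : R) (m : nat) : R :=
  eta * (m%:R `^ (- (24 / 5)) * gain `^ m%:R^-1).

Lemma weight_gt0 eta m : 0 < eta -> (0 < m)%N -> 0 < weight eta m.
Proof.
move=> e0 m0; rewrite /weight; apply: mulr_gt0 => //.
by apply: mulr_gt0; apply: powR_gt0; rewrite ?gain_gt0 ?ltr0n.
Qed.

Lemma weight_ge0 eta m : 0 <= eta -> 0 <= weight eta m.
Proof. by move=> e0; rewrite /weight; apply: mulr_ge0 => //; apply: mulr_ge0; exact: powR_ge0. Qed.

Lemma powRDr (x p q : R) : 0 < x -> x `^ (p + q) = x `^ p * x `^ q.
Proof. by move=> x0; rewrite powRD // (gt_eqF x0) implybT. Qed.

Lemma ler_powRN (x y p : R) : 0 < x -> x <= y -> 0 <= p -> y `^ (- p) <= x `^ (- p).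
Proof.
move=> x0 xy p0; rewrite !powRN lef_pV2 ?posrE ?powR_gt0 ?(lt_le_trans x0) //.
by apply: ler_powR2 => //; exact: ltW.
Qed.

Lemma powRM3 (x y z p : R) : 0 < x -> 0 < y -> 0 <= z ->
  (x * (y * z)) `^ p = x `^ p * (y `^ p * z `^ p).
Proof.
move=> x0 y0 z0; rewrite powRM ?(ltW x0) ?mulr_ge0 ?(ltW y0) //.
by rewrite (powRM _ (ltW y0) z0).
Qed.

Lemma ratio_sum1 (s t : nat) : (0 < s)%N -> (0 < t)%N ->
  t%:R / (s + t)%:R = 1 - s%:R / (s + t)%:R :> R.
Proof.
move=> s0 t0; have n0 : (s + t)%:R != 0 :> R by rewrite pnatr_eq0 -lt0n addn_gt0 s0.
by apply: (mulIf n0); rewrite mulrBl !divfK // mul1r natrD addrAC subrr add0r.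
Qed.

Lemma ratio_itv (s t : nat) : (0 < s)%N -> (0 < t)%N -> 0 < (s%:R / (s + t)%:R : R) < 1.
Proof.
move=> s0 t0; have n0 : 0 < (s + t)%:R :> R by rewrite ltr0n addn_gt0 s0.
apply/andP; split; first by rewrite divr_gt0 // ltr0n.
by rewrite ltr_pdivrMr // mul1r ltr_nat -[X in (X < _)%N]addn0 ltn_add2l.
Qed.

(* The factor [gain ^ (1/m)] in the weight gains [gain ^ (-1/m)] at each split,
   because [1/s * s/m + 1/t * t/m = 2/m]. *)
Lemma weight_split eta s t : 0 < eta -> (0 < s)%N -> (0 < t)%N ->
  let th := s%:R / (s + t)%:R in
  weight eta (s + t) = split_factor th * gain `^ (- (s + t)%:R^-1) *
    (weight eta s `^ th * weight eta t `^ (1 - th)).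
Proof.
move=> e0 s0 t0 th; have m0 : (0 < s + t)%N by rewrite addn_gt0 s0.
have sp : 0 < s%:R :> R by rewrite ltr0n.
have tp : 0 < t%:R :> R by rewrite ltr0n.
have mp : 0 < (s + t)%:R :> R by rewrite ltr0n.
have cp := gain_gt0.
have /andP[th0 th1] := ratio_itv s0 t0.
have lnW m : (0 < m)%N -> ln (weight eta m) = ln eta - 24 / 5 * ln m%:R + m%:R^-1 * ln gain.
  move=> m0'; have mp' : 0 < m%:R :> R by rewrite ltr0n.
  rewrite /weight !lnM ?posrE ?mulr_gt0 ?powR_gt0 // !ln_powR; ring.
have sf0 : 0 < split_factor th.
  by apply: powR_gt0; apply: mulr_gt0; apply: powR_gt0; rewrite // subr_gt0.
have Ws := weight_gt0 e0 s0; have Wt := weight_gt0 e0 t0.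
have sg0 : 0 < split_factor th * gain `^ (- (s + t)%:R^-1) := mulr_gt0 sf0 (powR_gt0 _ cp).
have st0 : 0 < weight eta s `^ th * weight eta t `^ (1 - th).
  by apply: mulr_gt0; exact: powR_gt0.
apply: ln_inj; rewrite ?posrE ?weight_gt0 //; first exact: mulr_gt0.
rewrite lnW // lnM ?posrE //.
have p1 : 0 < th `^ th := powR_gt0 _ th0.
have p2 : 0 < (1 - th) `^ (1 - th) by apply: powR_gt0; rewrite subr_gt0.
rewrite (lnM (x := split_factor th)) ?posrE //; last exact: powR_gt0.
rewrite (lnM (x := weight eta s `^ th)) ?posrE //; [|exact: powR_gt0..].
have -> : ln (split_factor th) = 24 / 5 * (th * ln th + (1 - th) * ln (1 - th)).
  by rewrite /split_factor ln_powR lnM ?posrE // !ln_powR.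
rewrite (ln_powR gain) (ln_powR (weight eta s)) (ln_powR (weight eta t)) (lnW _ s0) (lnW _ t0).
have -> : 1 - th = t%:R / (s + t)%:R by rewrite ratio_sum1.
rewrite /th !ln_div ?posrE // natrD.
move: (ln s%:R) (ln t%:R) (ln (s%:R + t%:R)) (ln eta) (ln gain) => a b c e f.
field; rewrite ?gt_eqF ?addr_gt0 //.
Qed.

(** For s > 1 the power is at least exp (-2), as 1 + x <= exp x; and (1 - 2/40)^40 <= exp (-2) still
    exceeds 1/8. *)
Lemma vfac_pow_ge s : (0 < s)%N -> 8^-1 <= vfac R s ^+ s.
Proof.
rewrite /vfac; case: eqP => [-> _|_ s0]; first by rewrite expr1.
have sp : 0 < s%:R :> R by rewrite ltr0n.
apply: (@le_trans _ _ (expR (- 2))).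
  apply: le_trans (@expR_ge_pow R _ 40 isT _); clear; lra.
have -> : - 2 = s%:R * - (2 / s%:R) :> R by field; rewrite gt_eqF.
rewrite expRM_natl ler_pXn2r ?nnegrE ?expR_ge0 ?divr_ge0 //.
have -> : s%:R / s.+2%:R = (1 + 2 / s%:R)^-1 :> R.
  by rewrite -addn2 natrD; field; rewrite !gt_eqF ?addr_gt0.
by rewrite expRN lef_pV2 ?posrE ?expR_gt0 ?addr_gt0 ?divr_gt0 // expR_ge1Dx.
Qed.

(** Since (v^t)^(s/m) = (v^s)^(t/m), each multiplier is raised to its own degree, and the loss is at
    most 8 however unbalanced the split. *)
Lemma vfac_split s t : (0 < s)%N -> (0 < t)%N ->
  8^-1 <= (vfac R s ^+ t) `^ (s%:R / (s + t)%:R) * (vfac R t ^+ s) `^ (t%:R / (s + t)%:R).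
Proof.
move=> s0 t0.
have vs := vfac_gt0 R s0; have vt := vfac_gt0 R t0.
have mp : (s + t)%:R != 0 :> R by rewrite pnatr_eq0 -lt0n addn_gt0 s0.
have swap (a b : nat) (v : R) : 0 < v ->
    (v ^+ b) `^ (a%:R / (s + t)%:R) = (v ^+ a) `^ (b%:R / (s + t)%:R).
  move=> v0; rewrite -!(powR_mulrn _ (ltW v0)) -!powRrM; congr (_ `^ _); ring.
rewrite (swap s t (vfac R s)) // (swap t s (vfac R t)) //.
have i0 : 0 <= 8^-1 :> R by rewrite invr_ge0 ler0n.
have -> : 8^-1 = 8^-1 `^ (t%:R / (s + t)%:R) * 8^-1 `^ (s%:R / (s + t)%:R) :> R.
  rewrite -powRDr; last by rewrite invr_gt0 ltr0n.
  by rewrite -mulrDl -natrD addnC divff // powRr1.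
apply: ler_pM; rewrite ?powR_ge0 //; apply: ler_powR2; rewrite ?vfac_pow_ge ?divr_ge0 //.
Qed.

Lemma root_le_104 m : (0 < m)%N -> (9 * m%:R) `^ m%:R^-1 * gain `^ (- m%:R^-1) <= 26 / 25 :> R.
Proof.
move=> m0; have mp : 0 < m%:R :> R by rewrite ltr0n.
have c0 := ltW gain_gt0.
have e0 : 0 <= 26 / 25 :> R := divr_ge0 (ler0n _ _) (ler0n _ _).
have y0 : 0 <= 9 * m%:R :> R by rewrite mulr_ge0 ?ler0n.
rewrite powRN -(powRV _ c0) -powRM ?invr_ge0 //.
rewrite /gain -[leRHS](@powRVK _ m%:R) ?gt_eqF //; apply: ler_powR2.
- by rewrite invr_ge0 ltW.
- by rewrite mulr_ge0 ?invr_ge0.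
rewrite powR_mulrn // -[26 / 25](subrKC 1).
apply: le_trans (@bernoulli_ineq R (26 / 25 - 1) m _); last by clear; lra.
move: m%:R mp; clear => x; lra.
Qed.

(** Weighted AM-GM between the two budget terms [u] and [v], followed by [diffuse_constant] at [th]
    for [u] and at 1 - [th] for [v]. *)
Lemma diffuse_term eta s t (U V : R) : 0 < eta -> (0 < s)%N -> (0 < t)%N ->
  0 <= U -> 0 <= V ->
  (9 * (s + t)%:R) `^ (s + t)%:R^-1 * (weight eta (s + t) *
    (psi (s%:R / (s + t)%:R) * (U `^ (s%:R / (s + t)%:R) * V `^ (t%:R / (s + t)%:R)))) <=
  99 / 200 * (weight eta s * (vfac R s ^+ t * U) + weight eta t * (vfac R t ^+ s * V)).
Proof.
move=> e0 s0 t0 U0 V0; set m := (s + t)%N; set th := s%:R / m%:R.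
have m0 : (0 < m)%N by rewrite addn_gt0 s0.
have th'E : t%:R / m%:R = 1 - th by rewrite /th /m ratio_sum1.
have /andP[th0 th1] := ratio_itv s0 t0; rewrite -/m -/th in th0 th1.
have Ws := weight_gt0 e0 s0; have Wt := weight_gt0 e0 t0.
have vs : 0 < vfac R s ^+ t by rewrite exprn_gt0 // vfac_gt0.
have vt : 0 < vfac R t ^+ s by rewrite exprn_gt0 // vfac_gt0.
set u := weight eta s * _; set v := weight eta t * (vfac R t ^+ s * V).
have u0 : 0 <= u by apply: mulr_ge0; [exact: ltW|apply: mulr_ge0 => //; exact: ltW].
have v0 : 0 <= v by apply: mulr_ge0; [exact: ltW|apply: mulr_ge0 => //; exact: ltW].
have sf0 : 0 <= split_factor th by exact: powR_ge0.
pose vv := (vfac R s ^+ t) `^ th * (vfac R t ^+ s) `^ (1 - th).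
have vv0 : 8^-1 <= vv by have := vfac_split s0 t0; rewrite -/m -/th th'E.
pose ww := weight eta s `^ th * weight eta t `^ (1 - th).
have uvE : u `^ th * v `^ (1 - th) = ww * vv * (U `^ th * V `^ (1 - th)).
  rewrite /u /v /ww /vv.
  rewrite (powRM3 _ Ws vs U0) (powRM3 _ Wt vt V0).
  by move: (_ `^ th) (_ `^ th) (_ `^ th) (_ `^ (1 - th)) => *; ring.
have th01 : 0 <= th <= 1 by rewrite !ltW.
have amgm := weighted_amgm u0 v0 th01.
have UV0 : 0 <= U `^ th * V `^ (1 - th) by rewrite mulr_ge0 ?powR_ge0.
have ww0 : 0 <= ww by rewrite mulr_ge0 ?powR_ge0.
have wUV : ww * (U `^ th * V `^ (1 - th)) <= 8 * (th * u + (1 - th) * v).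
  apply: le_trans (ler_wpM2l (ler0n _ 8) amgm); rewrite uvE.
  have h : 1 <= 8 * vv by rewrite -ler_pdivrMl ?ltr0n // mulr1.
  have := ler_wpM2r (mulr_ge0 ww0 UV0) h; rewrite mul1r => /le_trans; apply.
  by rewrite le_eqVlt; apply/orP; left; apply/eqP; ring.
have p0 := psi_ge0 th.
rewrite th'E weight_split // -/m -/th -/ww.
set g := (9 * m%:R) `^ _; set h := gain `^ _.
have gh : g * h <= 26 / 25 := root_le_104 m0.
have gh0 : 0 <= g * h by rewrite mulr_ge0 ?powR_ge0.
have -> : g * (split_factor th * h * ww * (psi th * (U `^ th * V `^ (1 - th)))) =
   (g * h) * (psi th * split_factor th * (ww * (U `^ th * V `^ (1 - th)))) by ring.
have ps0 : 0 <= psi th * split_factor th by exact: mulr_ge0.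
apply: le_trans (ler_wpM2r _ gh) _; first by apply: mulr_ge0 => //; exact: mulr_ge0.
have c0 : 0 <= 26 / 25 :> R := divr_ge0 (ler0n _ _) (ler0n _ _).
apply: le_trans (ler_wpM2l c0 (ler_wpM2l ps0 wUV)) _.
have th01' : 0 < th < 1 by rewrite th0.
have th02' : 0 < 1 - th < 1 by rewrite subr_gt0 th1 gtrBl.
have := ler_wpM2r u0 (diffuse_constant th01').
have := ler_wpM2r v0 (diffuse_constant th02'); rewrite psi_sym split_factor_sym.
move=> h1 h2; have := lerD h2 h1; rewrite -mulrDr; apply: le_trans.
by rewrite le_eqVlt; apply/orP; left; apply/eqP; field.
Qed.

(* With [x = k/m <= 1/2] and [z^x <= 1 + z] for [z = m^(12/5) u], the exponent
   [11/10 - 24/5 (1 - x) - 12/5 x] of [m] is at most [-5/2]. *)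
Lemma cap_term eta l k (U V : R) : 0 < eta <= 1 -> (0 < k <= l)%N ->
  0 <= U -> vfac R l ^+ k * U <= 4 -> 0 <= V ->
  (l + k)%:R `^ (11 / 10) * (weight eta (l + k) *
    (U `^ (l%:R / (l + k)%:R) * V `^ (k%:R / (l + k)%:R))) <=
  32 * Num.sqrt eta * ((l + k)%:R `^ (- (5 / 2)) + weight eta k * (vfac R k ^+ l * V)).
Proof.
move=> /andP[e0 e1] /andP[k0 kl] U0 U4 V0; set m := (l + k)%N.
have l0 : (0 < l)%N := leq_trans k0 kl.
have m0 : (0 < m)%N by rewrite addn_gt0 l0.
have mp : 0 < m%:R :> R by rewrite ltr0n.
set x := k%:R / m%:R; set th := l%:R / m%:R.
have xE : x = 1 - th by rewrite /x /th /m ratio_sum1.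
have /andP[th0 th1] := ratio_itv l0 k0; rewrite -/m -/th in th0 th1.
have x0 : 0 <= x by rewrite xE subr_ge0 ltW.
have x2 : x <= 2^-1.
  by rewrite /x ler_pdivrMr // ler_pdivlMl ?ltr0n // -natrM ler_nat /m mul2n -addnn leq_add2r.
have Wk := weight_gt0 e0 k0; have Wl := weight_gt0 e0 l0.
have vl : 0 < vfac R l ^+ k by rewrite exprn_gt0 // vfac_gt0.
have vk : 0 < vfac R k ^+ l by rewrite exprn_gt0 // vfac_gt0.
set u := weight eta k * _.
have u0 : 0 <= u by apply: mulr_ge0; [exact: ltW|apply: mulr_ge0 => //; exact: ltW].
pose vv := (vfac R l ^+ k) `^ th * (vfac R k ^+ l) `^ x.
have vv0 : 8^-1 <= vv by exact: vfac_split.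
have vvp : 0 < vv by apply: lt_le_trans vv0; rewrite invr_gt0 ltr0n.
have step1 : weight eta k `^ x * (U `^ th * V `^ x) <= 32 * u `^ x.
  have -> : u `^ x = weight eta k `^ x * ((vfac R k ^+ l) `^ x * V `^ x).
    exact: powRM3.
  rewrite [leRHS]mulrCA ler_wpM2l ?powR_ge0 // [leRHS]mulrA ler_wpM2r ?powR_ge0 //.
  have h1 : (vfac R l ^+ k) `^ th * U `^ th <= 4.
    rewrite -powRM ?(ltW vl) //; have := ler_powR2 (ltW th0) (mulr_ge0 (ltW vl) U0) U4.
    move=> /le_trans; apply; apply: ler1_powR; [by rewrite ler1n | exact: ltW].
  have h2 : 1 <= 8 * vv by rewrite -ler_pdivrMl ?ltr0n // mulr1.
  have Uth : 0 <= U `^ th := powR_ge0 _ _.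
  have := ler_wpM2r Uth h2; rewrite mul1r => /le_trans; apply.
  have h3 := ler_wpM2l (mulr_ge0 (ler0n R 8) (powR_ge0 (vfac R k ^+ l) x)) h1.
  apply: le_trans (le_trans _ h3) _; rewrite le_eqVlt; apply/orP; left; apply/eqP; rewrite /vv; ring.
have Wm : weight eta m <= weight eta k `^ x * (Num.sqrt eta * m%:R `^ (- (24 / 5) * (1 - x))).
  have kp : 0 < k%:R :> R by rewrite ltr0n.
  have e225 : gain `^ m%:R^-1 = (gain `^ k%:R^-1) `^ x :> R.
    rewrite -powRrM; congr (_ `^ _); rewrite /x; field; rewrite !gt_eqF //.
  have eE : eta = eta `^ x * eta `^ (1 - x) by rewrite -powRDr // subrKC powRr1 // ltW.
  have mE : m%:R `^ (- (24 / 5)) = m%:R `^ (- (24 / 5) * x) * m%:R `^ (- (24 / 5) * (1 - x)) :> R.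
    by rewrite -powRDr //; congr (_ `^ _); ring.
  rewrite /weight (powRM _ (ltW e0)) ?mulr_ge0 ?powR_ge0 // powRM ?powR_ge0 //.
  rewrite {1}eE mE e225.
  have h1 : eta `^ (1 - x) <= Num.sqrt eta.
    rewrite -powR12_sqrt ?(ltW e0) //; apply: ger_powR; rewrite ?e0 ?e1 //.
    by move: x2; clear; lra.
  have h2 : m%:R `^ (- (24 / 5) * x) <= (k%:R `^ (- (24 / 5))) `^ x :> R.
    rewrite -powRrM !mulNr; apply: ler_powRN => //; first by rewrite ler_nat leq_addl.
    by rewrite mulr_ge0 // divr_ge0.
  move: h1 h2; set a := eta `^ x; set b := eta `^ (1 - x); set c := _ `^ (- (24 / 5) * x).
  set f := (k%:R `^ _) `^ x; set g := m%:R `^ (_ * (1 - x)); set h := (gain `^ _) `^ x => h1 h2.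
  have -> : a * b * (c * g * h) = b * c * (a * g * h) by ring.
  have -> : a * (f * h) * (Num.sqrt eta * g) = Num.sqrt eta * f * (a * g * h) by ring.
  apply: ler_wpM2r; first by rewrite !mulr_ge0 ?powR_ge0.
  by apply: ler_pM; rewrite ?powR_ge0.
set q := m%:R `^ (11 / 10); set g := m%:R `^ (- (24 / 5) * (1 - x)) in Wm.
have q0 : 0 <= q := powR_ge0 _ _.
have g0 : 0 <= g := powR_ge0 _ _.
have UV0 : 0 <= U `^ th * V `^ x by rewrite mulr_ge0 ?powR_ge0.
have s0 : 0 <= Num.sqrt eta := sqrtr_ge0 _.
apply: le_trans (ler_wpM2l q0 (ler_wpM2r UV0 Wm)) _.
have -> : q * (weight eta k `^ x * (Num.sqrt eta * g) * (U `^ th * V `^ x)) =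
  Num.sqrt eta * (q * g) * (weight eta k `^ x * (U `^ th * V `^ x)) by ring.
apply: le_trans (ler_wpM2l (mulr_ge0 s0 (mulr_ge0 q0 g0)) step1) _.
have -> : Num.sqrt eta * (q * g) * (32 * u `^ x) = 32 * Num.sqrt eta * (q * g * u `^ x) by ring.
apply: ler_wpM2l; first by rewrite mulr_ge0.
have m1 : 1 <= m%:R :> R by rewrite ler1n.
set z := m%:R `^ (12 / 5) * u.
have z0 : 0 <= z by rewrite mulr_ge0 ?powR_ge0.
have zx : z `^ x <= 1 + z.
  have x01 : 0 <= x <= 1 by rewrite x0; move: x2; clear; lra.
  have := weighted_amgm z0 ler01 x01; rewrite powR1 mulr1 => /le_trans; apply.
  rewrite mulr1 addrC lerD //; first by rewrite gerBl.
  by rewrite ler_piMl //; case/andP: x01.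
have uE : u `^ x = m%:R `^ (- (12 / 5 * x)) * z `^ x.
  rewrite /z powRM ?powR_ge0 // -powRrM mulrA -powRDr //.
  by rewrite addNr powRr0 mul1r.
have -> : q * g * u `^ x = m%:R `^ (11 / 10 - 24 / 5 * (1 - x) - 12 / 5 * x) * z `^ x.
  rewrite uE mulrA /q /g -!powRDr //; congr (_ `^ _ * _); ring.
have e25 : m%:R `^ (11 / 10 - 24 / 5 * (1 - x) - 12 / 5 * x) <= m%:R `^ (- (5 / 2)) :> R.
  by apply: ler_powR => //; move: x2; clear; lra.
apply: le_trans (ler_pM (powR_ge0 _ _) (powR_ge0 _ _) e25 zx) _.
rewrite mulrDr mulr1 lerD2l /z mulrA -powRDr // ler_piMl //.
rewrite -[leRHS](powRr0 m%:R); apply: ler_powR => //; clear; lra.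
Qed.

End Weights.

(** * Sums over the splits of all degrees *)

Section Sums.
Variable R : realType.

Lemma sum_ord_nat (F : nat -> R) m :
  \sum_(s < m | (0 < s)%N) F s = \sum_(1 <= s < m) F s.
Proof. by rewrite (big_nat_widenl 1 0) // big_mkord; apply: eq_bigl => s. Qed.

Lemma sum_ord_nat_rev (G : nat -> nat -> R) m :
  \sum_(1 <= k < m) G k (m - k)%N = \sum_(l < m | (0 < l)%N) G (m - l)%N l.
Proof.
rewrite (sum_ord_nat (fun l => G (m - l)%N l)) big_nat_rev /= !big_nat.
by apply: eq_bigr => l /andP[l0 lm]; rewrite add1n subSS subKn // ltnW.
Qed.

Lemma sum_split_sym (K : R) (G H : nat -> nat -> R) M :
  \sum_(1 <= m < M) \sum_(1 <= s < m) K * (G s (m - s)%N + H (m - s)%N s) =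
  K * (\sum_(1 <= m < M) \sum_(1 <= s < m) G s (m - s)%N +
       \sum_(1 <= m < M) \sum_(1 <= s < m) H s (m - s)%N).
Proof.
rewrite -big_split mulr_sumr /=; apply: eq_bigr => m _.
rewrite -mulr_sumr big_split /= (sum_ord_nat_rev H).
by rewrite (sum_ord_nat (fun s => H (m - s)%N s)).
Qed.

Lemma ler_sum_nat_widen (F : nat -> R) k T : (k <= T)%N -> (forall t, 0 <= F t) ->
  \sum_(1 <= t < k) F t <= \sum_(1 <= t < T) F t.
Proof.
move=> kT F0; have [k0|k0] := leqP k 1.
  by rewrite [leLHS]big_geq // sumr_ge0.
by rewrite [leRHS](big_cat_nat (ltnW k0) kT) /= lerDl sumr_ge0.
Qed.

(** The diagonals s + t = m fill a triangle inside a rectangle. The value s = M is missing because t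
    >= 1, which is what the induction on the degree needs. *)
Lemma triangle_sum (G : nat -> nat -> R) M T : (M <= T)%N -> (forall s t, 0 <= G s t) ->
  \sum_(1 <= m < M.+1) \sum_(1 <= s < m) G s (m - s)%N <=
  \sum_(1 <= s < M) \sum_(1 <= t < T) G s t.
Proof.
move=> MT G0.
have -> : \sum_(1 <= m < M.+1) \sum_(1 <= s < m) G s (m - s)%N =
    \sum_(1 <= s < M.+1) \sum_(1 <= t < M.+1 - s) G s t.
  elim: {MT} M => [|M IH]; first by rewrite !big_geq.
  rewrite big_nat_recr //= IH [RHS]big_nat_recr //= subSnn [X in _ = _ + X]big_geq // addr0.
  rewrite -big_split /= !big_nat; apply: eq_bigr => s /andP[s0 sM].
  by rewrite [(M.+2 - s)%N]subSn ?(ltnW sM) // big_nat_recr //= ltn_subRL addn0 -ltnS.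
case: M MT => [|M] MT; first by rewrite !big_geq.
rewrite big_nat_recr //= subSnn [X in _ + X]big_geq // addr0 !big_nat.
apply: ler_sum => s /andP[s0 sM]; apply: ler_sum_nat_widen => //.
by move: MT s0; clear; lia.
Qed.

(** Telescoping: each step amounts to 1/p^3 <= 4 (1/p - 1/q) with p^2 = k + 1 and q^2 = k + 2. *)
Lemma sum_powR_32 M : \sum_(1 <= m < M.+1) m%:R `^ (- (3 / 2)) <= 4 :> R.
Proof.
suff H k : \sum_(1 <= m < k.+1) m%:R `^ (- (3 / 2)) <= 4 * (1 - (Num.sqrt k.+1%:R)^-1) :> R.
  apply: le_trans (H M) _; rewrite -[leRHS]mulr1 ler_wpM2l // gerBl invr_ge0 sqrtr_ge0 //.
elim: k => [|k IH]; first by rewrite big_geq // sqrtr1 invr1 subrr mulr0.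
rewrite big_nat_recr //=; apply: le_trans (lerD IH (lexx _)) _.
have -> : k.+1%:R `^ (- (3 / 2)) = (Num.sqrt k.+1%:R)^-1 ^+ 3 :> R.
  rewrite -powR12_sqrt // exprVn powRN; congr (_^-1).
  by rewrite -powR_mulrn ?powR_ge0 // -powRrM; congr (_ `^ _); rewrite mulrC.
set p : R := Num.sqrt k.+1%:R; set q : R := Num.sqrt k.+2%:R.
have p1 : 1 <= p by rewrite -[leLHS]sqrtr1 ler_wsqrtr // ler1n.
have p2 : p ^+ 2 = k.+1%:R by rewrite sqr_sqrtr.
have q2 : q ^+ 2 = p ^+ 2 + 1 by rewrite p2 sqr_sqrtr // natr1.
have q0 : 0 < q by rewrite sqrtr_gt0.
have p0 : 0 < p by rewrite sqrtr_gt0.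
have pn : p != 0 by rewrite gt_eqF.
have qn : q != 0 by rewrite gt_eqF.
have pqn : p + q != 0 by rewrite gt_eqF ?addr_gt0.
have d : (q - p) * (p + q) = 1.
  have -> : (q - p) * (p + q) = q ^+ 2 - p ^+ 2 by ring.
  by rewrite q2; ring.
have h : 0 <= 4 * p ^+ 2 * (q - p) - q.
  have pq0 : 0 < p + q by rewrite addr_gt0.
  rewrite -(pmulr_lge0 _ pq0).
  have -> : (4 * p ^+ 2 * (q - p) - q) * (p + q) = 4 * p ^+ 2 * ((q - p) * (p + q)) - q * (p + q).
    by ring.
  have := sqr_ge0 (p - q); rewrite d; move: q2 p1; clear; nra.
rewrite -subr_ge0.
have -> : 4 * (1 - q^-1) - (4 * (1 - p^-1) + p^-1 ^+ 3) =
  (4 * p ^+ 2 * (q - p) - q) / (p ^+ 3 * q) by field; rewrite pn qn.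
by rewrite divr_ge0 // mulr_ge0 ?exprn_ge0 ?ltW.
Qed.

End Sums.

(** * Diffuse monomials *)

Section Decomposition.
Variables (R : realType) (N : nat) (w : R[i]).
Hypothesis prim_w : N.-primitive_root w.
Variables n d : nat.
Hypothesis small_d : (2 * d.+1 <= N)%N.
Hypothesis small_nd : (n * d.+1 < N)%N.

Notation mono := {ffun 'I_n -> 'I_d.+1}.
Notation coloring := {ffun 'I_n -> bool}.
Notation ev := (@ev R N w n d.+1).
Notation tavg := (@tavg R N n).
Notation mass := (@mass R n d.+1).

Variable a : mono -> R[i].
Hypothesis a1 : forall z, modC (ev a z) <= 1.

Lemma coef_le1 x : modC (a x) <= 1.
Proof.
rewrite -(@ler_pXn2r _ 2) ?nnegrE ?modC_ge0 // expr1n.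
apply: (@le_trans _ _ (tavg (fun z => modC (ev a z) ^+ 2))).
  rewrite (tavg_sqr prim_w small_d) (bigD1 x) //= lerDl.
  by apply: sumr_ge0 => y _; exact: sqr_ge0.
rewrite -[leRHS](tavg_cst prim_w n); apply: ler_tavg => z.
by rewrite expr_le1 // modC_ge0.
Qed.

Lemma sqr_powR_le (y : R) m : (0 < m)%N -> 0 <= y <= 1 -> (y ^+ 2) `^ rexp R m <= y.
Proof.
move=> m0 /andP[y0 y1]; rewrite -powR_mulrn // -powRrM.
have [->|yn0] := eqVneq y 0.
  by rewrite powR0 // mulf_neq0 ?pnatr_eq0 // gt_eqF // rexp_gt0.
have yp : 0 < y <= 1 by rewrite lt_neqAle eq_sym yn0 y0.
apply: ge1r_powR => //; rewrite /rexp mulrA ler_pdivlMr ?ltr0n // mul1r -natrM ler_nat.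
by move: m0; clear; lia.
Qed.

Lemma sum_split_le (P : pred mono) s t (c : coloring) : (0 < s + t)%N ->
  (forall x, P x -> deg x = s) ->
  \sum_(x | (deg x == s + t)%N && P (res c x)) (modC (a x) ^+ 2) `^ rexp R (s + t) <=
  \sum_(x | P x) \sum_(y | deg y == t) (modC (split_coef a c x y) ^+ 2) `^ rexp R (s + t).
Proof.
move=> m0 Ps; rewrite (sum_splits c) [leRHS]big_mkcond /=; apply: ler_sum => x _.
case: ifPn => Px; last first.
  rewrite big1 // => y /andP[sxy]; have [-> _] := res_mix sxy.
  by rewrite (negbTE Px) andbF.
rewrite [leLHS]big_mkcond [leRHS]big_mkcond /=; apply: ler_sum => y _.
case: ifP => [/andP[sxy /andP[/eqP dxy _]]|_]; last by case: ifP => _; rewrite ?powR_ge0.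
have [e1 e2] := res_mix sxy.
have dy : deg y = t.
  by apply/eqP; rewrite -(eqn_add2l s) -dxy -(deg_mix_res c (mix c x y)) e1 e2 (Ps _ Px).
by rewrite dy eqxx /split_coef sxy.
Qed.

(** [P] is the full degree [s] for the diffuse terms and the set of pure powers for the capped ones.
    The first factor keeps this restriction; the second one drops it to become a full [block]. *)
Lemma split_interpolation (P : pred mono) s t (c : coloring) : (0 < s)%N -> (0 < t)%N ->
  (forall x, P x -> deg x = s) ->
  \sum_(x | (deg x == s + t)%N && P (res c x)) (modC (a x) ^+ 2) `^ rexp R (s + t) <=
  (lr (rexp R s) P (fun x => mass t (split_coef a c x)) `^ (s%:R / (s + t)%:R) *
   block t s a (neg c) `^ (t%:R / (s + t)%:R)) `^ rexp R (s + t).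
Proof.
move=> s0 t0 Ps; have m0 : (0 < s + t)%N by rewrite addn_gt0 s0.
apply: le_trans (sum_split_le _ m0 Ps) _.
have A0 x y : 0 <= modC (split_coef a c x y) ^+ 2 by exact: sqr_ge0.
apply: le_trans (mixed_norm_interpolation P (fun y => deg y == t) s0 t0 A0) _.
apply: (ler_powR2 (ltW (rexp_gt0 R m0))); first by apply: mulr_ge0; exact: powR_ge0.
apply: ler_wpM2l; first exact: powR_ge0.
apply: (ler_powR2 (divr_ge0 (ler0n _ _) (ler0n _ _)) (lr_ge0 _ _ _)).
apply: ler_lr; first exact: rexp_gt0.
move=> y _; rewrite sumr_ge0 //= /mass [leRHS](bigID P) /=.
apply: (@le_trans _ _ (\sum_(x | (deg x == s) && P x) modC (split_coef a (neg c) y x) ^+ 2)).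
  rewrite le_eqVlt; apply/orP; left; apply/eqP; apply: eq_big => [x|x _].
    by case Px: (P x); rewrite ?andbF // andbT (Ps _ Px) eqxx.
  by rewrite split_coef_neg.
by rewrite lerDl; apply: sumr_ge0 => x _; exact: sqr_ge0.
Qed.

Definition diffuse m : pred mono := [pred x | (deg x == m) && [forall i, (2 * x i <= m)%N]].

Definition ublock eta s t c := weight eta s * (vfac R s ^+ t * block s t a c).

Lemma ublock_ge0 eta s t c : 0 < eta -> 0 <= ublock eta s t c.
Proof.
move=> e0; apply: mulr_ge0; first by apply: weight_ge0; exact: ltW.
apply: mulr_ge0; [apply: exprn_ge0 | exact: lr_ge0].
by case: s => [|s]; [rewrite /vfac /= mul0r | rewrite ltW // vfac_gt0].
Qed.

(** The induction cannot handle the splits into degrees 0 and [m]; they disappear because [psi]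
    vanishes at 0 and 1. *)
Lemma psi_res_sum m (c : coloring) (x : mono) (F : R) : deg x = m -> (0 < m)%N -> 0 <= F ->
  psi ((deg (res c x))%:R / m%:R) * F <=
  \sum_(s < m | (0 < s)%N && (deg (res c x) == s)) psi (s%:R / m%:R) * F.
Proof.
move=> dx m0 F0; set s := deg (res c x).
have mn0 : m%:R != 0 :> R by rewrite pnatr_eq0 -lt0n.
have sm : (s <= m)%N by rewrite -dx -(deg_mix_res c x) leq_addr.
have [p0 p1] := psi_end R.
have [s0|s0] := posnP s.
  by rewrite s0 mul0r p0 mul0r sumr_ge0 // => i _; rewrite mulr_ge0 ?psi_ge0.
have [s1|s1] := eqVneq s m.
  by rewrite s1 divff // p1 mul0r sumr_ge0 // => i _; rewrite mulr_ge0 ?psi_ge0.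
have lt_sm : (s < m)%N by rewrite ltn_neqAle s1.
rewrite (bigD1 (Ordinal lt_sm)) /= ?s0 ?eqxx // lerDl sumr_ge0 // => i _.
by rewrite mulr_ge0 ?psi_ge0.
Qed.

(** [mean_psi_ge1] bounds each term by its [psi]-weighted average over the colourings. Jensen's
    inequality for pairs of a colouring and a degree, of total mass at most [m], brings the power 1
    + 1/m inside at the cost of m^(1/m). *)
Lemma diffuse_bound eta m : 0 < eta -> (0 < m)%N ->
  3 `^ m%:R^-1 * (weight eta m * lr (rexp R m) (diffuse m) (fun x => modC (a x) ^+ 2)) <=
  2 ^- n * \sum_(c : coloring) \sum_(1 <= s < m)
    99 / 200 * (ublock eta s (m - s) c + ublock eta (m - s) s (neg c)).
Proof.
move=> e0 m0; have r0 := rexp_gt0 R m0; have r1 := rexp_le1 R m.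
have mp : 0 < m%:R :> R by rewrite ltr0n.
have rV : (rexp R m)^-1 - 1 = m%:R^-1 by rewrite rexpV // addrAC subrr add0r.
pose F x := (modC (a x) ^+ 2) `^ rexp R m.
have F0 x : 0 <= F x := powR_ge0 _ _.
pose T (c : coloring) s := \sum_(x | (deg x == m) && (deg (res c x) == s)) F x.
have T0 c s : 0 <= T c s by apply: sumr_ge0.
pose p : R := 2 ^- n.
have p0 : 0 <= p by rewrite invr_ge0 exprn_ge0.
have A : \sum_(x | diffuse m x) F x <=
    \sum_(q : coloring * 'I_m | (0 < q.2)%N) p * (psi (q.2%:R / m%:R) * T q.1 q.2).
  apply: (@le_trans _ _ (p * \sum_(c : coloring) \sum_(x | deg x == m)
      psi ((deg (res c x))%:R / m%:R) * F x)).
    rewrite exchange_big mulr_sumr /=.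
    rewrite [leRHS](bigID (fun x : mono => [forall i, (2 * x i <= m)%N])) /= ler_wpDr //.
      apply: sumr_ge0 => x _; rewrite mulr_ge0 // sumr_ge0 // => c _.
      by rewrite mulr_ge0 // psi_ge0.
    apply: ler_sum => x /andP[/eqP dx /forallP xle]; rewrite -mulr_suml mulrA.
    rewrite -[leLHS]mul1r ler_wpM2r //.
    apply: le_trans (mean_psi_ge1 R m0 dx xle) _.
    rewrite le_eqVlt; apply/orP; left; apply/eqP; congr (_ * _); apply: eq_bigr => c _.
    congr (psi (_%:R / _)); rewrite /deg big_mkcond; apply: eq_bigr => i _.
    by rewrite !ffunE; case: (c i).
  rewrite -(pair_big xpredT (fun s : 'I_m => (0 < s)%N) (fun c s => p * (psi (s%:R / m%:R) * T c s))) /=.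
  rewrite mulr_sumr; apply: ler_sum => c _; rewrite -mulr_sumr; apply: ler_wpM2l => //.
  apply: (@le_trans _ _ (\sum_(x | deg x == m)
      \sum_(s < m | (0 < s)%N && (deg (res c x) == s)) psi (s%:R / m%:R) * F x)).
    by apply: ler_sum => x /eqP dx; exact: psi_res_sum.
  rewrite (exchange_big_dep (fun s : 'I_m => (0 < s)%N)) /=; last by move=> x s _ /andP[].
  apply: ler_sum => s s0; rewrite /T mulr_sumr.
  rewrite le_eqVlt; apply/orP; left; apply/eqP; apply: eq_bigl => x.
  by rewrite s0.
have U0 s t c : 0 <= block s t a c by exact: lr_ge0.
have Tle c s t : (0 < s)%N -> (0 < t)%N -> (s + t = m)%N ->
    T c s <= (block s t a c `^ (s%:R / m%:R) * block t s a (neg c) `^ (t%:R / m%:R)) `^ rexp R m.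
  move=> s0 t0 st; have h (x : mono) : (deg x == s) -> deg x = s by move/eqP.
  by have := split_interpolation c s0 t0 h; rewrite st.
have step : lr (rexp R m) (diffuse m) (fun x => modC (a x) ^+ 2) <=
   m%:R `^ m%:R^-1 * \sum_(q : coloring * 'I_m | (0 < q.2)%N)
     p * (3 `^ m%:R^-1 * (psi (q.2%:R / m%:R) * (block q.2 (m - q.2) a q.1 `^ (q.2%:R / m%:R) *
        block (m - q.2) q.2 a (neg q.1) `^ ((m - q.2)%:R / m%:R)))).
  have rV0 : 0 <= (rexp R m)^-1 by rewrite invr_ge0 ltW.
  have S0 : 0 <= \sum_(x | diffuse m x) F x by apply: sumr_ge0.
  apply: le_trans (ler_powR2 rV0 S0 A) _.
  have psT (q : coloring * 'I_m) : 0 <= psi (q.2%:R / m%:R) * T q.1 q.2.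
    by rewrite mulr_ge0 // psi_ge0.
  have r01 : 0 < rexp R m <= 1 by rewrite r0.
  apply: le_trans (power_mean_sum (fun _ _ => p0) (fun q _ => psT q) r01) _.
  rewrite rV; apply: ler_pM.
  - exact: powR_ge0.
  - by apply: sumr_ge0 => q _; apply: mulr_ge0 => //; exact: powR_ge0.
  - apply: ler_powR2; [by rewrite invr_ge0 ltW | exact: sumr_ge0 |].
    rewrite -(pair_big xpredT (fun s : 'I_m => (0 < s)%N) (fun _ _ => p)) /=.
    apply: (@le_trans _ _ (\sum_(c : coloring) \sum_(s < m) p)).
      by apply: ler_sum => c _; rewrite [leRHS](bigID (fun s : 'I_m => (0 < s)%N)) /= lerDl sumr_ge0.
    rewrite !sumr_const card_ord card_ffun card_bool card_ord -mulrnA -(mulr_natr p) natrM natrX.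
    by rewrite mulrCA /p mulVf ?mulr1 // gt_eqF ?exprn_gt0.
  - apply: ler_sum => -[c s] /= s0; apply: ler_wpM2l => //.
    have ms : (0 < m - s)%N by rewrite subn_gt0.
    have := Tle c s (m - s)%N s0 ms (subnKC (ltnW (ltn_ord s))).
    set X := block _ _ _ _ `^ _ * _ => TX.
    have X0 : 0 <= X by rewrite mulr_ge0 ?powR_ge0.
    rewrite powRM ?psi_ge0 //.
    have := ler_powR2 rV0 (T0 c s) TX; rewrite powRVK ?gt_eqF // => {}TX.
    apply: le_trans (ler_wpM2l (powR_ge0 _ _) TX) _.
    rewrite mulrA ler_wpM2r // -[(rexp R m)^-1](subrK 1) rV.
    (* y^(1 + 1/m) = y y^(1/m) with [y <= 3]: the source of the second factor 3^(1/m). *)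
    move: (psi_ge0 (s%:R / m%:R : R)) (psi_le3 (s%:R / m%:R : R)); move: (psi _) => y y0 y3.
    rewrite [leRHS]mulrC -(@mulr_powRB1 _ y) // ?addr_gt0 ?invr_gt0 // addrK.
    by apply: ler_wpM2l => //; apply: ler_powR2 => //; rewrite invr_ge0 ltW.
have W0 : 0 <= weight eta m by apply: weight_ge0; exact: ltW.
have c0 : 0 <= 3 `^ m%:R^-1 :> R := powR_ge0 _ _.
apply: le_trans (ler_wpM2l c0 (ler_wpM2l W0 step)) _.
rewrite [leRHS](_ : _ = \sum_(q : coloring * 'I_m | (0 < q.2)%N) p *
    (99 / 200 * (ublock eta q.2 (m - q.2) q.1 + ublock eta (m - q.2) q.2 (neg q.1)))); last first.
  rewrite -/p mulr_sumr -(pair_big xpredT (fun s : 'I_m => (0 < s)%N)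
    (fun c s => p * (99 / 200 * (ublock eta s (m - s) c + ublock eta (m - s) s (neg c))))) /=.
  by apply: eq_bigr => c _; rewrite -sum_ord_nat mulr_sumr.
rewrite !mulr_sumr; apply: ler_sum => -[c s] /= s0.
have ms : (0 < m - s)%N by rewrite subn_gt0.
have := diffuse_term e0 s0 ms (U0 s (m - s)%N c) (U0 (m - s)%N s (neg c)).
rewrite (subnKC (ltnW (ltn_ord s))) => /(ler_wpM2l p0).
rewrite -/(ublock _ _ _ c) -/(ublock _ _ _ (neg c)) => /(le_trans _); apply.
have -> : (9 * m%:R) `^ m%:R^-1 = 3 `^ m%:R^-1 * 3 `^ m%:R^-1 * m%:R `^ m%:R^-1 :> R.
  rewrite -!powRM ?mulr_ge0 //; congr ((_ * _) `^ _); ring.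
have arrange (x W y q z : R) : x * (W * (y * (q * (x * z)))) = q * (x * x * y * (W * z)) by ring.
by rewrite arrange.
Qed.

End Decomposition.

(** * Pure powers and monomials with one dominant exponent *)

Section LargeExponents.
Variables (R : realType) (N : nat) (w : R[i]).
Hypothesis prim_w : N.-primitive_root w.
Variables n d : nat.
Hypothesis small_d : (2 * d.+1 <= N)%N.
Hypothesis small_nd : (n * d.+1 < N)%N.

Notation mono := {ffun 'I_n -> 'I_d.+1}.
Notation coloring := {ffun 'I_n -> bool}.
Notation ev := (@ev R N w n d.+1).
Notation tavg := (@tavg R N n).
Notation mass := (@mass R n d.+1).

Lemma sum_pure_powers_le2 (b : mono -> R[i]) l : (0 < l <= d)%N ->
  (forall z, modC (ev b z) <= 1) ->
  \sum_(x in pure n d l) (modC (b x) ^+ 2) `^ rexp R l <= 2.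
Proof.
move=> ld b1; apply: le_trans (sum_pure_le2 prim_w small_d small_nd ld b1).
apply: ler_sum => x _; apply: sqr_powR_le; first by case/andP: ld.
by rewrite modC_ge0 (coef_le1 prim_w small_d b1).
Qed.

Lemma two_powR_rexpV l (y : R) : (0 < l)%N -> 0 <= y <= 2 -> y `^ (rexp R l)^-1 <= 4.
Proof.
move=> l0 /andP[y0 y2]; have r0 := rexp_gt0 R l0.
apply: (@le_trans _ _ (2 `^ (rexp R l)^-1)).
  by apply: ler_powR2 => //; rewrite invr_ge0 ltW.
have -> : 4 = 2 `^ 2 :> R by rewrite powR_mulrn //; ring.
apply: ler_powR; first by rewrite ler1n.
by rewrite rexpV // -lerBrDl (_ : 2 - 1 = 1) ?invf_le1 ?ltr0n ?ler1n //; ring.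
Qed.

Variable a : mono -> R[i].
Hypothesis a1 : forall z, modC (ev a z) <= 1.

Lemma pure_block_le4 l k (c : coloring) : (0 < l <= d)%N -> (0 < k < N)%N ->
  vfac R l ^+ k * lr (rexp R l) (mem (pure n d l)) (fun x => mass k (split_coef a c x)) <= 4.
Proof.
move=> ld /andP[k0 kN]; have /andP[l0 ld'] := ld.
have r0 := rexp_gt0 R l0; have v0 := vfac_gt0 R l0.
have vk0 : 0 <= vfac R l ^+ k by rewrite exprn_ge0 // ltW.
rewrite -lrZ ?gt_eqF // => [|x _]; last exact: mass_ge0.
apply: two_powR_rexpV => //; apply/andP; split.
  by apply: sumr_ge0 => x _; exact: powR_ge0.
apply: (@le_trans _ _ (tavg (fun z => \sum_(x in pure n d l)
    (modC (ev (split_coef a c x) z) ^+ 2) `^ rexp R l))).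
  rewrite tavg_sum; apply: ler_sum => x _.
  apply: le_trans (degree_hypercontractive prim_w small_d small_nd (split_coef a c x) l0 kN).
  have m0 t : 0 <= vfac R l ^+ t * mass t (split_coef a c x).
    by rewrite mulr_ge0 ?mass_ge0 ?exprn_ge0 // ltW.
  apply: (ler_powR2 (ltW r0) (m0 k)).
  rewrite (bigD1 (Ordinal (ltnSn k))) //= lerDl; apply: sumr_ge0 => t _; exact: m0.
rewrite -[leRHS](tavg_cst prim_w n); apply: ler_tavg => z.
apply: (@sum_pure_powers_le2 (fun x => ev (split_coef a c x) z)) => // y.
by rewrite -ev_mix.
Qed.

(** 2700 = 3 * 225 * 4. The decay of the weight is relaxed from 24/5 to 3/2, the exponent of
    [sum_powR_32]. *)
Lemma pure_bound eta m : 0 < eta -> (0 < m <= d)%N ->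
  3 `^ m%:R^-1 * (weight eta m * lr (rexp R m) (mem (pure n d m)) (fun x => modC (a x) ^+ 2)) <=
  2700 * eta * m%:R `^ (- (3 / 2)).
Proof.
move=> e0 md; have /andP[m0 _] := md.
have mp : 0 < m%:R :> R by rewrite ltr0n.
have l4 : lr (rexp R m) (mem (pure n d m)) (fun x => modC (a x) ^+ 2) <= 4.
  apply: two_powR_rexpV => //; rewrite sum_pure_powers_le2 // andbT.
  by apply: sumr_ge0 => x _; exact: powR_ge0.
have m1 : m%:R^-1 <= 1 :> R by rewrite invf_le1 // ler1n.
have c3 : 3 `^ m%:R^-1 <= 3 :> R by apply: ler1_powR => //; rewrite ler1n.
have cg : gain R `^ m%:R^-1 <= gain R by apply: ler1_powR => //; rewrite ler1n.
have wm : weight eta m <= eta * (m%:R `^ (- (3 / 2)) * gain R).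
  apply: ler_wpM2l; first exact: ltW.
  apply: ler_pM; [exact: powR_ge0|exact: powR_ge0| |exact: cg].
  by apply: ler_powR; [rewrite ler1n | lra].
have W0 : 0 <= weight eta m by apply: weight_ge0; exact: ltW.
apply: le_trans (ler_pM (powR_ge0 _ _) (mulr_ge0 W0 (lr_ge0 _ _ _)) c3
  (ler_pM W0 (lr_ge0 _ _ _) wm l4)) _.
rewrite /gain le_eqVlt; apply/orP; left; apply/eqP; ring.
Qed.

Definition has_cap m : pred mono :=
  [pred x | (deg x == m) && [exists i, (m < 2 * x i)%N && (x i < m)%N]].

Lemma isolates_res (x : mono) i (c : coloring) :
  isolates (fun j => x j) i c -> res c x = atom d (x i) i.
Proof.
move=> /andP[ci /forallP H]; apply/ffunP => j; apply: val_inj; rewrite /= atomE; last by rewrite -ltnS.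
rewrite !ffunE; case: eqP => [->|/eqP ji]; first by rewrite ci.
have := H j; rewrite ji /=; case: posnP => [xj _|_ /negbTE -> //].
by case: (c j); rewrite ?xj.
Qed.

Definition nu_mass : R := (1 - 2^-1 `^ 10^-1)^-1.

Lemma nu_mass_ge1 : 1 <= nu_mass.
Proof.
have q0 : 0 <= 2^-1 `^ 10^-1 :> R := powR_ge0 _ _.
have q1 : 2^-1 `^ 10^-1 < 1 :> R.
  have e1 : 1 `^ 10^-1 = 1 :> R by rewrite powR1.
  by rewrite -[ltRHS]e1 gt0_ltr_powR ?nnegrE ?invr_gt0 ?invr_ge0 //; lra.
by rewrite /nu_mass invf_ge1 ?subr_gt0 // gerBl.
Qed.

(** 3^(1/m) comes from the three classes, the second factor from Jensen's inequality for a measure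
    of that mass, and X = 2 (4m)^(11/10) inverts the bound of [nu_isolates]. One X is at most 32
    m^(11/10); the rest is the 1/m-th power of at most 96 [nu_mass] m^3, and m^3 <= 8^m. *)
Lemma cap_constant m : (0 < m)%N ->
  3 `^ m%:R^-1 * (nu_mass * m%:R) `^ m%:R^-1 *
    (2 * (4 * m%:R) `^ (11 / 10)) `^ (1 + m%:R^-1) <=
  768 * nu_mass * (32 * m%:R `^ (11 / 10)).
Proof.
move=> m0; have mp : 0 < m%:R :> R by rewrite ltr0n.
have mi : 0 <= m%:R^-1 :> R by rewrite invr_ge0 ltW.
have m1 : 1 <= m%:R :> R by rewrite ler1n.
have mi1 : m%:R^-1 <= 1 :> R by rewrite invf_le1.
have C1 := nu_mass_ge1; have C0 : 0 < nu_mass := lt_le_trans ltr01 C1.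
have p1 : 0 < m%:R `^ (11 / 10) :> R := powR_gt0 _ mp.
set X : R := 2 * (4 * m%:R) `^ (11 / 10).
have X1 : X <= 32 * m%:R `^ (11 / 10).
  rewrite /X powRM // mulrA ler_wpM2r ?(ltW p1) //.
  have -> : 32 = 2 * 4 `^ 2 :> R by rewrite powR_mulrn //; ring.
  by apply: ler_wpM2l => //; apply: ler_powR; [rewrite ler1n | lra].
have X0 : 0 < X by rewrite mulr_gt0 // powR_gt0 // mulr_gt0.
have X2 : X <= 32 * m%:R ^+ 2.
  apply: le_trans X1 _; apply: ler_wpM2l => //; rewrite -powR_mulrn ?(ltW mp) //.
  by apply: ler_powR => //; lra.
have XE : X `^ (1 + m%:R^-1) = X * X `^ m%:R^-1.
  by rewrite powRD ?powRr1 ?(ltW X0) // gt_eqF ?implybT.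
have small : 3 `^ m%:R^-1 * (nu_mass * m%:R) `^ m%:R^-1 * X `^ m%:R^-1 <= 768 * nu_mass.
  have nm0 : 0 <= nu_mass * m%:R by rewrite mulr_ge0 // ltW.
  rewrite -(powRM _ (ler0n _ 3) nm0) -powRM ?(ltW X0) ?mulr_ge0 ?(ltW C0) //.
  apply: (@le_trans _ _ ((96 * nu_mass * m%:R ^+ 3) `^ m%:R^-1)).
    apply: (ler_powR2 mi); first by rewrite !mulr_ge0 ?(ltW X0) ?(ltW C0).
    apply: le_trans (ler_wpM2l _ X2) _; first by rewrite mulr_ge0.
    by rewrite le_eqVlt; apply/orP; left; apply/eqP; ring.
  have k1 : 1 <= 96 * nu_mass by rewrite -[leLHS]mulr1 ler_pM // ler1n.
  have k0 : 0 <= 96 * nu_mass := le_trans ler01 k1.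
  rewrite powRM ?exprn_ge0 ?(ltW mp) //.
  have -> : 768 * nu_mass = 96 * nu_mass * 8 by ring.
  apply: ler_pM; rewrite ?powR_ge0 //; first exact: ler1_powR.
  have -> : 8 = (8 ^+ m) `^ m%:R^-1 :> R by rewrite -powR_mulrn // powRVK // gt_eqF.
  apply: (ler_powR2 mi); first by rewrite exprn_ge0 // ltW.
  have -> : 8 = 2 ^+ 3 :> R by ring.
  rewrite -exprM mulnC exprM; apply: lerXn2r; rewrite ?nnegrE ?exprn_ge0 ?(ltW mp) //.
  by rewrite -natrX ler_nat ltnW // ltn_expl.
rewrite XE mulrCA mulrC; apply: ler_pM => //; last exact: ltW.
by rewrite !mulr_ge0 ?powR_ge0.
Qed.

Lemma sum_has_cap_le (m J : nat) (F : mono -> R) : (0 < m <= d)%N -> (4 * m < 2 ^ J)%N ->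
  (forall x, 0 <= F x) ->
  (4 * m%:R) `^ (- (11 / 10)) / 2 * \sum_(x | has_cap m x) F x <=
  \sum_(q : coloring * 'I_m | (m < 2 * q.2)%N) nu R J q.1 *
    \sum_(x | (deg x == m) && (res q.1 x \in pure n d q.2)) F x.
Proof.
move=> /andP[m0 md] mJ F0.
apply: (@le_trans _ _ (\sum_(x | has_cap m x) \sum_(c : coloring) \sum_(l < m | (m < 2 * l)%N &&
    (res c x \in pure n d l)) nu R J c * F x)).
  rewrite mulr_sumr; apply: ler_sum => x /andP[/eqP dx /existsP[i /andP[xi xm]]].
  apply: le_trans (ler_wpM2r (F0 x) (@nu_isolates R n J (fun j => x j) m i m0 mJ dx)) _.
  rewrite mulr_suml big_mkcond /=; apply: ler_sum => c _; case: ifP => [ic|_]; last first.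
    by apply: sumr_ge0 => l _; rewrite mulr_ge0 // nu_ge0.
  rewrite (bigD1 (Ordinal xm)) /=; last by rewrite xi (isolates_res ic) imset_f.
  by rewrite lerDl; apply: sumr_ge0 => l _; rewrite mulr_ge0 // nu_ge0.
rewrite -(pair_big xpredT (fun l : 'I_m => (m < 2 * l)%N) (fun c l => nu R J c *
    \sum_(x | (deg x == m) && (res c x \in pure n d l)) F x)) /=.
rewrite exchange_big; apply: ler_sum => c _.
rewrite (exchange_big_dep (fun l : 'I_m => (m < 2 * l)%N)) /=; last by move=> x l _ /andP[].
apply: ler_sum => l ml; rewrite -mulr_sumr ler_wpM2l ?nu_ge0 //.
rewrite big_mkcond [leRHS]big_mkcond; apply: ler_sum => x _.
rewrite ml /has_cap /=; case: (deg x == m) => //=.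
by case: (res c x \in _); case: ifP => //; rewrite ?andbF.
Qed.

(** As for the diffuse terms, with [nu] as the measure on colourings. The isolated side consists of
    pure powers, bounded by [pure_block_le4], so that only the blocks of [neg c] draw on the
    budget. *)
Lemma cap_bound eta m J : 0 < eta <= 1 -> (0 < m <= d)%N -> (4 * m < 2 ^ J)%N ->
  3 `^ m%:R^-1 * (weight eta m * lr (rexp R m) (has_cap m) (fun x => modC (a x) ^+ 2)) <=
  768 * nu_mass * 32 * (32 * Num.sqrt eta) * \sum_(c : coloring) nu R J c *
    \sum_(1 <= k < m) (m%:R `^ (- (5 / 2)) + ublock a eta k (m - k) (neg c)).
Proof.
move=> eta01 md mJ; have /andP[m0 md'] := md; have /andP[e0 _] := eta01.
have r0 := rexp_gt0 R m0; have r1 := rexp_le1 R m.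
have mp : 0 < m%:R :> R by rewrite ltr0n.
have rV : (rexp R m)^-1 = 1 + m%:R^-1 := rexpV R m0.
have rV0 : 0 <= (rexp R m)^-1 by rewrite invr_ge0 ltW.
have C0 : 0 <= nu_mass := le_trans ler01 nu_mass_ge1.
pose F x := (modC (a x) ^+ 2) `^ rexp R m.
have F0 x : 0 <= F x := powR_ge0 _ _.
pose T (c : coloring) l := \sum_(x | (deg x == m) && (res c x \in pure n d l)) F x.
have T0 c l : 0 <= T c l by apply: sumr_ge0.
pose U c l k := lr (rexp R l) (mem (pure n d l)) (fun x => mass k (split_coef a c x)).
have W0 : 0 <= weight eta m by apply: weight_ge0; exact: ltW.
pose p : R := 2 * (4 * m%:R) `^ (11 / 10).
have p0 : 0 < p by rewrite mulr_gt0 // powR_gt0 // mulr_gt0.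
have A : \sum_(x | has_cap m x) F x <=
    p * \sum_(q : coloring * 'I_m | (m < 2 * q.2)%N) nu R J q.1 * T q.1 q.2.
  rewrite -ler_pdivrMl //; apply: le_trans (sum_has_cap_le md mJ F0).
  by rewrite powRN /p invfM [_^-1 / 2]mulrC.
have nu0 := nu_ge0 R (n := n) J.
have mass_nu : \sum_(q : coloring * 'I_m | (m < 2 * q.2)%N) nu R J q.1 <= nu_mass * m%:R.
  rewrite -(pair_big xpredT (fun l : 'I_m => (m < 2 * l)%N) (fun c _ => nu R J c)) /=.
  apply: (@le_trans _ _ (\sum_(c : coloring) nu R J c * m%:R)).
    apply: ler_sum => c _; rewrite mulr_natr -[X in _ *+ X]card_ord -sumr_const.
    by rewrite [leRHS](bigID (fun l : 'I_m => (m < 2 * l)%N)) /= lerDl sumr_ge0.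
  by rewrite -mulr_suml ler_wpM2r ?ler0n // sum_nu.
have r01 : 0 < rexp R m <= 1 by rewrite r0.
have step : lr (rexp R m) (has_cap m) (fun x => modC (a x) ^+ 2) <=
    p `^ (1 + m%:R^-1) * ((nu_mass * m%:R) `^ m%:R^-1 *
    \sum_(q : coloring * 'I_m | (m < 2 * q.2)%N) nu R J q.1 *
      (U q.1 q.2 (m - q.2)%N `^ (q.2%:R / m%:R) *
       block (m - q.2) q.2 a (neg q.1) `^ ((m - q.2)%:R / m%:R))).
  have S0 : 0 <= \sum_(x | has_cap m x) F x by apply: sumr_ge0.
  apply: le_trans (ler_powR2 rV0 S0 A) _.
  have s0 : 0 <= \sum_(q : coloring * 'I_m | (m < 2 * q.2)%N) nu R J q.1 * T q.1 q.2.
    by apply: sumr_ge0 => q _; rewrite mulr_ge0.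
  rewrite powRM ?(ltW p0) // rV ler_wpM2l ?powR_ge0 // -rV.
  have nq (q : coloring * 'I_m) : 0 <= nu R J q.1 := nu0 _.
  have Tq (q : coloring * 'I_m) : 0 <= T q.1 q.2 := T0 _ _.
  apply: le_trans (power_mean_sum (fun q _ => nq q) (fun q _ => Tq q) r01) _.
  rewrite rV [1 + _]addrC addrK; apply: ler_pM.
  - exact: powR_ge0.
  - by apply: sumr_ge0 => q _; apply: mulr_ge0 => //; exact: powR_ge0.
  - by apply: ler_powR2 => //; rewrite ?invr_ge0 ?(ltW mp) ?sumr_ge0.
  - apply: ler_sum => -[c l] /= ml; apply: ler_wpM2l => //.
    have lm := ltn_ord l; have ms : (0 < m - l)%N by rewrite subn_gt0.
    have l0 : (0 < l)%N by move: ml; case: (nat_of_ord l).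
    have ld : (l <= d)%N by apply: leq_trans (ltnW lm) md'.
    have h (x : mono) : x \in pure n d l -> deg x = l by apply: pure_deg.
    have := split_interpolation a c l0 ms h; rewrite (subnKC (ltnW lm)) => TX.
    have := ler_powR2 rV0 (T0 c l) TX; rewrite powRVK ?gt_eqF ?mulr_ge0 ?powR_ge0 //.
    by rewrite rV [1 + _]addrC.
have c0 : 0 <= 3 `^ m%:R^-1 :> R := powR_ge0 _ _.
apply: le_trans (ler_wpM2l c0 (ler_wpM2l W0 step)) _.
set S := \sum_(q : _ * _ | _) _.
have S0 : 0 <= S by apply: sumr_ge0 => q _; apply: mulr_ge0 => //; apply: mulr_ge0; exact: powR_ge0.
have -> (x W y z : R) : x * (W * (y * (z * S))) = x * z * y * (W * S) by ring.
apply: le_trans (ler_wpM2r (mulr_ge0 W0 S0) (cap_constant m0)) _.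
have -> (x y z q W : R) : x * y * (z * q) * (W * S) = x * y * z * (q * (W * S)) by ring.
rewrite -[leRHS]mulrA; apply: ler_wpM2l.
  by apply: mulr_ge0; [apply: mulr_ge0; [exact: ler0n | exact: C0] | exact: ler0n].
rewrite /S !mulr_sumr.
rewrite -(pair_big xpredT (fun l : 'I_m => (m < 2 * l)%N) (fun c l =>
   m%:R `^ (11 / 10) * (weight eta m * (nu R J c * (U c l (m - l)%N `^ (l%:R / m%:R) *
       block (m - l) l a (neg c) `^ ((m - l)%:R / m%:R)))))) /=.
apply: ler_sum => c _; rewrite mulrCA.
rewrite (sum_ord_nat_rev (fun k l => m%:R `^ (- (5 / 2)) + ublock a eta k l (neg c))).
have t0 (l : 'I_m) : 0 <= m%:R `^ (- (5 / 2)) + ublock a eta (m - l) l (neg c).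
  by rewrite addr_ge0 ?powR_ge0 // ublock_ge0 ?subn_gt0.
rewrite !mulr_sumr big_mkcond [leRHS]big_mkcond /=; apply: ler_sum => l _.
case: ifP => [ml|_]; last first.
  by case: ifP => // _; rewrite mulr_ge0 // mulr_ge0 // mulr_ge0 // sqrtr_ge0.
have l0 : (0 < l)%N by move: ml; case: (nat_of_ord l).
rewrite l0; have lm := ltn_ord l; have ms : (0 < m - l)%N by rewrite subn_gt0.
have kl : (0 < m - l <= l)%N by rewrite ms; move: ml; clear; lia.
have ld : (0 < l <= d)%N by rewrite l0; apply: leq_trans (ltnW lm) md'.
have kN : (0 < m - l < N)%N by rewrite ms; move: small_d md'; clear; lia.
have := cap_term eta01 kl (lr_ge0 _ _ _) (pure_block_le4 c ld kN) (lr_ge0 _ _ _).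
move=> /(_ _ (rexp R (m - l)) (fun x => deg x == (m - l)%N) (fun x => mass l (split_coef a (neg c) x))).
rewrite (subnKC (ltnW lm)) -/(U c l _) -/(block _ _ _ _) => /(ler_wpM2l (nu0 c)).
rewrite -/(ublock a eta _ _ _) => H.
have arrange (x y z q : R) : x * (y * (z * q)) = z * (x * (y * q)) by ring.
by rewrite arrange.
Qed.

End LargeExponents.

(** * The induction on the degree *)

Section Induction.
Variables (R : realType) (N : nat) (w : R[i]).
Hypothesis prim_w : N.-primitive_root w.
Variables n d : nat.
Hypothesis small_d : (2 * d.+1 <= N)%N.
Hypothesis small_nd : (n * d.+1 < N)%N.

Notation mono := {ffun 'I_n -> 'I_d.+1}.
Notation coloring := {ffun 'I_n -> bool}.
Notation ev := (@ev R N w n d.+1).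
Notation weighted_BH := (@weighted_BH R N w n d).

Lemma power_mean3 m (x y z : R) : (0 < m)%N -> 0 <= x -> 0 <= y -> 0 <= z ->
  (x + y + z) `^ (rexp R m)^-1 <=
  3 `^ m%:R^-1 * (x `^ (rexp R m)^-1 + y `^ (rexp R m)^-1 + z `^ (rexp R m)^-1).
Proof.
move=> m0 x0 y0 z0.
have r01 : 0 < rexp R m <= 1 by rewrite rexp_gt0 // rexp_le1.
pose f (i : 'I_3) : R := nth 0 [:: x; y; z] i.
have f0 i : 0 <= f i by case: i => -[|[|[|k]]].
have := @power_mean_sum R 'I_3 predT (fun=> 1) f _ (fun _ _ => ler01) (fun i _ => f0 i) r01.
rewrite sumr_const card_ord rexpV // [1 + _]addrC addrK.
by rewrite !big_ord_recl !big_ord0 /f /= !mul1r !addr0 !addrA.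
Qed.

(** An exponent above m/2 makes a cap unless it equals m, and then the monomial is a pure power. By
    convexity of the power 1 + 1/m three classes only cost 3^(1/m). *)
Lemma coef_lr_split m (a : mono -> R[i]) : (0 < m <= d)%N ->
  coef_lr m a <= 3 `^ m%:R^-1 *
    (lr (rexp R m) (diffuse m) (fun x => modC (a x) ^+ 2) +
     lr (rexp R m) (has_cap m) (fun x => modC (a x) ^+ 2) +
     lr (rexp R m) (mem (pure n d m)) (fun x => modC (a x) ^+ 2)).
Proof.
move=> /andP[m0 md].
pose F x := (modC (a x) ^+ 2) `^ rexp R m.
have F0 x : 0 <= F x := powR_ge0 _ _.
have S0 (P : pred mono) : 0 <= \sum_(x | P x) F x by apply: sumr_ge0.
apply: le_trans (power_mean3 m0 (S0 (diffuse m)) (S0 (has_cap m)) (S0 (mem (pure n d m)))).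
apply: ler_powR2 => //; first by rewrite invr_ge0 ltW // rexp_gt0.
rewrite -/(F _) big_mkcond (big_mkcond (diffuse m)) (big_mkcond (has_cap m)).
rewrite (big_mkcond (mem (pure n d m))) -!big_split /=; apply: ler_sum => x _.
case: eqP => [dx|_]; last by rewrite !addr_ge0 //; case: ifP.
rewrite /diffuse /has_cap /= dx eqxx /=.
have pos (b b' : bool) : 0 <= (if b then F x else 0) + (if b' then F x else 0).
  by rewrite addr_ge0 //; [case: b | case: b'].
case: ifPn => [_|]; first by rewrite -addrA lerDl pos.
move=> /forallPn[j]; rewrite -ltnNge => xj.
case: ifPn => [_|h].
  by rewrite add0r lerDl; case: ifP.
suff -> : x \in pure n d m by rewrite !add0r.
have xjm : x j = m :> nat.
  apply/eqP; rewrite eqn_leq; apply/andP; split.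
    by rewrite -dx /deg (bigD1 j) //= leq_addr.
  by rewrite leqNgt; apply: contra h => xm; apply/existsP; exists j; rewrite xj.
apply/imsetP; exists j => //; apply/ffunP => k; apply: val_inj; rewrite /= atomE //.
case: eqP => [->//|/eqP kj]; apply/eqP; rewrite -leqn0 -(leq_add2l m) addn0 -[X in (_ <= X)%N]dx.
by rewrite /deg (bigD1 j) //= xjm leq_add2l (bigD1 k) //= leq_addr.
Qed.

Lemma ublock_sum_le1 eta M (a : mono -> R[i]) (c : coloring) : 0 < eta -> (M < N)%N ->
  weighted_BH (weight eta) M -> (forall z, modC (ev a z) <= 1) ->
  \sum_(1 <= m < M.+2) \sum_(1 <= s < m) ublock a eta s (m - s) c <= 1.
Proof.
move=> e0 MN H a1.
apply: le_trans (triangle_sum MN (fun s t => ublock_ge0 a s t c e0)) _.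
have W0 m : 0 <= weight eta m by apply: weight_ge0; exact: ltW.
apply: le_trans (block_sum_le1 prim_w small_d small_nd c (leqnn N) W0 H a1).
rewrite le_eqVlt; apply/orP; left; apply/eqP; apply: eq_bigr => s _.
by rewrite -sum_ord_nat mulr_sumr.
Qed.

Definition cap_factor : R := 768 * nu_mass R * 32 * 32.

Variable eta : R.
Hypothesis eta01 : 0 < eta <= 1.
Hypothesis small_eta : cap_factor * (nu_mass R * 5) * Num.sqrt eta + 2700 * 4 * eta <= 100^-1.

Lemma weighted_BH_weight M : (M <= d)%N -> weighted_BH (weight eta) M.
Proof.
elim: M => [|M IH] Md a a1; first by rewrite big_geq.
have {}IH := IH (ltnW Md); have /andP[e0 _] := eta01.
have MN : (M < N)%N by move: small_d Md; clear; lia.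
have C0 : 0 <= nu_mass R := le_trans ler01 (nu_mass_ge1 R).
have B c : \sum_(1 <= m < M.+2) \sum_(1 <= s < m) ublock a eta s (m - s) c <= 1.
  exact: ublock_sum_le1.
(* One number of scales for all degrees: 4m < 2^(m+2) <= 2^(d+2). *)
pose J := d.+3.
have mJ m : (m <= d)%N -> (4 * m < 2 ^ J)%N.
  move=> md; have := ltn_expl m (isT : (1 < 2)%N); rewrite /J !expnS.
  have : (2 ^ m <= 2 ^ d)%N by rewrite leq_exp2l.
  by move: (2 ^ m)%N (2 ^ d)%N => p q; clear; lia.
pose Df m := 2 ^- n * \sum_(c : coloring) \sum_(1 <= s < m)
    99 / 200 * (ublock a eta s (m - s) c + ublock a eta (m - s) s (neg c)).
pose Cp m := cap_factor * Num.sqrt eta * \sum_(c : coloring) nu R J c *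
    \sum_(1 <= k < m) (m%:R `^ (- (5 / 2)) + ublock a eta k (m - k) (neg c)).
pose Pu m : R := 2700 * eta * m%:R `^ (- (3 / 2)).
apply: (@le_trans _ _ (\sum_(1 <= m < M.+2) (Df m + Cp m + Pu m))).
  rewrite !big_nat; apply: ler_sum => m /andP[m0 mM].
  have md : (m <= d)%N by apply: leq_trans Md; rewrite -ltnS.
  have mm : (0 < m <= d)%N by rewrite m0.
  have W0 : 0 <= weight eta m by apply: weight_ge0; exact: ltW.
  apply: le_trans (ler_wpM2l W0 (coef_lr_split a mm)) _.
  rewrite mulrCA !mulrDr; apply: lerD; first apply: lerD.
  - exact: (diffuse_bound a e0 m0).
  - have := cap_bound prim_w small_d small_nd a1 eta01 mm (mJ m md).
    by rewrite /Cp /cap_factor !mulrA.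
  - exact: (pure_bound prim_w small_d small_nd a1 e0 mm).
rewrite !big_split /=.
(* The budget is spent once by [c] and once by [neg c], hence twice 99/200. *)
have D1 : \sum_(1 <= m < M.+2) Df m <= 99 / 100.
  rewrite /Df -mulr_sumr exchange_big /=.
  apply: (@le_trans _ _ (2 ^- n * \sum_(c : coloring) 99 / 100)); last first.
    rewrite sumr_const card_ffun card_bool card_ord -(mulr_natr (99 / 100)) natrX mulrCA.
    by rewrite mulVf ?mulr1 // gt_eqF // exprn_gt0.
  apply: ler_wpM2l; first by rewrite invr_ge0 exprn_ge0.
  apply: ler_sum => c _.
  rewrite (sum_split_sym _ (fun s t => ublock a eta s t c) (fun s t => ublock a eta s t (neg c))).
  have -> : 99 / 100 = 99 / 200 * (1 + 1) :> R by field.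
  by apply: ler_wpM2l; [exact: (divr_ge0 (ler0n _ _) (ler0n _ _)) | exact: lerD].
(* 5 = 4 + 1: the terms m^(-5/2), for m - 1 values of [k], sum to at most 4, and the blocks of
   [neg c] to at most 1. *)
have C1 : \sum_(1 <= m < M.+2) Cp m <= cap_factor * (nu_mass R * 5) * Num.sqrt eta.
  have K0 : 0 <= cap_factor by rewrite /cap_factor !mulr_ge0 ?ler0n.
  rewrite /Cp -mulr_sumr -[leRHS]mulrAC; apply: ler_wpM2l.
    by apply: mulr_ge0 => //; exact: sqrtr_ge0.
  rewrite exchange_big /=.
  apply: (@le_trans _ _ (\sum_(c : coloring) nu R J c * 5)); last first.
    by rewrite -mulr_suml ler_wpM2r ?ler0n // sum_nu.
  apply: ler_sum => c _; rewrite -mulr_sumr; apply: ler_wpM2l; first exact: nu_ge0.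
  have e5 : 4 + 1 = 5 :> R by ring.
  rewrite -[leRHS]e5; under eq_bigr => m _ do rewrite big_split /=.
  rewrite big_split /=; apply: lerD => //.
  apply: le_trans (sum_powR_32 R M.+1); rewrite !big_nat; apply: ler_sum => m /andP[m0 _].
  have mp : 0 < m%:R :> R by rewrite ltr0n.
  rewrite sumr_const_nat -[leLHS]mulr_natl.
  have -> : m%:R `^ (- (3 / 2)) = m%:R * m%:R `^ (- (5 / 2)) :> R.
    by rewrite -{2}[m%:R](powRr1 (ler0n _ m)) -powRDr //; congr (_ `^ _); field.
  by apply: ler_wpM2r; [exact: powR_ge0 | rewrite ler_nat leq_subr].
have P1 : \sum_(1 <= m < M.+2) Pu m <= 2700 * 4 * eta.
  rewrite /Pu -mulr_sumr [leRHS]mulrAC; apply: ler_wpM2l; last exact: sum_powR_32.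
  by apply: mulr_ge0; [exact: ler0n | exact: ltW].
apply: le_trans (lerD (lerD D1 C1) P1) _; rewrite -addrA.
apply: le_trans (lerD (lexx _) small_eta) _.
by rewrite le_eqVlt; apply/orP; left; apply/eqP; field.
Qed.

Lemma coef_lr_le m (a : mono -> R[i]) : (0 < m <= d)%N -> (forall z, modC (ev a z) <= 1) ->
  coef_lr m a <= eta^-1 * m%:R `^ (24 / 5).
Proof.
move=> /andP[m0 md] a1; have /andP[e0 _] := eta01.
have mp : 0 < m%:R :> R by rewrite ltr0n.
have W0 k : 0 <= weight eta k by apply: weight_ge0; exact: ltW.
have L0 k : 0 <= coef_lr k a by exact: lr_ge0.
have : weight eta m * coef_lr m a <= 1.
  apply: le_trans (weighted_BH_weight md a1).
  rewrite big_nat_recr //= lerDr sumr_ge0 // => k _; exact: mulr_ge0.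
rewrite -ler_pdivlMl ?weight_gt0 // mulr1 => /le_trans; apply.
rewrite -[m%:R `^ _]invrK -powRN -invfM lef_pV2 ?posrE ?weight_gt0 ?mulr_gt0 ?powR_gt0 //.
rewrite ler_wpM2l ?(ltW e0) // ler_peMr ?powR_ge0 //.
rewrite -[leLHS](powRr0 (gain R)); apply: ler_powR; last by rewrite invr_ge0 ltW.
by rewrite /gain ler1n.
Qed.

End Induction.

Lemma small_eta_exists (R : realType) (A B : R) : 0 <= A -> 0 <= B ->
  exists2 eta, 0 < eta <= 1 & A * Num.sqrt eta + B * eta <= 100^-1.
Proof.
move=> A0 B0; pose s := (100 * (A + B + 1))^-1.
have k0 : 0 < 100 * (A + B + 1) by apply: mulr_gt0; [rewrite ltr0n | rewrite ltr_wpDl ?addr_ge0].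
have s0 : 0 < s by rewrite invr_gt0.
have s1 : s <= 1 by rewrite invf_le1 //; move: A0 B0; clear; lra.
exists (s ^+ 2); first by rewrite exprn_gt0 // expr_le1 // ltW.
rewrite sqrtr_sqr ger0_norm ?(ltW s0) //.
apply: (@le_trans _ _ ((A + B + 1) * s)); last by rewrite /s invfM mulrCA divff ?mulr1 // gt_eqF // ltr_wpDl ?addr_ge0.
have : B * s ^+ 2 <= B * s by rewrite ler_wpM2l // expr2 ger_pMl.
by move: s0; clear; nra.
Qed.

(** * From the discrete torus to polynomials on the polydisc *)

Section Polynomials.
Variables (R : realType) (n m : nat) (P : mpoly n R[i]).
Hypothesis homog_P : homog_poly R m n P.

Lemma mevalM_homog (r : R[i]) (z : 'I_n -> R[i]) :
  meval (fun i => r * z i) P = r ^+ m * meval z P.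
Proof.
rewrite !mevalE mulr_sumr !big_seq; apply: eq_bigr => al al_P.
under eq_bigr => i _ do rewrite exprMn.
by rewrite big_split prodrXr -mdegE (dhomog_mf homog_P al_P) /= mulrCA.
Qed.

Lemma mdeg_msupp al : al \in msupp P -> mdeg al = m.
Proof. exact: dhomog_mf homog_P al. Qed.

Lemma supnorm_has_sup : has_sup [set modC (meval z P) | z in polydisc R n].
Proof.
split; first by exists (modC (meval (fun=> 0) P)), (fun=> 0) => // i; rewrite modC0.
exists (\sum_(al <- msupp P) modC (mcoeff al P)) => _ [z z1 <-].
rewrite mevalE; apply: le_trans (ler_modC_sum _ _ _) _; apply: ler_sum => al _.
rewrite modCM ler_piMr ?modC_ge0 //.
elim/big_rec: _ => [|i y _ y1]; first by rewrite modC1.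
by rewrite modCM modCX mulr_ile1 ?exprn_ge0 ?modC_ge0 // exprn_ile1 ?modC_ge0 // ltW.
Qed.

Lemma supnorm_ge0 : 0 <= poly_supnorm P.
Proof.
apply: le_trans (modC_ge0 (meval (fun=> 0) P)) _.
by apply: (sup_upper_bound supnorm_has_sup); exists (fun=> 0) => // i; rewrite modC0.
Qed.

(** For r < 1 the point r z lies in the open polydisc, and homogeneity gives r^m |P(z)| <= [s]; the
    torus is reached as r tends to 1. *)
Lemma modC_meval_le_supnorm (z : 'I_n -> R[i]) : (0 < m)%N -> (forall i, modC (z i) <= 1) ->
  modC (meval z P) <= poly_supnorm P.
Proof.
move=> m0 z1; set X := modC _; set s := poly_supnorm P.
have s0 : 0 <= s := supnorm_ge0.
have H (r : R) : 0 <= r < 1 -> r ^+ m * X <= s.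
  move=> /andP[r0 r1]; apply: (sup_upper_bound supnorm_has_sup).
  exists (fun i => (r%:C)%C * z i); last by rewrite mevalM_homog modCM modCX modC_real.
  by move=> i; rewrite modCM modC_real //; apply: le_lt_trans r1; rewrite ler_piMr.
rewrite leNgt; apply/negP => sX.
have mp : 0 < m%:R :> R by rewrite ltr0n.
have Xp : 0 < X := le_lt_trans s0 sX.
have m1 : 1 <= m%:R :> R by rewrite ler1n.
(* Chosen so that (1 - e)^m X >= (1 - m e) X = X - (X - s) / 2 > s. *)
pose e := (X - s) / (2 * m%:R * X).
have D0 : 0 < 2 * m%:R * X by rewrite !mulr_gt0.
have e0 : 0 < e by rewrite divr_gt0 // subr_gt0.
have e1 : e <= 1.
  rewrite ler_pdivrMr // mul1r; apply: (@le_trans _ _ X); first by rewrite gerBl.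
  by rewrite ler_peMl ?(ltW Xp) //; move: m1; lra.
have := H (1 - e); rewrite subr_ge0 e1 gtrBl e0 => /(_ isT).
have eN : -1 <= - e by rewrite lerN2.
have /(ler_wpM2r (ltW Xp)) /le_trans h := bernoulli_ineq m eN => /h.
have -> : (1 + m%:R * - e) * X = X - (X - s) / 2 by rewrite /e; field; rewrite !gt_eqF.
by move: sX; lra.
Qed.

Definition multi (f : {ffun 'I_n -> 'I_m.+1}) : multinom n := Multinom [tuple f i : nat | i < n].

Definition unmulti (al : multinom n) : {ffun 'I_n -> 'I_m.+1} := [ffun i => inord (al i)].

Lemma multiE f i : multi f i = f i.
Proof. exact: mnmE. Qed.

Lemma unmultiK al : al \in msupp P -> multi (unmulti al) = al.
Proof.
move=> al_P; apply/mnmP => i; rewrite multiE ffunE inordK // ltnS.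
by rewrite -(mdeg_msupp al_P) mdegE (bigD1 i) //= leq_addr.
Qed.

Lemma deg_multi f : mdeg (multi f) = deg f.
Proof. by rewrite mdegE; apply: eq_bigr => i _; rewrite multiE. Qed.

Lemma sum_msupp (V : nmodType) (G : multinom n -> V) :
  \sum_(al <- msupp P) G al = \sum_(f | multi f \in msupp P) G (multi f).
Proof.
have uniq_P : uniq (map unmulti (msupp P)).
  rewrite map_inj_in_uniq ?msupp_uniq // => x y xP yP e.
  by rewrite -(unmultiK xP) e unmultiK.
transitivity (\sum_(f <- map unmulti (msupp P)) G (multi f)).
  by rewrite [RHS]big_map; apply: eq_big_seq => al al_P; rewrite unmultiK.
rewrite (big_uniq _ uniq_P); apply: eq_bigl => f; apply/mapP/idP => [[al al_P ->]|fP].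
  by rewrite unmultiK.
exists (multi f) => //; apply/ffunP => i; apply: val_inj.
by rewrite /= ffunE multiE inordK.
Qed.

End Polynomials.

Lemma coef_norm_le (R : realType) (eta : R) n m (P : mpoly n R[i]) :
  0 < eta <= 1 ->
  cap_factor R * (nu_mass R * 5) * Num.sqrt eta + 2700 * 4 * eta <= 100^-1 ->
  homog_poly R m n P -> (0 < m)%N ->
  coef_norm (BH_exponent R m) P / poly_supnorm P <= (Num.sqrt eta)^-1 * m%:R `^ (12 / 5).
Proof.
move=> eta01 small_eta homog_P m0; have /andP[e0 _] := eta01.
set s := poly_supnorm P.
have s0 : 0 <= s := supnorm_ge0 P.
have rhs0 : 0 <= (Num.sqrt eta)^-1 * m%:R `^ (12 / 5).
  by rewrite mulr_ge0 ?powR_ge0 // invr_ge0 sqrtr_ge0.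
have [->|sn0] := eqVneq s 0; first by rewrite invr0 mulr0.
have sp : 0 < s by rewrite lt_neqAle eq_sym sn0.
(* Large enough to avoid aliasing both for squares in one variable and for total degrees. *)
pose N := ((n + 2) * m.+1)%N.
have N0 : (0 < N)%N by rewrite muln_gt0 addnC.
have small_d : (2 * m.+1 <= N)%N by rewrite leq_mul2r leq_addl orbT.
have small_nd : (n * m.+1 < N)%N by rewrite ltn_mul2r /= -[X in (X < _)%N]addn0 ltn_add2l.
have [w prim_w] := prim_root_exists R N0.
pose a (f : {ffun 'I_n -> 'I_m.+1}) : R[i] := mcoeff (multi f) P / (s%:C)%C.
have a1 z : modC (@ev R N w n m.+1 a z) <= 1.
  have -> : @ev R N w n m.+1 a z = meval (fun i => w ^+ z i) P / (s%:C)%C.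
    rewrite mevalE (sum_msupp homog_P) mulr_suml [RHS]big_mkcond; apply: eq_bigr => f _.
    case: ifPn => fP; last by rewrite /a memN_msupp_eq0 // !mul0r.
    rewrite /a mulrAC; congr (_ * _ / _); apply: eq_bigr => i _.
    by rewrite multiE -exprM mulnC.
  rewrite modCM modCV modC_real // ler_pdivrMr // mul1r.
  apply: (modC_meval_le_supnorm homog_P m0) => i; by rewrite (modC_rootX prim_w).
have md : (0 < m <= m)%N by rewrite m0 leqnn.
have := coef_lr_le prim_w small_d small_nd eta01 small_eta md a1.
have r0 := rexp_gt0 R m0.
set q := BH_exponent R m.
have qE : q = 2 * rexp R m by rewrite /q /BH_exponent /rexp natrM mulrA.
have q0 : 0 < q by rewrite qE mulr_gt0.
set T := \sum_(f | multi f \in msupp P) (modC (a f) ^+ 2) `^ rexp R m.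
have T0 : 0 <= T by apply: sumr_ge0 => f _; exact: powR_ge0.
have cE : coef_norm q P / s = T `^ q^-1.
  rewrite /coef_norm (sum_msupp homog_P).
  have -> : \sum_(f : {ffun 'I_n -> 'I_m.+1} | multi f \in msupp P) modC (mcoeff (multi f) P) `^ q = s `^ q * T.
    rewrite /T mulr_sumr; apply: eq_bigr => f _.
    rewrite -powR_mulrn ?modC_ge0 // -powRrM -qE -powRM ?modC_ge0 //.
    by rewrite /a modCM modCV modC_real // mulrCA divff ?mulr1.
  by rewrite powRM ?powR_ge0 // powRVK ?gt_eqF // mulrAC divff // mul1r.
have TL : T `^ (rexp R m)^-1 <= coef_lr m a.
  apply: ler_powR2 => //; first by rewrite invr_ge0 ltW.
  rewrite /T big_mkcond [leRHS]big_mkcond; apply: ler_sum => f _.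
  case: ifP => [fP|_]; last by case: ifP; rewrite ?powR_ge0.
  by rewrite -deg_multi (mdeg_msupp homog_P fP) eqxx.
move=> /(le_trans TL) L.
rewrite cE qE invfM mulrC powRrM powR12_sqrt ?powR_ge0 //.
apply: le_trans (ler_wsqrtr L) _.
rewrite sqrtrM ?invr_ge0 ?(ltW e0) // sqrtrV ?(ltW e0) //.
rewrite -[Num.sqrt (_ `^ _)]powR12_sqrt ?powR_ge0 // -powRrM le_eqVlt; apply/orP; left; apply/eqP.
by congr (_ * _ `^ _); field.
Qed.

(** * The comparison of 12/5 with the growth exponent *)

Section GrowthExponent.
Variable R : realType.

Lemma entropy_gt0 (a : R) : 0 < a < 1 -> 0 < entropy a.
Proof.
move=> /andP[a0 a1].
have l1 : ln a < 0 by rewrite ln_lt0 // a0.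
have l2 : ln (1 - a) < 0 by rewrite ln_lt0 // subr_gt0 a1 gtrBl.
have s0 : 0 < 1 - a by rewrite subr_gt0.
rewrite /entropy subr_gt0 mulNr; apply: (@lt_trans _ _ 0).
  by rewrite pmulr_rlt0.
by rewrite oppr_gt0 pmulr_rlt0.
Qed.

(* Gibbs' inequality against the distribution [(1/7, 6/7)]. *)
Lemma entropy_le (a : R) : 0 < a <= 7^-1 -> entropy a <= ln (7 / 6) + (ln 2 + ln 3) / 7.
Proof.
move=> /andP[a0 a7].
have b0 : 0 < 1 - a by lra.
have gibbs (p q : R) : 0 < p -> 0 < q -> p * ln q - p * ln p <= q - p.
  move=> p0 q0; rewrite -mulrBr -ln_div ?posrE //.
  have h : -1 < q / p - 1 by rewrite ltrBrDr addNr divr_gt0.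
  have := ler_wpM2l (ltW p0) (le_ln1Dx h); rewrite subrKC.
  by rewrite mulrBr mulr1 mulrCA divff ?gt_eqF // mulr1.
have i7 : 0 < 7^-1 :> R by rewrite invr_gt0.
have i67 : 0 < 6 / 7 :> R by rewrite divr_gt0.
have h1 := gibbs _ _ a0 i7; have h2 := gibbs _ _ b0 i67.
have l6 : ln 6 = ln 2 + ln 3 :> R.
  have -> : 6 = 2 * 3 :> R by ring.
  by rewrite lnM ?posrE.
move: h1 h2; rewrite !ln_div ?posrE // lnV ?posrE // l6 /entropy.
have n2 : 0 <= ln 2 :> R by rewrite ln_ge0 // ler1n.
have n3 : 0 <= ln 3 :> R by rewrite ln_ge0 // ler1n.
move: n2 n3; move: (ln 2) (ln 3) (ln 7) => x y z n2 n3.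
have : a * (x + y) <= 7^-1 * (x + y) by rewrite ler_wpM2r // addr_ge0.
move: (ln a) (ln (1 - a)) => u v; lra.
Qed.

(** 9/8, 4/3, 3/4 and 2/3 are built from 2 and 3 only, so that the cubic bound at these points
    yields linear constraints on ln 2 and ln 3. The factor 29/10 is 12/5 + 1/2. *)
Lemma entropy_constant :
  29 / 10 * (ln (7 / 6) + (ln 2 + ln 3) / 7) <= ln 2 + 2^-1 :> R.
Proof.
have l76 := @ln1D_le_cubic R 6^-1.
have l98 := @ln1D_le_cubic R 8^-1.
have l43 := @ln1D_le_cubic R 3^-1.
have l34 := @ln1D_le_cubic R (- 4^-1).
have l23 := @ln1D_le_cubic R (- 3^-1).
have e76 : ln (1 + 6^-1) = ln (7 / 6) :> R by congr ln; field.
have e98 : ln (1 + 8^-1) = 2 * ln 3 - 3 * ln 2 :> R.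
  have -> : 1 + 8^-1 = 3 ^+ 2 / 2 ^+ 3 :> R by field.
  by rewrite ln_div ?posrE ?exprn_gt0 // !lnXn // !mulr_natl.
have e43 : ln (1 + 3^-1) = 2 * ln 2 - ln 3 :> R.
  have -> : 1 + 3^-1 = 2 ^+ 2 / 3 :> R by field.
  by rewrite ln_div ?posrE ?exprn_gt0 // !lnXn // !mulr_natl.
have e34 : ln (1 + - 4^-1) = ln 3 - 2 * ln 2 :> R.
  have -> : 1 + - 4^-1 = 3 / 2 ^+ 2 :> R by field.
  by rewrite ln_div ?posrE ?exprn_gt0 // !lnXn // !mulr_natl.
have e23 : ln (1 + - 3^-1) = ln 2 - ln 3 :> R.
  have -> : 1 + - 3^-1 = 2 / 3 :> R by field.
  by rewrite ln_div ?posrE.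
rewrite e76 in l76; rewrite e98 in l98; rewrite e43 in l43.
rewrite e34 in l34; rewrite e23 in l23.
move: l76 l98 l43 l34 l23; move: (ln (7 / 6)) (ln 2) (ln 3) => x y z.
move=> /(_ ltac:(lra)) h1 /(_ ltac:(lra)) h2 /(_ ltac:(lra)) h3 /(_ ltac:(lra)) h4 /(_ ltac:(lra)) h5.
lra.
Qed.

Lemma B_diff_ge (a : R) : 0 < a <= 7^-1 -> 12 / 5 <= B_diff a.
Proof.
move=> a17; have /andP[a0 a7] := a17.
have a1 : a < 1 by lra.
have h0 : 0 < entropy a by rewrite entropy_gt0 // a0.
have lE : ln (2 * Num.sqrt (expR 1)) = ln 2 + 2^-1 :> R.
  by rewrite lnM ?posrE ?sqrtr_gt0 ?expR_gt0 // -powR12_sqrt ?expR_ge0 // ln_powR expRK mulr1.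
rewrite /B_diff lE lerBrDr ler_pdivlMr //.
apply: le_trans entropy_constant.
have -> : 12 / 5 + 2^-1 = 29 / 10 :> R by field.
by rewrite ler_wpM2l ?divr_ge0 ?ler0n // entropy_le.
Qed.

(** At a = 1/7 the radicand 2 (5/7)^2 - 1 = 1/49 is a perfect square, which makes 1/7 a convenient
    dividing point. *)
Lemma B_cap_ge (a : R) : 7^-1 <= a <= 2^-1 -> 12 / 5 <= B_cap a.
Proof.
move=> /andP[a7 a2]; rewrite /B_cap /mu.
have -> : 2 * ((1 + Num.sqrt (2 * (1 - 2 * a) ^+ 2 - 1)) / 2) =
  1 + Num.sqrt (2 * (1 - 2 * a) ^+ 2 - 1) by field.
have s17 : Num.sqrt (2 * (1 - 2 * a) ^+ 2 - 1) <= 7^-1.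
  have -> : 7^-1 = Num.sqrt (7^-1 ^+ 2) :> R by rewrite sqrtr_sqr ger0_norm // invr_ge0.
  by apply: ler_wsqrtr; nra.
have s0 : 0 <= Num.sqrt (2 * (1 - 2 * a) ^+ 2 - 1) := sqrtr_ge0 _.
have p0 : 0 < 1 + Num.sqrt (2 * (1 - 2 * a) ^+ 2 - 1) by rewrite ltr_pwDl.
rewrite ler_pdivlMr //; lra.
Qed.

Lemma a_max_itv : 0 < a_max R <= 2^-1.
Proof.
rewrite /a_max; have s2 : 1 < Num.sqrt 2 :> R by rewrite -[ltLHS]sqrtr1 ltr_sqrt // ltr1n.
have p2 : 0 < Num.sqrt 2 :> R := lt_trans ltr01 s2.
have i1 : (Num.sqrt 2)^-1 < 1 :> R by rewrite invf_lt1.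
have i0 : 0 < (Num.sqrt 2)^-1 :> R by rewrite invr_gt0.
by apply/andP; split; lra.
Qed.

Lemma beta_star_ge : 12 / 5 <= beta_star R.
Proof.
have /andP[m0 m2] := a_max_itv.
apply: lb_le_inf.
  exists (Num.max (B_diff (a_max R / 2)) (B_cap (a_max R / 2))); exists (a_max R / 2) => //=.
  by apply/andP; split; lra.
move=> _ [a /= /andP[a0 am] <-]; rewrite le_max.
have [a7|a7] := leP a 7^-1; first by rewrite B_diff_ge // a0.
by rewrite B_cap_ge ?orbT // (ltW a7) (le_trans (ltW am)).
Qed.

End GrowthExponent.

(** * Bounds for the constants and the conclusion *)

Section Constants.
Variable R : realType.

Lemma BH_const_le : exists2 K : R, 0 <= K &
  forall m, (0 < m)%N -> (BH_const R m <= (K * m%:R `^ (12 / 5))%:E)%E.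
Proof.
have C0 : 0 <= nu_mass R := le_trans ler01 (nu_mass_ge1 R).
have A0 : 0 <= cap_factor R * (nu_mass R * 5).
  apply: mulr_ge0; last by rewrite mulr_ge0.
  by apply: mulr_ge0; [apply: mulr_ge0; [apply: mulr_ge0; [exact: ler0n|exact: C0]|exact: ler0n]|exact: ler0n].
have B0 : 0 <= 2700 * 4 :> R := mulr_ge0 (ler0n _ _) (ler0n _ _).
have [eta eta01 small_eta] := small_eta_exists A0 B0.
exists (Num.sqrt eta)^-1; first by rewrite invr_ge0 sqrtr_ge0.
move=> m m0; apply: ge_ereal_sup => _ [n n1 <-]; apply: ge_ereal_sup => _ [P [homP _] <-].
by rewrite lee_fin coef_norm_le.
Qed.

(** The monomial z^m in one variable is a witness. Together with the upper bound this makes the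
    constant finite, as [fine] requires. *)
Lemma BH_const_ge0 m : (0 <= BH_const R m)%E.
Proof.
apply: le_ereal_sup_tmp; exists (BH_const_dim R m 1); first by exists 1%N.
pose P : mpoly 1 R[i] := mpolyX R[i] (Multinom [tuple m | i < 1]).
apply: le_ereal_sup_tmp; exists (coef_norm (BH_exponent R m) P / poly_supnorm P)%:E.
  exists P => //; split.
    have deg_m : mdeg (Multinom [tuple m | i < 1]) = m by rewrite mdegE big_ord1 mnmE.
    by rewrite /homog_poly /= dhomogX; apply/eqP.
  apply/eqP => /(congr1 (mcoeff (Multinom [tuple m | i < 1])))/eqP.
  by rewrite mcoeffX mcoeff0 eqxx oner_eq0.
by rewrite lee_fin divr_ge0 ?powR_ge0 // supnorm_ge0.
Qed.

Lemma powR_negligible (K p q : R) : p < q ->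
  (fun m => K * m%:R `^ p) =o_\oo (fun m : nat => m%:R `^ q : R).
Proof.
move=> pq; apply/eqoP => e e0.
have d0 : 0 < q - p by rewrite subr_gt0.
near=> m.
have mp : 0 < m%:R :> R by rewrite ltr0n; near: m; exact: nbhs_infty_gt.
have Km : `|K| / e <= m%:R `^ (q - p).
  have k0 : 0 <= `|K| / e by rewrite divr_ge0 // ltW.
  rewrite -[leLHS](@powRVK _ (q - p)^-1) ?invr_eq0 ?gt_eqF // invrK.
  apply: ler_powR2; rewrite ?powR_ge0 ?(ltW d0) //.
  near: m; exact: nbhs_infty_ger.
rewrite normrM !(ger0_norm (powR_ge0 _ _)).
rewrite -[q](subrK p) powRDr // mulrA ler_wpM2r ?powR_ge0 //.
by rewrite mulrC -ler_pdivrMr.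
Unshelve. all: by end_near.
Qed.

End Constants.

(* The first conjunct makes every [BH_const R m] with [1 <= m] finite, so that
   [fine] loses no information in the second one. *)
Theorem theorem1p2 (R : realType) :
  (forall eps : R, 0 < eps ->
     exists K : R, forall m : nat, (1 <= m)%N ->
       (BH_const R m <= (K * m%:R `^ (beta_star R + eps))%:E)%E) /\
  (fun m : nat => fine (BH_const R m)) =o_\oo
    (fun m : nat => m%:R `^ (5 / 2) : R).
Proof.
have [K K0 BH_le] := BH_const_le R; split=> [eps eps0|].
  exists K => m m1; apply: le_trans (BH_le m m1) _; rewrite lee_fin ler_wpM2l //.
  apply: ler_powR; first by rewrite ler1n.
  by apply: le_trans (beta_star_ge R) _; rewrite lerDl ltW.
have pq : 12 / 5 < 5 / 2 :> R by lra.
apply/eqoP => e e0; have /eqoP/(_ e e0) H := powR_negligible K pq.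
near=> m; have m1 : (0 < m)%N by near: m; exact: nbhs_infty_gt.
apply: (@le_trans _ _ `|K * m%:R `^ (12 / 5)|); last by near: m.
have fin : BH_const R m \is a fin_num.
  by rewrite ge0_fin_numE ?BH_const_ge0 // (le_lt_trans (BH_le m m1)) ?ltry.
rewrite !ger0_norm ?mulr_ge0 ?powR_ge0 ?fine_ge0 ?BH_const_ge0 //.
by rewrite -lee_fin fineK // BH_le.
Unshelve. all: by end_near.
Qed.
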